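(* Let $\mathcal M$ be a rigid special pseudo-Kähler manifold of complex dimension $n$, with metric $g$ of arbitrary signature, Kähler form $\Phi$, complex structure $J$ and flat symplectic connection $\nabla$. Then there exists a locally finite covering of $\mathcal M$ by domains of flat Darboux coordinates $(x^1,\dots,x^n,y_1,\dots,y_n)$ such that on each domain there are holomorphic functions $\eta^j,\lambda_j$ with $\mathrm{Re}(d\eta^j)=dx^j$, $\mathrm{Re}(d\lambda_j)=-dy_j$ and the functions $\eta^1,\dots,\eta^n$ form a system of holomorphic coordinates (special coordinates). In such coordinates there exists locally a holomorphic function $\mathcal F$ with $\lambda_j=-8\,\partial\mathcal F/\partial\eta^j$, and $$\mathcal K_0=2\,\mathrm{Im}\!\left(\frac{\partial\mathcal F}{\partial\eta^k}\bar\eta^k\right)$$ is a Kähler potential: $g\big(\tfrac{\partial}{\partial\eta^i},\tfrac{\partial}{\partial\bar\eta^{\jmath}}\big)=\partial_i\partial_{\bar\jmath}\mathcal K_0$.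
   Context: A rigid special (pseudo-)Kähler manifold is a (pseudo-)Kähler manifold (metric $g$ nondegenerate, $g(JX,JY)=g(X,Y)$, $\Phi(X,Y)=g(X,JY)$ closed, $J$ integrable) with a real, flat, torsion-free linear connection $\nabla$ such that $\nabla\Phi=0$ and $d_\nabla J=0$, where $J$ is viewed as a $T\mathcal M$-valued 1-form and $d_\nabla$ is the covariant exterior differential. The metric is extended complex-bilinearly to complexified tangent vectors. Convention: wedge products are normalized as $\alpha\wedge\beta=\frac12(\alpha\otimes\beta-\beta\otimes\alpha)$. Flat Darboux coordinates are local real coordinates $(x^j,y_j)$ with $\Phi=\sum_j dx^j\wedge dy_j$ (in this normalization) and $\nabla\frac{\partial}{\partial x^j}=\nabla\frac{\partial}{\partial y_j}=0$. *)

(* Defs.v *)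
From HB Require Import structures.
From mathcomp Require Import all_boot all_order all_algebra.
From mathcomp Require Import all_classical all_reals all_analysis.
From mathcomp Require Import complex.

Set Implicit Arguments.
Unset Strict Implicit.
Unset Printing Implicit Defensive.

Import Order.TTheory GRing.Theory Num.Theory.
Import numFieldNormedType.Exports.

Local Open Scope classical_set_scope.
Local Open Scope complex_scope.
Local Open Scope ring_scope.

(* Smooth manifolds are (Hausdorff, second countable) topological spaces with
   a maximal smooth atlas; tensor fields and linear connections are given, as
   in classical tensor calculus, by their components in every chart of the
   maximal atlas, subject to the transformation laws.  All component functions
   are written as functions of the point of the manifold. *)

Section EuclideanSmoothness.
Variables (R : realType) (m : nat).

(* f is of class C^k on D (meant for D open): all iterated partial derivatives
   up to order k exist and are continuous at the points of D. *)
Fixpoint class_C (k : nat) (D : set 'rV[R]_m) (f : 'rV[R]_m -> R) : Prop :=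
  (forall u, D u -> {for u, continuous f}) /\
  match k with
  | 0%N => True
  | k'.+1 => forall a : 'I_m,
      (forall u, D u -> derivable f u (delta_mx 0 a)) /\
      class_C k' D ('D_(delta_mx 0 a) f)
  end.

Definition smooth (D : set 'rV[R]_m) (f : 'rV[R]_m -> R) : Prop :=
  forall k, class_C k D f.

End EuclideanSmoothness.

Section Charts.
Variables (R : realType) (m : nat) (T : topologicalType).

(* Only the values of [coord] on [dom], and of [coordV] on the image of [dom],
   are meaningful. *)
Record chart : Type := Chart {
  dom : set T;
  coord : T -> 'rV[R]_m;
  coordV : 'rV[R]_m -> T }.

Definition is_chart (c : chart) : Prop :=
  [/\ open (dom c),
      open (coord c @` dom c),
      (forall p, dom c p -> coordV c (coord c p) = p),
      (forall p, dom c p -> {for p, continuous (coord c)}) &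
      (forall u, (coord c @` dom c) u -> {for u, continuous (coordV c)})].

(* f is smooth on dom c `&` U, in the coordinates of c *)
Definition smooth_in (c : chart) (U : set T) (f : T -> R) : Prop :=
  smooth (coord c @` (dom c `&` U)) (f \o coordV c).

Definition smooth_transition (c c' : chart) : Prop :=
  forall k : 'I_m, smooth_in c (dom c') (fun p => coord c' p 0 k).

Definition compatible (c c' : chart) : Prop :=
  smooth_transition c c' /\ smooth_transition c' c.

(* the partial derivative of f at p along the a-th coordinate of c *)
Definition pderiv (c : chart) (a : 'I_m) (f : T -> R) (p : T) : R :=
  'D_(delta_mx 0 a) (f \o coordV c) (coord c p).

(* components of df at p in the basis of coordinate differentials of c *)
Definition differential (c : chart) (f : T -> R) (p : T) : 'rV[R]_m :=
  \row_a pderiv c a f p.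

(* entry (k, a) is the derivative of the k-th coordinate of c' along the a-th
   coordinate of c *)
Definition jacobian (c c' : chart) (p : T) : 'M[R]_m :=
  \matrix_(k, a) pderiv c a (fun q => coord c' q 0 k) p.

Definition pderivC (c : chart) (a : 'I_m) (f : T -> R[i]) (p : T) : R[i] :=
  pderiv c a (fun q => complex.Re (f q)) p
  +i* pderiv c a (fun q => complex.Im (f q)) p.

Definition differentialC (c : chart) (f : T -> R[i]) (p : T) : 'rV[R[i]]_m :=
  \row_a pderivC c a f p.

End Charts.

Record smooth_manifold (R : realType) (m : nat) : Type := SmoothManifold {
  carrier :> topologicalType;
  atlas : set (chart R m carrier);
  manifold_hausdorff : hausdorff_space carrier;
  manifold_second_countable : @second_countable carrier;
  atlas_chart : forall c, atlas c -> is_chart c;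
  atlas_cover : forall p, exists2 c, atlas c & dom c p;
  atlas_compatible : forall c c', atlas c -> atlas c' -> compatible c c';
  atlas_maximal : forall c, is_chart c ->
    (forall c', atlas c' -> compatible c c') -> atlas c }.

Section Tensors.
Variables (R : realType) (m : nat) (M : smooth_manifold R m).
Local Notation chart := (chart R m M).

Definition smooth_on (U : set M) (f : M -> R) : Prop :=
  forall c, atlas c -> smooth_in c U f.

(* (0,2)-tensor fields: g c p a b = g(d/dx^a, d/dx^b) at p, for x = coord c *)
Record tensor02 : Type := Tensor02 {
  comp02 :> chart -> M -> 'M[R]_m;
  comp02_smooth : forall c, atlas c -> forall a b,
    smooth_in c (dom c) (fun p => comp02 c p a b);
  comp02_change : forall c c', atlas c -> atlas c' ->
    forall p, dom c p -> dom c' p ->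
    comp02 c p =
    (jacobian c c' p)^T *m comp02 c' p *m jacobian c c' p }.

(* endomorphism fields of the tangent bundle: the image under J of d/dx^b is
   the sum over a of J c p a b times d/dx^a *)
Record tensor11 : Type := Tensor11 {
  comp11 :> chart -> M -> 'M[R]_m;
  comp11_smooth : forall c, atlas c -> forall a b,
    smooth_in c (dom c) (fun p => comp11 c p a b);
  comp11_change : forall c c', atlas c -> atlas c' ->
    forall p, dom c p -> dom c' p ->
    jacobian c c' p *m comp11 c p = comp11 c' p *m jacobian c c' p }.

(* linear connections on the tangent bundle, by their Christoffel symbols:
   christoffel c p k a b is the k-th component of the covariant derivative of
   d/dx^b along d/dx^a *)
Record connection : Type := Connection {
  christoffel :> chart -> M -> 'I_m -> 'I_m -> 'I_m -> R;
  christoffel_smooth : forall c, atlas c -> forall k a b,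
    smooth_in c (dom c) (fun p => christoffel c p k a b);
  christoffel_change : forall c c', atlas c -> atlas c' ->
    forall p, dom c p -> dom c' p -> forall k a b,
    \sum_l jacobian c c' p k l * christoffel c p l a b =
    \sum_d \sum_e christoffel c' p k d e
        * jacobian c c' p d a * jacobian c c' p e b
      + pderiv c a (fun q => jacobian c c' q k b) p }.

Definition torsion_free (nabla : connection) : Prop :=
  forall c, atlas c -> forall p, dom c p -> forall k a b,
    nabla c p k a b = nabla c p k b a.

(* k-th component of R(d/dx^a, d/dx^b) d/dx^l *)
Definition curvature (nabla : connection) (c : chart) (p : M)
    (k l a b : 'I_m) : R :=
  pderiv c a (fun q => nabla c q k b l) p
  - pderiv c b (fun q => nabla c q k a l) p
  + \sum_d (nabla c p k a d * nabla c p d b l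
            - nabla c p k b d * nabla c p d a l).

Definition flat (nabla : connection) : Prop :=
  forall c, atlas c -> forall p, dom c p -> forall k l a b,
    curvature nabla c p k l a b = 0.

Section Form.
Variable (Phi : chart -> M -> 'M[R]_m).

Definition closed2 : Prop :=
  forall c, atlas c -> forall p, dom c p -> forall a b d,
    pderiv c a (fun q => Phi c q b d) p + pderiv c b (fun q => Phi c q d a) p
    + pderiv c d (fun q => Phi c q a b) p = 0.

(* (nabla_{d/dx^a} Phi)(d/dx^b, d/dx^d) = 0 *)
Definition parallel2 (nabla : connection) : Prop :=
  forall c, atlas c -> forall p, dom c p -> forall a b d,
    pderiv c a (fun q => Phi c q b d) p
    - \sum_l nabla c p l a b * Phi c p l d
    - \sum_l nabla c p l a d * Phi c p b l = 0.

End Form.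

(* k-th component of nabla_X (J Y) for X = d/dx^a, Y = d/dx^b *)
Definition nabla_J (nabla : connection) (J : tensor11) (c : chart) (p : M)
    (k a b : 'I_m) : R :=
  pderiv c a (fun q => J c q k b) p + \sum_l nabla c p k a l * J c p l b.

(* d_nabla J = 0, where for a vector-valued 1-form
   (d_nabla J)(X, Y) = nabla_X (J Y) - nabla_Y (J X) - J [X, Y];
   coordinate vector fields commute *)
Definition dnabla_closed (nabla : connection) (J : tensor11) : Prop :=
  forall c, atlas c -> forall p, dom c p -> forall k a b,
    nabla_J nabla J c p k a b - nabla_J nabla J c p k b a = 0.

(* df o J = i df *)
Definition holomorphic (J : tensor11) (U : set M) (f : M -> R[i]) : Prop :=
  [/\ smooth_on U (fun p => complex.Re (f p)),
      smooth_on U (fun p => complex.Im (f p)) &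
      forall c, atlas c -> forall p, U p -> dom c p ->
        differentialC c f p *m map_mx (real_complex R) (J c p) =
        'i%C *: differentialC c f p].

(* the complex-bilinear extension of g, on complexified tangent vectors given
   by their components in c *)
Definition bilinC (g : tensor02) (c : chart) (p : M) (u v : 'cV[R[i]]_m) :
    R[i] :=
  (u^T *m map_mx (real_complex R) (g c p) *m v) 0 0.

(* with the normalization of the wedge product by 1/2 *)
Definition wedge (alpha beta : 'rV[R]_m) : 'M[R]_m :=
  2^-1 *: (alpha^T *m beta - beta^T *m alpha).

End Tensors.

Section SpecialKahler.
Variables (R : realType) (n : nat) (M : smooth_manifold R (n + n)).
Local Notation chart := (chart R (n + n) M).
Variables (g : tensor02 M) (J : tensor11 M) (nabla : connection M).

(* C^n = R^n x R^n, real parts first *)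
Definition real_coords (z : 'I_n -> R[i]) : 'rV[R]_(n + n) :=
  row_mx (\row_j complex.Re (z j)) (\row_j complex.Im (z j)).

(* e is the chart underlying the system of holomorphic coordinates eta *)
Definition holomorphic_coords (e : chart) (eta : 'I_n -> M -> R[i]) : Prop :=
  [/\ atlas e,
      (forall j, holomorphic J (dom e) (eta j)) &
      forall p, dom e p -> coord e p = real_coords (fun j => eta j p)].

(* J is the almost complex structure of a complex manifold *)
Definition integrable : Prop :=
  forall p, exists e eta, dom e p /\ holomorphic_coords e eta.

(* Phi(X, Y) = g(X, J Y) *)
Definition kahler_form (c : chart) (p : M) : 'M[R]_(n + n) :=
  g c p *m J c p.

Record pseudo_kahler : Prop := PseudoKahler {
  metric_symmetric : forall c, atlas c -> forall p, dom c p ->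
    (g c p)^T = g c p;
  metric_nondegenerate : forall c, atlas c -> forall p, dom c p ->
    g c p \in unitmx;
  complex_structure : forall c, atlas c -> forall p, dom c p ->
    J c p *m J c p = - 1%:M;
  complex_structure_integrable : integrable;
  metric_hermitian : forall c, atlas c -> forall p, dom c p ->
    (J c p)^T *m g c p *m J c p = g c p;
  kahler_form_closed : closed2 kahler_form }.

Record rigid_special_kahler : Prop := RigidSpecialKahler {
  special_pseudo_kahler : pseudo_kahler;
  special_flat : flat nabla;
  special_torsion_free : torsion_free nabla;
  special_symplectic : parallel2 kahler_form nabla;
  special_dnabla : dnabla_closed nabla J }.

Definition xcoord (c : chart) (j : 'I_n) (p : M) : R :=
  coord c p 0 (lshift n j).

Definition ycoord (c : chart) (j : 'I_n) (p : M) : R :=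
  coord c p 0 (rshift n j).

(* The coordinate vector fields are parallel iff the Christoffel symbols vanish
   in the chart. *)
Definition flat_darboux (c : chart) : Prop :=
  [/\ atlas c,
      (forall p, dom c p -> kahler_form c p =
         \sum_j wedge (differential c (xcoord c j) p)
                      (differential c (ycoord c j) p)) &
      forall p, dom c p -> forall k a b, nabla c p k a b = 0].

(* c : flat Darboux coordinates (x, y); eta : special coordinates on the same
   domain, with underlying chart e *)
Record special_coords (c e : chart) (eta lambda : 'I_n -> M -> R[i]) : Prop :=
  SpecialCoords {
    special_darboux : flat_darboux c;
    special_same_dom : dom e = dom c;
    special_holo_coords : holomorphic_coords e eta;
    special_holo_lambda : forall j, holomorphic J (dom c) (lambda j);
    special_Re_deta : forall j p, dom c p ->
      map_mx (@complex.Re R) (differentialC c (eta j) p) =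
      differential c (xcoord c j) p;
    special_Re_dlambda : forall j p, dom c p ->
      map_mx (@complex.Re R) (differentialC c (lambda j) p) =
      - differential c (ycoord c j) p }.

(* The following are the Wirtinger operators and the components of the vectors
   d/d eta^j, d/d (conjugate of eta^j), for the chart e of eta. *)
Definition dholo (e : chart) (j : 'I_n) (f : M -> R[i]) (p : M) : R[i] :=
  2^-1 * (pderivC e (lshift n j) f p - 'i%C * pderivC e (rshift n j) f p).

Definition dantiholo (e : chart) (j : 'I_n) (f : M -> R[i]) (p : M) : R[i] :=
  2^-1 * (pderivC e (lshift n j) f p + 'i%C * pderivC e (rshift n j) f p).

Definition vholo (j : 'I_n) : 'cV[R[i]]_(n + n) :=
  2^-1 *: (delta_mx (lshift n j) 0 - 'i%C *: delta_mx (rshift n j) 0).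

Definition vantiholo (j : 'I_n) : 'cV[R[i]]_(n + n) :=
  2^-1 *: (delta_mx (lshift n j) 0 + 'i%C *: delta_mx (rshift n j) 0).

(* 2 Im (sum_k dF/d eta^k * conjugate of eta^k) *)
Definition special_potential (e : chart) (eta : 'I_n -> M -> R[i])
    (F : M -> R[i]) (p : M) : R :=
  2 * complex.Im (\sum_k dholo e k F p * (eta k p)^*%C).

Definition kahler_potential (e : chart) (V : set M) (K : M -> R) : Prop :=
  forall p, V p -> forall i j,
    bilinC g e p (vholo i) (vantiholo j) =
    dholo e i (dantiholo e j (fun q => (K q)%:C)) p.

End SpecialKahler.

Definition locally_finite_cover (T : topologicalType) (I : Type)
    (U : I -> set T) : Prop :=
  [/\ (forall i, open (U i)), \bigcup_i U i = setT &
      forall p, exists2 W, open_nbhs p W &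
        finite_set [set i | (U i `&` W) !=set0]].

(* Main.v *)
(* A parallel coframe for nabla with prescribed value at a point solves the linear
   system d theta_b = Gamma^l_{ab} theta_l dx^a, which flatness makes integrable;
   it is obtained by Picard iteration of the radial homotopy operator of the
   Poincare lemma.  Without torsion its members are closed, hence differentials of
   functions, and these are flat coordinates by the inverse function theorem.  The
   form Phi is constant in them, so they are Darboux coordinates as soon as the
   coframe is symplectic at the point.

   In flat coordinates d_nabla J = 0 says that the rows of J are closed 1-forms, and
   eta^j = x^j - i int dx^j o J, lambda_j = - y_j + i int dy_j o J.  The eta^j are
   coordinates when dx^j, dx^j o J are independent; this holds when the vectors
   dual to the dx^j span a Lagrangian subspace on which g is nondegenerate, and
   such a subspace exists at every point by a Gram-Schmidt process.

   Finally the (2,0)-form sum_j dlambda_j /\ deta^j has real part a multiple of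
   Phi - Phi(J., J.) = 0, so it vanishes and F integrates - lambda_j deta^j / 8. *)

Require Import Defs.
From HB Require Import structures.
From mathcomp Require Import all_boot all_order all_algebra.
From mathcomp Require Import all_classical all_reals all_analysis.
From mathcomp Require Import complex ring lra.
(* Required again, so that [coord] and [jacobian] are those of Defs. *)
Require Import Defs.

Set Implicit Arguments.
Unset Strict Implicit.
Unset Printing Implicit Defensive.

Import Order.TTheory GRing.Theory Num.Theory.
Import numFieldNormedType.Exports.

Local Open Scope classical_set_scope.
Local Open Scope complex_scope.
Local Open Scope ring_scope.

(** * Functions of class C^k *)

(** Two steps resist a direct argument. Uniform convergence of Picard iterates says nothing about
    their derivatives, and a total differential system has solutions only when it is integrable.
    Each iterate is therefore tracked together with its defect, the difference between its partial
    derivatives and the right-hand side. Flatness makes the exterior derivative of the right-hand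
    side linear in the defect, so defects and increments decay together like powers of 1/2. The
    radius of the ball on which this works is fixed before the initial covector, so all members of a
    coframe live on one ball.

    In arbitrary signature a Gram-Schmidt step can break down, because nonzero vectors may be null
    for g. Each step looks for a vector v with g(v, v) nonzero in the g-orthogonal complement of E
    and J E. Nondegeneracy of g on that complement, together with polarization, provides one.
    Orthogonality to E keeps the Gram matrix invertible, and orthogonality to J E keeps the span
    isotropic for Phi. *)

Section NearOpen.
Variable T : topologicalType.
Implicit Types (D : set T) (u v : T).

Lemma near_in_open D u (P : T -> Prop) :
  open D -> D u -> (forall v, D v -> P v) -> \forall v \near u, P v.
Proof.
by move=> oD Du DP; apply: (@filterS _ _ _ D) => //; exact: open_nbhs_nbhs.
Qed.

Lemma continuous_at_near_eq (U : topologicalType) (f g : T -> U) u :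
  {near u, f =1 g} -> {for u, continuous f} -> {for u, continuous g}.
Proof.
move=> fg cf; rewrite /prop_for /continuous_at -(nbhs_singleton fg).
exact: cvg_trans (near_eq_cvg fg) cf.
Qed.

End NearOpen.

Section DirectionalDerivatives.
Variables (R : realType) (V : normedModType R).
Implicit Types (D : set V) (f g : V -> R) (u v w : V).

Lemma line_quotient f w v t h :
  h^-1 *: (((fun s => f (s *: v + w)) \o shift t) (h *: (1 : R)) - f (t *: v + w))
  = h^-1 *: ((f \o shift (t *: v + w)) (h *: v) - f (t *: v + w)).
Proof. by rewrite /= scalerDl -addrA /GRing.scale /= mulr1. Qed.

Lemma is_derive_line f w v t : derivable f (t *: v + w) v ->
  is_derive t 1 (fun s : R => f (s *: v + w)) ('D_v f (t *: v + w)).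
Proof.
move=> df; apply: DeriveDef.
  rewrite /derivable; under eq_fun do rewrite line_quotient.
  exact: df.
rewrite /derive; under eq_fun do rewrite line_quotient.
by [].
Qed.

Lemma MVT_dir f w v : (forall s, 0 <= s <= 1 -> derivable f (s *: v + w) v) ->
  exists2 s, 0 <= s <= 1 & f (v + w) - f w = 'D_v f (s *: v + w).
Proof.
move=> df.
have [||s] := @MVT_segment R (fun s => f (s *: v + w))
    (fun s => 'D_v f (s *: v + w)) 0 1 ler01.
- move=> s; rewrite in_itv /= => /andP[s0 s1].
  by apply: is_derive_line; apply: df; rewrite !ltW.
- apply: derivable_within_continuous => s; rewrite in_itv /= => s01.
  by have [] := is_derive_line (df s s01).
rewrite in_itv /= => s01; rewrite scale1r scale0r add0r subr0 mulr1 => E.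
by exists s.
Qed.

(** Only differentiability along [v] is available, so homogeneity in the direction comes from the
    one-variable chain rule along a line and not from linearity of a differential. *)
Lemma is_deriveZdir f u v (c : R) : derivable f u v ->
  is_derive u (c *: v) f (c * 'D_v f u).
Proof.
move=> df.
have E0 w : u = 0 *: w + u by rewrite scale0r add0r.
have dF : is_derive (c * 0) 1 (fun s : R => f (s *: v + u)) ('D_v f u).
  by have := @is_derive_line f u v (c * 0); rewrite mulr0 -E0; apply.
have dG : is_derive (0 : R) 1 (fun s : R => c * s) c.
  have -> : (fun s : R => c * s) = (c \*: id)%R by apply/funext.
  by apply: is_derive_eq; rewrite /GRing.scale /= mulr1.
have dH := @is_derive1_comp R (fun s : R => f (s *: v + u)) (fun s => c * s) 0 _ _ dF dG.
have EH : (fun s : R => f (s *: v + u)) \o (fun s => c * s)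
  = fun s : R => f (s *: (c *: v) + u).
  by apply/funext => s /=; rewrite scalerA mulrC.
rewrite EH in dH.
apply: DeriveDef.
  by apply/derivable1P; case: dH.
have <- : 'D_1 (fun s : R => f (s *: (c *: v) + u)) 0 = c * 'D_v f u.
  by rewrite mulrC; case: dH.
rewrite /derive [X in _ = lim (X @ _)](_ : _ =
  fun h : R => h^-1 *: ((f \o shift u) (h *: (c *: v)) - f u)) //.
apply/funext => h; have := line_quotient f u (c *: v) 0 h.
by rewrite -E0.
Qed.

Lemma is_derive_from_line f u v (d : R) :
  is_derive (0 : R) 1 (fun s : R => f (s *: v + u)) d -> is_derive u v f d.
Proof.
move=> [df dE]; apply: DeriveDef; first exact/derivable1P.
rewrite -dE /derive; congr (lim _).
suff -> : (fun h : R => h^-1 *: ((f \o shift u) (h *: v) - f u)) =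
  (fun h : R => h^-1 *: (((fun s : R => f (s *: v + u)) \o shift 0) (h *: (1 : R)) -
     f (0 *: v + u))) by [].
apply/funext => h; rewrite line_quotient.
by rewrite scale0r add0r.
Qed.

(** Limits and local inverses are known through estimates only; this turns a first-order estimate
    along a line into a directional derivative. *)
Lemma is_derive_of_bound f u v (g : R) :
  (forall d, 0 < d -> \forall s \near (0 : R),
    `|f (s *: v + u) - f u - s * g| <= d * `|s|) -> is_derive u v f g.
Proof.
move=> key; apply: is_derive_from_line.
have cvg : h^-1 *: (((fun s : R => f (s *: v + u)) \o shift 0) (h *: (1 : R)) -
     f (0 *: v + u)) @[h --> 0^'] --> g.
  apply/cvgrPdist_le => d d0.
  near=> s.
  have s0 : s != 0 by near: s; exact: nbhs_dnbhs_neq.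
  have : `|f (s *: v + u) - f u - s * g| <= d * `|s|.
    by near: s; apply: nbhs_dnbhs; exact: key.
  rewrite /= addr0 [_ *: 1]mulr1 scale0r add0r => h.
  move: h; move: (f (s *: v + u) - f u) => X h.
  have -> : g - s^-1 *: X = - s^-1 * (X - s * g).
    by rewrite /GRing.scale /=; field.
  by rewrite normrM normrN normfV ler_pdivrMl ?normr_gt0 // (mulrC _ d).
apply: DeriveDef; first by apply/cvg_ex; eexists; exact: cvg.
exact/cvg_lim.
Unshelve. all: by end_near.
Qed.

Lemma differentiable_eps f u (df : {linear V -> R}) : continuous df ->
  (forall e, 0 < e ->
    \forall h \near 0, `|f (h + u) - f u - df h| <= e * `|h|) ->
  differentiable f u /\ 'd f u = df :> (V -> R).
Proof.
move=> cdf fe.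
have E : f \o shift u = cst (f u) + df +o_ 0 id.
  apply/eqaddoP => e /fe; apply: filterS => h /=.
  by rewrite !fctE /= opprD addrA.
have dE := diff_unique cdf E; split => //.
by apply/diff_locallyP; rewrite dE.
Qed.

End DirectionalDerivatives.

Section ClassC.
Variables (R : realType) (m : nat).
Implicit Types (D : set 'rV[R]_m) (f g : 'rV[R]_m -> R) (u v w : 'rV[R]_m).

Local Notation pd a f := ('D_(delta_mx 0 a) f).

Lemma class_C_cont k D f u : class_C k D f -> D u -> {for u, continuous f}.
Proof. by case: k => [|k] [cf _] Du; exact: cf. Qed.

Lemma class_C_derivable k D f u a : class_C k.+1 D f -> D u ->
  derivable f u (delta_mx 0 a).
Proof. by move=> [_ /(_ a)[df _]]; exact: df. Qed.

Lemma class_C_pd k D f a : class_C k.+1 D f -> class_C k D (pd a f).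
Proof. by move=> [_ /(_ a)[_]]. Qed.

Lemma class_CS k D f : class_C k.+1 D f -> class_C k D f.
Proof.
elim: k f => [|k IH] f [cf df]; first by split.
by split=> // a; split; [exact: (df a).1|exact/IH/(df a).2].
Qed.

Lemma class_C_le k l D f : (l <= k)%N -> class_C k D f -> class_C l D f.
Proof.
move=> /subnK <-; elim: (k - l)%N => [|j IH] //.
by rewrite addSn => /class_CS.
Qed.

(** Every condition in [class_C] concerns [f] itself near a point, not a restriction of [f], so [W]
    need be neither open nor contained in [D]. *)
Lemma class_C_local k D f :
  (forall u, D u -> exists2 W, W u & class_C k W f) -> class_C k D f.
Proof.
elim: k f => [|k IH] f loc; split=> //.
- by move=> u /loc[W Wu /class_C_cont]; exact.
- by move=> u /loc[W Wu /class_C_cont]; exact.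
move=> a; split=> [u /loc[W Wu /class_C_derivable]|]; first exact.
by apply: IH => u /loc[W Wu fW]; exists W => //; exact: class_C_pd.
Qed.

Lemma class_C_sub k D D' f : D' `<=` D -> class_C k D f -> class_C k D' f.
Proof. by move=> sD fD; apply: class_C_local => u /sD Du; exists D. Qed.

Lemma class_C_ext k D f g : open D -> (forall u, D u -> f u = g u) ->
  class_C k D f -> class_C k D g.
Proof.
move=> oD; have nfg f' g' u : D u -> (forall u, D u -> f' u = g' u) ->
  {near u, f' =1 g'} by move=> Du; exact: near_in_open.
elim: k f g => [|k IH] f g fg [cf df]; split=> //.
- by move=> u Du; apply: continuous_at_near_eq (nfg _ _ _ Du fg) (cf u Du).
- by move=> u Du; apply: continuous_at_near_eq (nfg _ _ _ Du fg) (cf u Du).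
move=> a; split=> [u Du|].
  apply: near_eq_derivable (nfg _ _ _ Du fg) _; exact: (df a).1.
by apply: IH (df a).2 => u Du; apply: near_eq_derive; exact: nfg.
Qed.

Lemma class_C_cst k D c : class_C k D (cst c).
Proof.
elim: k c => [|k IH] c; split=> //.
- by move=> u _; exact: cst_continuous.
- by move=> u _; exact: cst_continuous.
move=> a; split=> [u _|]; first exact: derivable_cst.
have -> // : pd a (cst c) = (cst 0 : 'rV[R]_m -> R).
by apply/funext => u; rewrite derive_cst.
Qed.

Lemma is_derive_coord u v (a : 'I_m) :
  is_derive u v (fun w : 'rV[R]_m => w 0 a) (v 0 a).
Proof.
have lin : linear (fun w : 'rV[R]_m => w 0 a : R) by move=> c w1 w2; rewrite !mxE.
pose L : {linear 'rV[R]_m -> R} := HB.pack (fun w : 'rV[R]_m => w 0 a : R)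
  (GRing.isLinear.Build _ _ _ _ _ lin).
apply: DeriveDef; first exact/diff_derivable/differentiable_coord.
rewrite deriveE; last exact: differentiable_coord.
by rewrite -[fun w => _]/(L : _ -> R) diff_lin //; exact: coord_continuous.
Qed.

Lemma class_C_coord k D (a : 'I_m) : class_C k D (fun u => u 0 a).
Proof.
have cc u : {for u, continuous (fun w : 'rV[R]_m => w 0 a)}.
  exact: coord_continuous.
case: k => [|k]; split=> // b; split=> [u _|].
  by have [] := is_derive_coord u (delta_mx 0 b) a.
have -> : pd b (fun w : 'rV[R]_m => w 0 a) = cst ((delta_mx 0 b : 'rV[R]_m) 0 a).
  by apply/funext => u; have [_] := is_derive_coord u (delta_mx 0 b) a.
exact: class_C_cst.
Qed.

Lemma class_CD k D f g : open D -> class_C k D f -> class_C k D g ->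
  class_C k D (fun u => f u + g u).
Proof.
move=> oD; elim: k f g => [|k IH] f g [cf df] [cg dg]; split=> //.
- by move=> u Du; apply: continuousD; [exact: cf|exact: cg].
- by move=> u Du; apply: continuousD; [exact: cf|exact: cg].
move=> a; split=> [u Du|].
  by apply: derivableD; [exact: (df a).1|exact: (dg a).1].
apply: class_C_ext oD _ (IH _ _ (df a).2 (dg a).2) => u Du /=.
by rewrite deriveD //; [exact: (df a).1|exact: (dg a).1].
Qed.

Lemma class_CN k D f : open D -> class_C k D f -> class_C k D (fun u => - f u).
Proof.
move=> oD; elim: k f => [|k IH] f [cf df]; split=> //.
- by move=> u Du; apply: continuousN; exact: cf.
- by move=> u Du; apply: continuousN; exact: cf.
move=> a; split=> [u Du|]; first by apply: derivableN; exact: (df a).1.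
apply: class_C_ext oD _ (IH _ (df a).2) => u Du /=.
by rewrite deriveN //; exact: (df a).1.
Qed.

Lemma class_CM k D f g : open D -> class_C k D f -> class_C k D g ->
  class_C k D (fun u => f u * g u).
Proof.
move=> oD; elim: k f g => [|k IH] f g fC gC.
  split=> // u Du.
  by apply: continuousM; [exact: class_C_cont fC Du|exact: class_C_cont gC Du].
split=> [u Du|a].
  by apply: continuousM; [exact: class_C_cont fC Du|exact: class_C_cont gC Du].
have df u := @class_C_derivable _ _ _ u a fC.
have dg u := @class_C_derivable _ _ _ u a gC.
split=> [u Du|]; first by apply: derivableM; [exact: df|exact: dg].
apply: class_C_ext oD _ (class_CD oD (IH _ _ (class_CS fC) (class_C_pd a gC))
  (IH _ _ (class_CS gC) (class_C_pd a fC))) => u Du /=.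
by rewrite deriveM //; [exact: df|exact: dg].
Qed.

Lemma class_CV k D f : open D -> (forall u, D u -> f u != 0) ->
  class_C k D f -> class_C k D (fun u => (f u)^-1).
Proof.
move=> oD f0; elim: k => [|k IH] fC.
  by split=> // u Du; apply: continuousV; [exact: f0|exact: class_C_cont fC Du].
split=> [u Du|a].
  by apply: continuousV; [exact: f0|exact: class_C_cont fC Du].
have df u := @class_C_derivable _ _ _ u a fC.
have iC := IH (class_CS fC).
split=> [u Du|]; first by apply: derivableV; [exact: f0|exact: df].
apply: class_C_ext oD _
  (class_CM oD (class_CN oD (class_CM oD iC iC)) (class_C_pd a fC)) => u Du /=.
by rewrite deriveV; [rewrite expr2 invfM|exact: f0|exact: df].
Qed.

Lemma class_C_sum k D (I : Type) (r : seq I) (P : pred I)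
    (F : I -> 'rV[R]_m -> R) : open D ->
  (forall i, P i -> class_C k D (F i)) ->
  class_C k D (fun u => \sum_(i <- r | P i) F i u).
Proof.
move=> oD FC; elim: r => [|i r IH].
  by apply: class_C_ext oD _ (class_C_cst k D 0) => u _; rewrite big_nil.
case Pi: (P i); last by apply: class_C_ext oD _ IH => u _; rewrite big_cons Pi.
apply: class_C_ext oD _ (class_CD oD (FC _ Pi) IH) => u _.
by rewrite big_cons Pi.
Qed.

Lemma class_C_prod k D (I : Type) (r : seq I) (P : pred I)
    (F : I -> 'rV[R]_m -> R) : open D ->
  (forall i, P i -> class_C k D (F i)) ->
  class_C k D (fun u => \prod_(i <- r | P i) F i u).
Proof.
move=> oD FC; elim: r => [|i r IH].
  by apply: class_C_ext oD _ (class_C_cst k D 1) => u _; rewrite big_nil.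
case Pi: (P i); last by apply: class_C_ext oD _ IH => u _; rewrite big_cons Pi.
apply: class_C_ext oD _ (class_CM oD (FC _ Pi) IH) => u _.
by rewrite big_cons Pi.
Qed.

Lemma class_C_det k D p (A : 'rV[R]_m -> 'M[R]_p) : open D ->
  (forall i j, class_C k D (fun u => A u i j)) ->
  class_C k D (fun u => \det (A u)).
Proof.
move=> oD AC; apply: class_C_sum => // s _; apply: class_CM => //.
  exact: class_C_cst.
by apply: class_C_prod.
Qed.

(** By Cramer's rule the entries are cofactors divided by the determinant. *)
Lemma class_C_invmx k D p (A : 'rV[R]_m -> 'M[R]_p) : open D ->
  (forall u, D u -> A u \in unitmx) ->
  (forall i j, class_C k D (fun u => A u i j)) ->
  forall i j, class_C k D (fun u => invmx (A u) i j).
Proof.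
move=> oD uA AC i j.
have dC := class_CV oD _ (class_C_det oD AC).
apply: (@class_C_ext k D (fun u => (\det (A u))^-1 *
    ((-1) ^+ (j + i) * \det (row' j (col' i (A u))))) _ oD).
  by move=> u Du; rewrite /invmx uA // !mxE.
apply: class_CM => //; first by apply: dC => u /uA; rewrite unitmxE unitfE.
apply: class_CM => //; first exact: class_C_cst.
apply: class_C_det => // s t.
by apply: class_C_ext oD _ (AC (lift j s) (lift i t)) => u _; rewrite !mxE.
Qed.

End ClassC.

(** * Total differentials of functions of class C^1 *)

Section ContinuouslyDifferentiable.
Variables (R : realType) (m : nat).
Implicit Types (D : set 'rV[R]_m) (f g : 'rV[R]_m -> R) (u v w : 'rV[R]_m).

Local Notation pd a f := ('D_(delta_mx 0 a) f).

Lemma row_coord_le v (a : 'I_m) : `|v 0 a| <= `|v|.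
Proof.
rewrite [leRHS]/Num.Def.normr /= mx_normrE.
exact: (le_bigmax _ (fun ij : 'I_1 * 'I_m => `|v ij.1 ij.2|) (0, a)).
Qed.

Lemma row_norm_le v (c : R) : 0 <= c -> (forall a, `|v 0 a| <= c) -> `|v| <= c.
Proof.
move=> c0 vc; rewrite [leLHS]/Num.Def.normr /= mx_normrE.
by apply: bigmax_le => // -[i j] _ /=; rewrite ord1.
Qed.

Lemma row_norm_lt v (c : R) : 0 < c -> (forall a, `|v 0 a| < c) -> `|v| < c.
Proof.
move=> c0 vc; rewrite [ltLHS]/Num.Def.normr /= mx_normrE.
by apply: bigmax_lt => // -[i j] _ /=; rewrite ord1.
Qed.

(** The corners of a path from 0 to [v] whose edges are parallel to the axes; only partial
    derivatives are needed along such a path. *)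
Definition row_cut (k : nat) v : 'rV[R]_m := \row_j (if (j < k)%N then v 0 j else 0).

Lemma row_cutS (k : nat) v (a : 'I_m) : a = k :> nat ->
  row_cut k.+1 v = v 0 a *: delta_mx 0 a + row_cut k v.
Proof.
move=> ak; apply/rowP => j; rewrite !mxE eqxx /= ltnS leq_eqVlt -ak.
have [->|ne] := eqVneq j a; first by rewrite eqxx ltnn mulr1 addr0.
by rewrite -(inj_eq val_inj) in ne; rewrite (negbTE ne) mulr0 add0r.
Qed.

Lemma C1_expansion D f u : open D -> class_C 1 D f -> D u ->
  forall e, 0 < e -> \forall h \near (0 : 'rV[R]_m),
    `|f (h + u) - f u - \sum_a h 0 a * pd a f u| <= e * `|h|.
Proof.
move=> oD fC Du e e0.
(* Each of the [m] edges of the path contributes an error of at most [e'] times the norm of [h].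
   Dividing by [m.+1] keeps the denominator nonzero in dimension 0. *)
have e'0 : 0 < e / m.+1%:R by rewrite divr_gt0.
set e' := e / m.+1%:R in e'0.
have : \forall v \near u, D v /\ forall a, `|pd a f v - pd a f u| <= e'.
  have : \forall v \near u, forall a : 'I_m, `|pd a f v - pd a f u| <= e'.
    apply: (@filter_forall _ _ (fun a v => `|pd a f v - pd a f u| <= e')
      (nbhs u)) => a; have /cvgrPdist_le /(_ _ e'0) := class_C_cont (class_C_pd a fC) Du.
    by apply: filterS => v; rewrite distrC.
  by apply: filterS2; [move=> v; exact: conj|exact: open_nbhs_nbhs].
move=> /nbhs_ballP[d /= d0 dP].
apply/nbhs_ballP; exists d => //= h; rewrite -ball_normE /= sub0r normrN => hd.
have {}dP w : `|w| <= `|h| -> D (w + u) /\ forall a, `|pd a f (w + u) - pd a f u| <= e'.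
  move=> wh; apply: dP; rewrite -ball_normE /= opprD addrC subrK normrN.
  exact: le_lt_trans hd.
have step k : (k <= m)%N -> `|f (row_cut k h + u) - f u -
    \sum_(a < m | (a < k)%N) h 0 a * pd a f u| <= e' * `|h| *+ k.
  elim: k => [|k IH] km.
    have -> : row_cut 0 h = 0 by apply/rowP => j; rewrite !mxE.
    by rewrite add0r subrr big_pred0 // subr0 normr0 mulr0n.
  pose a : 'I_m := Ordinal km.
  rewrite (row_cutS h (erefl : a = k :> nat)) (bigD1 a) //=.
  rewrite (eq_bigl (fun b : 'I_m => (b < k)%N)); last first.
    move=> b; rewrite ltnS leq_eqVlt -(inj_eq val_inj) /=.
    by case: ltngtP.
  have cut s : 0 <= s <= 1 -> `|s *: (h 0 a *: delta_mx 0 a) + row_cut k h| <= `|h|.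
    move=> /andP[s0 s1]; apply: row_norm_le => // j; rewrite !mxE eqxx /=.
    have [->|ja] := eqVneq j a.
      rewrite ltnn addr0 mulr1 normrM ger0_norm //.
      by rewrite (le_trans _ (row_coord_le h a)) // ler_piMl.
    rewrite mulr0 mulr0 add0r; case: ifP => _; first exact: row_coord_le.
    by rewrite normr0.
  have [|s s01 E] := @MVT_dir R _ f (row_cut k h + u) (h 0 a *: delta_mx 0 a).
    move=> s s01.
    suff df : derivable f (s *: (h 0 a *: delta_mx 0 a) + (row_cut k h + u))
      (delta_mx 0 a) by have [] := is_deriveZdir (h 0 a) df.
    by rewrite addrA; apply: class_C_derivable fC _; have [] := dP _ (cut s s01).
  have [Dw /(_ a) pw] := dP _ (cut s s01).
  have [_ E2] := is_deriveZdir (h 0 a) (class_C_derivable (a := a) fC Dw).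
  rewrite !addrA E2 in E.
  set w := s *: _ + _ + u in E pw Dw *.
  have -> : f (h 0 a *: delta_mx 0 a + row_cut k h + u) =
    h 0 a * pd a f w + f (row_cut k h + u) by rewrite -E subrK.
  rewrite mulrSr.
  have -> : h 0 a * pd a f w + f (row_cut k h + u) - f u -
      (h 0 a * pd a f u + \sum_(b < m | (b < k)%N) h 0 b * pd b f u) =
    (f (row_cut k h + u) - f u - \sum_(b < m | (b < k)%N) h 0 b * pd b f u) +
    h 0 a * (pd a f w - pd a f u) by ring.
  rewrite (le_trans (ler_normD _ _)) // lerD //; first exact/IH/ltnW.
  by rewrite normrM mulrC ler_pM // row_coord_le.
have := step m (leqnn m).
have -> : row_cut m h = h by apply/rowP => j; rewrite mxE ltn_ord.
rewrite [X in X <= _ -> _](_ : _ = `|f (h + u) - f u - \sum_a h 0 a * pd a f u|).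
  2: by congr (`|_ - _|); apply: eq_bigl => b; exact: ltn_ord.
move=> /le_trans; apply; rewrite -mulrnAl ler_wpM2r //.
rewrite /e' -mulr_natr mulrAC ler_pdivrMr // ler_pM2l // ler_nat //.
Qed.

Definition dsum f u : 'rV[R]_m -> R := fun h => \sum_a h 0 a * pd a f u.

Lemma dsum_linear f u : linear (dsum f u).
Proof.
move=> c h k; rewrite /dsum /GRing.scale /= mulr_sumr -big_split /=.
by apply: eq_bigr => a _; rewrite !mxE; ring.
Qed.

HB.instance Definition _ f u := GRing.isLinear.Build _ _ _ _ (dsum f u)
  (dsum_linear f u).

Lemma dsum_continuous f u : continuous (dsum f u).
Proof.
move=> h; apply: (@class_C_cont _ _ 0 setT) => //.
apply: class_C_sum => [|a _]; first exact: openT.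
by apply: class_CM; [exact: openT|exact: class_C_coord|exact: class_C_cst].
Qed.

Lemma C1_differentiable D f u : open D -> class_C 1 D f -> D u ->
  differentiable f u.
Proof.
move=> oD fC Du.
by have [] := differentiable_eps (@dsum_continuous f u) (C1_expansion oD fC Du).
Qed.

Lemma C1_derive D f u v : open D -> class_C 1 D f -> D u ->
  'D_v f u = \sum_a v 0 a * pd a f u.
Proof.
move=> oD fC Du.
have [df dE] := differentiable_eps (@dsum_continuous f u) (C1_expansion oD fC Du).
by rewrite deriveE // dE.
Qed.

Lemma C1_derivable D f u v : open D -> class_C 1 D f -> D u -> derivable f u v.
Proof. by move=> oD fC Du; apply: diff_derivable; exact: C1_differentiable fC Du. Qed.

Lemma class_CS_intro k D f : open D ->
  (forall u a, D u -> derivable f u (delta_mx 0 a)) ->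
  (forall u, D u -> {for u, continuous f}) ->
  (forall a, class_C k D (pd a f)) -> class_C k.+1 D f.
Proof. by move=> oD df cf pC; split=> // a; split=> [u Du|//]; exact: df. Qed.

End ContinuouslyDifferentiable.

Section Composition.
Variables (R : realType) (p : nat).

Local Notation pd a f := ('D_(delta_mx 0 a) f).

Lemma row_continuous (T : topologicalType) (G : T -> 'rV[R]_p) u :
  (forall b, {for u, continuous (fun w => G w 0 b)}) -> {for u, continuous G}.
Proof.
move=> cG; apply/cvgrPdist_lt => e e0.
have : \forall w \near u, forall b : 'I_p, `|G u 0 b - G w 0 b| < e.
  apply: (@filter_forall _ _ (fun b w => `|G u 0 b - G w 0 b| < e) (nbhs u)).
  by move=> b; have /cvgrPdist_lt := cG b; exact.
by apply: filterS => w Gw; apply: row_norm_lt => // b; rewrite !mxE.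
Qed.

Lemma coord_continuous_at (T : topologicalType) (G : T -> 'rV[R]_p) u b :
  {for u, continuous G} -> {for u, continuous (fun w => G w 0 b)}.
Proof.
move=> cG; apply: (continuous_comp (f := G) (g := fun w : 'rV[R]_p => w 0 b)) => //.
exact: coord_continuous.
Qed.

Variable V : normedModType R.

Lemma row_differentiable (G : V -> 'rV[R]_p) u :
  (forall b, differentiable (fun w => G w 0 b) u) -> differentiable G u.
Proof.
move=> dG; have -> : G = \sum_b (fun w => G w 0 b *: (delta_mx 0 b : 'rV[R]_p)).
  apply/funext => w; rewrite fct_sumE.
  by rewrite -row_sum_delta.
apply: differentiable_sum => b.
exact: (@differentiableZl _ _ _ (fun w => G w 0 b)).
Qed.

Lemma is_derive_comp_row (G : V -> 'rV[R]_p) (f : 'rV[R]_p -> R) u v :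
  (forall b, differentiable (fun w => G w 0 b) u) -> differentiable f (G u) ->
  is_derive u v (fun w => f (G w))
    (\sum_b 'D_v (fun w => G w 0 b) u * pd b f (G u)).
Proof.
move=> dGb df; have dG := row_differentiable dGb.
have dfG : differentiable (fun w => f (G w)) u.
  exact: (@differentiable_comp _ _ _ _ G f).
apply: DeriveDef; first exact: diff_derivable.
rewrite deriveE // (@diff_comp _ _ _ _ G f) //=.
rewrite (row_sum_delta ('d G u v)) linear_sum /=; apply: eq_bigr => b _.
rewrite linearZ /= -!deriveE // derive_mx; last exact: diff_derivable.
by rewrite mxE.
Qed.

End Composition.

Section ClassCComposition.
Variables (R : realType) (m p : nat).

Local Notation pd a f := ('D_(delta_mx 0 a) f).

Lemma is_derive_comp_C1 (D : set 'rV[R]_m) (E : set 'rV[R]_p)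
    (G : 'rV[R]_m -> 'rV[R]_p) (f : 'rV[R]_p -> R) u v :
  open D -> open E -> (forall b, class_C 1 D (fun w => G w 0 b)) ->
  class_C 1 E f -> D u -> E (G u) ->
  is_derive u v (fun w => f (G w))
    (\sum_b 'D_v (fun w => G w 0 b) u * pd b f (G u)).
Proof.
move=> oD oE GC fC Du EGu; apply: is_derive_comp_row.
  by move=> b; exact: C1_differentiable (GC b) Du.
exact: C1_differentiable fC EGu.
Qed.

Lemma class_C_comp k (D : set 'rV[R]_m) (E : set 'rV[R]_p)
    (G : 'rV[R]_m -> 'rV[R]_p) (f : 'rV[R]_p -> R) :
  open D -> open E -> (forall u, D u -> E (G u)) ->
  (forall b, class_C k D (fun w => G w 0 b)) -> class_C k E f ->
  class_C k D (fun u => f (G u)).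
Proof.
move=> oD oE DE; have cont f' l l' : (forall b, class_C l D (fun w => G w 0 b)) ->
    class_C l' E f' -> forall u, D u -> {for u, continuous (fun u => f' (G u))}.
  move=> GC f'C u Du; apply: (continuous_comp (f := G)).
    by apply: row_continuous => b; exact: class_C_cont (GC b) Du.
  exact: class_C_cont f'C (DE _ Du).
elim: k f => [|k IH] f GC fC.
  by split=> //; exact: cont GC fC.
have GC1 b : class_C 1 D (fun w => G w 0 b) by exact: class_C_le (GC b).
have fC1 : class_C 1 E f by exact: class_C_le fC.
have dfG a u Du := @is_derive_comp_C1 D E G f u (delta_mx 0 a) oD oE GC1 fC1 Du (DE _ Du).
apply: (@class_CS_intro _ _ k D _ oD).
- by move=> u a Du; have [] := dfG a u Du.
- exact: cont GC fC.
move=> a; apply: (@class_C_ext _ _ _ _ (fun u =>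
  \sum_b pd a (fun w => G w 0 b) u * pd b f (G u))) => //.
  by move=> u Du; have [_] := dfG a u Du.
apply: class_C_sum => // b _; apply: class_CM => //.
  exact/class_C_pd/GC.
have fbC : class_C k E (pd b f) by exact: class_C_pd.
apply: (IH (pd b f)) => // c; exact: class_CS (GC c).
Qed.

End ClassCComposition.

Section Segments.
Variables (R : realType) (m : nat).
Implicit Types (D : set 'rV[R]_m) (f : 'rV[R]_m -> R) (u v c : 'rV[R]_m).

Local Notation pd a f := ('D_(delta_mx 0 a) f).

Lemma ball_segment c (r : R) u v s : ball c r u -> ball c r v -> 0 <= s <= 1 ->
  ball c r (s *: (v - u) + u).
Proof.
rewrite -ball_normE /= => cu cv /andP[s0 s1].
have -> : c - (s *: (v - u) + u) = (1 - s) *: (c - u) + s *: (c - v).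
  by apply/rowP => j; rewrite !mxE; ring.
rewrite (le_lt_trans (ler_normD _ _)) // !normrZ !ger0_norm // ?subr_ge0 //.
have [->|sn1] := eqVneq s 1; first by rewrite subrr mul0r add0r mul1r.
have s1' : 0 < 1 - s by rewrite subr_gt0 lt_neqAle sn1.
apply: (@lt_le_trans _ _ ((1 - s) * r + s * r)); last by rewrite -mulrDl subrK mul1r.
by rewrite ltr_leD // ?ltr_pM2l // ler_wpM2l // ltW.
Qed.

Lemma C1_MVT D f u v : open D -> class_C 1 D f ->
  (forall s, 0 <= s <= 1 -> D (s *: (v - u) + u)) ->
  exists2 s, 0 <= s <= 1 &
    f v - f u = \sum_a (v - u) 0 a * pd a f (s *: (v - u) + u).
Proof.
move=> oD fC Ds; have [|s s01] := @MVT_dir R _ f u (v - u).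
  by move=> s /Ds Dw; exact: C1_derivable fC Dw.
rewrite subrK => ->; exists s => //.
by rewrite (C1_derive _ oD fC) //; exact: Ds.
Qed.

Lemma ball_pd_eq0 c (r : R) f u : class_C 1 (ball c r) f ->
  (forall v a, ball c r v -> pd a f v = 0) -> ball c r u -> f u = f c.
Proof.
move=> fC f0 cu; have r0 : 0 < r.
  by move: cu; rewrite -ball_normE /=; apply: le_lt_trans.
have cc : ball c r c by exact: ballxx.
have seg s : 0 <= s <= 1 -> ball c r (s *: (u - c) + c) by exact: ball_segment.
have [s s01 E] := C1_MVT (ball_open c r) fC seg.
apply/eqP; rewrite -subr_eq0 E; apply/eqP; apply: big1 => a _.
by rewrite f0 ?mulr0 //; exact: seg.
Qed.

End Segments.

(** * The Poincare lemma *)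

Section UnitIntegral.
Variable R : realType.
Implicit Types (phi psi : R -> R).

Definition int01 phi : R := \int[lebesgue_measure]_(t in `[0, 1]) phi t.

(** Continuity is two-sided even at 0 and 1. The integrands below satisfy this because the segments
    they run along lie in an open ball. *)
Definition cont01 phi := forall t : R, 0 <= t <= 1 -> {for t, continuous phi}.

Lemma cont01_integrable phi : cont01 phi ->
  lebesgue_measure.-integrable `[0, 1] (EFin \o phi).
Proof.
move=> cphi; apply: continuous_compact_integrable; first exact: segment_compact.
apply: continuous_in_subspaceT => t; rewrite inE /= in_itv /=; exact: cphi.
Qed.

Lemma eq_int01 phi psi : (forall t : R, 0 <= t <= 1 -> phi t = psi t) ->
  int01 phi = int01 psi.
Proof.
by move=> E; apply: eq_Rintegral => t; rewrite inE /= in_itv /=; exact: E.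
Qed.

Lemma int01D phi psi : cont01 phi -> cont01 psi ->
  int01 (fun t => phi t + psi t) = int01 phi + int01 psi.
Proof. by move=> /cont01_integrable ? /cont01_integrable ?; exact: RintegralD. Qed.

Lemma int01B phi psi : cont01 phi -> cont01 psi ->
  int01 (fun t => phi t - psi t) = int01 phi - int01 psi.
Proof. by move=> /cont01_integrable ? /cont01_integrable ?; exact: RintegralB. Qed.

Lemma int01Z (c : R) phi : cont01 phi -> int01 (fun t => c * phi t) = c * int01 phi.
Proof. by move=> /cont01_integrable ?; exact: RintegralZl. Qed.

Lemma cont01_cst (c : R) : cont01 (fun=> c).
Proof. by move=> t _; exact: cst_continuous. Qed.

Lemma cont01_id : cont01 id.
Proof. by move=> t _; exact: cvg_id. Qed.

Lemma cont01D phi psi : cont01 phi -> cont01 psi -> cont01 (fun t => phi t + psi t).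
Proof. by move=> cf cg t t01; apply: continuousD; [exact: cf|exact: cg]. Qed.

Lemma cont01M phi psi : cont01 phi -> cont01 psi -> cont01 (fun t => phi t * psi t).
Proof. by move=> cf cg t t01; apply: continuousM; [exact: cf|exact: cg]. Qed.

Lemma int01_FTC (F phi : R -> R) : cont01 phi ->
  (forall t : R, 0 <= t <= 1 -> is_derive t 1 F (phi t)) -> int01 phi = F 1 - F 0.
Proof.
move=> cphi dF.
have cF t : 0 <= t <= 1 -> {for t, continuous F}.
  move=> /dF[dFt _]; apply/differentiable_continuous.
  exact/derivable1_diffP.
rewrite /int01 /Rintegral (@continuous_FTC2 _ phi F) //.
- apply: continuous_in_subspaceT => t; rewrite inE /= in_itv /=; exact: cphi.
- split.
  + move=> t; rewrite in_itv /= => /andP[t0 t1].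
    by have [] := dF t; rewrite ?(ltW t0) ?(ltW t1).
  + by apply: cvg_at_right_filter; apply: cF; rewrite lexx ler01.
  + by apply: cvg_at_left_filter; apply: cF; rewrite lexx ler01.
- move=> t; rewrite in_itv /= => /andP[t0 t1].
  by rewrite derive1E; have [] := dF t; rewrite ?(ltW t0) ?(ltW t1).
Qed.

Lemma int01_cst (c : R) : int01 (fun=> c) = c.
Proof.
have dF (t : R) : 0 <= t <= 1 -> is_derive t 1 (fun t => c * t) c.
  move=> _; have -> : (fun t : R => c * t) = (c \*: id)%R by apply/funext.
  by apply: is_derive_eq; rewrite /GRing.scale /= mulr1.
by rewrite (int01_FTC (@cont01_cst c) dF) mulr1 mulr0 subr0.
Qed.

Lemma cont01_sum (I : Type) (r : seq I) (F : I -> R -> R) :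
  (forall i, cont01 (F i)) -> cont01 (fun t => \sum_(i <- r) F i t).
Proof.
move=> cF; elim: r => [|i r IH].
  by under eq_fun do rewrite big_nil; exact: cont01_cst.
by under eq_fun do rewrite big_cons; exact: cont01D.
Qed.

Lemma int01_sum (I : Type) (r : seq I) (F : I -> R -> R) :
  (forall i, cont01 (F i)) ->
  int01 (fun t => \sum_(i <- r) F i t) = \sum_(i <- r) int01 (F i).
Proof.
move=> cF; elim: r => [|i r IH].
  by under eq_fun do rewrite big_nil; rewrite int01_cst big_nil.
under eq_fun do rewrite big_cons.
by rewrite int01D // ?IH ?big_cons //; exact: cont01_sum.
Qed.

Lemma int01_norm_le phi (C : R) : cont01 phi ->
  (forall t : R, 0 <= t <= 1 -> `|phi t| <= C) -> `|int01 phi| <= C.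
Proof.
move=> cphi phiC.
have cn : cont01 (fun t => `|phi t|).
  move=> t t01; apply: (continuous_comp (f := phi) (g := Num.norm)).
    exact: cphi.
  exact: norm_continuous.
apply: le_trans (le_normr_Rintegral _ (cont01_integrable cphi)) _ => //.
rewrite -[leRHS]int01_cst; apply: le_Rintegral => //.
- exact: cont01_integrable cn.
- exact: cont01_integrable (@cont01_cst C).
Qed.

(** The tube lemma: compactness of the interval makes the neighbourhood of [u] uniform in [t]. *)
Lemma near_unit_interval (T : topologicalType) (u : T) (P : T -> R -> Prop) :
  (forall t : R, 0 <= t <= 1 -> \forall z \near (u, t), P z.1 z.2) ->
  \forall v \near u, forall t : R, 0 <= t <= 1 -> P v t.
Proof.
move=> HP; have /compact_near_coveringP cov := @segment_compact R 0 1.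
have := cov T (nbhs u) (fun v t => P v t) _.
have H t : `[0 : R, 1]%classic t -> \near t & u, P u t.
  rewrite /= in_itv /= => /HP [[A B] /= [uA tB] AB].
  by exists (B, A) => //= -[t' v'] /= [Bt Av]; exact: (AB (v', t')).
move=> /(_ _ H); apply: filterS => v Pv t t01.
by apply: Pv; rewrite /= in_itv.
Qed.

Lemma int01_continuous (T : topologicalType) (u : T) (Phi : T -> R -> R) :
  (forall t : R, 0 <= t <= 1 -> {for (u, t), continuous (fun z => Phi z.1 z.2)}) ->
  (\forall v \near u, cont01 (Phi v)) ->
  {for u, continuous (fun v => int01 (Phi v))}.
Proof.
move=> cPhi cPhi01; apply/cvgrPdist_le => e e0.
have cu := nbhs_singleton cPhi01.
have : \forall v \near u, forall t : R, 0 <= t <= 1 -> `|Phi u t - Phi v t| <= e.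
  apply: near_unit_interval => t t01.
  have e20 : 0 < e / 2 by rewrite divr_gt0.
  have /cvgrPdist_le /(_ _ e20) h1 := cPhi t t01.
  have h2 : \forall z \near (u, t), `|Phi u t - Phi u z.2| <= e / 2.
    have /cvgrPdist_le /(_ _ e20) h := cu t t01.
    exact: (@cvg_snd _ _ (nbhs u) (nbhs t) _ _ h).
  apply: filterS2 h1 h2 => z /= z1 z2.
  rewrite (splitr e) -(subrKA (Phi u t)) (le_trans (ler_normD _ _)) // lerD //.
  by rewrite distrC.
move=> h; apply: filterS2 cPhi01 h => v cv uv.
rewrite -int01B //; apply: int01_norm_le => // t t01.
by apply: continuousB; [exact: cu|exact: cv].
Qed.

Lemma int01_derive (Phi Psi : R -> R -> R) (d : R) : 0 < d ->
  (forall s : R, `|s| < d -> cont01 (Phi s)) ->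
  (forall s t : R, `|s| < d -> 0 <= t <= 1 ->
    is_derive s 1 (fun s => Phi s t) (Psi s t)) ->
  (forall t : R, 0 <= t <= 1 -> {for ((0 : R), t), continuous (fun z => Psi z.1 z.2)}) ->
  cont01 (Psi 0) ->
  is_derive (0 : R) 1 (fun s => int01 (Phi s)) (int01 (Psi 0)).
Proof.
move=> d0 cPhi dPhi cPsi cPsi0.
(* This is the dominating function for differentiation under the integral sign: joint continuity and
   the tube lemma give one bound for all small [s]. *)
have : \forall s \near (0 : R), forall t : R, 0 <= t <= 1 -> `|Psi s t| <= `|Psi 0 t| + 1.
  apply: near_unit_interval => t t01.
  have e0 : 0 < 2^-1 :> R by rewrite invr_gt0.
  have /cvgrPdist_le /(_ _ e0) h1 := cPsi t t01.
  have h2 : \forall z \near ((0 : R), t), `|Psi 0 t - Psi 0 z.2| <= 2^-1.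
    have /cvgrPdist_le /(_ _ e0) h := cPsi0 t t01.
    exact: (@cvg_snd _ _ (nbhs (0 : R)) (nbhs t) _ _ h).
  apply: filterS2 h1 h2 => z /= z1 z2.
  rewrite -lerBlDl (le_trans (lerB_dist _ _)) //.
  rewrite -(subrKA (Psi 0 t)) (le_trans (ler_normD _ _)) //.
  rewrite (le_trans (lerD (_ : _ <= 2^-1) z2)) //; first by rewrite distrC.
  by lra.
move=> /nbhs_ballP[d' /= d'0 d'P].
pose e := Num.min d d'.
have e0 : 0 < e by rewrite lt_min d0 d'0.
have itv s : `](- e), e[%classic s -> `|s| < d /\ `|s| < d'.
  by rewrite /= in_itv /= -ltr_norml lt_min => /andP.
have I0 : `](- e), e[%classic 0 by rewrite /= in_itv /= oppr_lt0 e0.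
have mB : measurable (`[0, 1] : set (measurableTypeR R)) by exact: measurable_itv.
have := @cvg_differentiation_under_integral R _ _ lebesgue_measure Phi
  `[0, 1] mB 0 (- e) e I0 _ _ (fun t => `|Psi 0 t| + 1) _ _ _.
have p1 s t : `](- e), e[%classic s -> `[0, 1]%classic t -> partial1of2 Phi s t = Psi s t.
  move=> /itv[sd _]; rewrite /= in_itv /= => t01.
  by rewrite partial1of2E; have [] := dPhi s t sd t01.
move=> H; have {}H := H _ _ _ _ _.
have -> : int01 (Psi 0) = \int[lebesgue_measure]_(t in `[0, 1]) partial1of2 Phi 0 t.
  by apply: eq_Rintegral => t; rewrite inE => t01; rewrite p1.
have cvg : h^-1 *: (((fun s => int01 (Phi s)) \o shift 0) (h *: (1 : R)) - int01 (Phi 0))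
   @[h --> 0^'] --> \int[lebesgue_measure]_(t in `[0, 1]) partial1of2 Phi 0 t.
  under eq_fun do rewrite /= [_ *: 1]mulr1.
  apply: H.
  - by move=> s /itv[sd _]; apply: cont01_integrable; exact: cPhi.
  - move=> s t /itv[sd _]; rewrite /= in_itv /= => t01.
    by have [] := dPhi s t sd t01.
  - by move=> t; rewrite addr_ge0.
  - apply: cont01_integrable; apply: cont01D; last exact: cont01_cst.
    move=> t t01; apply: (continuous_comp (f := Psi 0) (g := Num.norm)).
      exact: cPsi0.
    exact: norm_continuous.
  - move=> s t Is t01; rewrite p1 //; have [_ sd'] := itv s Is.
    apply: d'P; last by move: t01; rewrite /= in_itv.
    by rewrite -ball_normE /= sub0r normrN.
apply: DeriveDef; first by apply/cvg_ex; eexists; exact: cvg.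
exact/cvg_lim.
Qed.

End UnitIntegral.

Lemma pair_continuous_at (T U V : topologicalType) (f : T -> U) (g : T -> V) x :
  {for x, continuous f} -> {for x, continuous g} ->
  {for x, continuous (fun y => (f y, g y))}.
Proof.
by move=> cf cg; exact: (@cvg_pair _ _ _ (nbhs x) (nbhs (f x)) (nbhs (g x))).
Qed.

Section RadialAverage.
Variables (R : realType) (m : nat) (c : 'rV[R]_m) (r : R).
Implicit Types (f : 'rV[R]_m -> R) (u v : 'rV[R]_m).

Local Notation pd a f := ('D_(delta_mx 0 a) f).
Local Notation B := (ball c r).

Definition radial_average f u : R := int01 (fun t => f (t *: (u - c) + c)).

Lemma ball_radius_gt0 u : B u -> 0 < r.
Proof. by rewrite -ball_normE /=; apply: le_lt_trans. Qed.

Lemma ball_radial u (t : R) : B u -> 0 <= t <= 1 -> B (t *: (u - c) + c).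
Proof.
move=> Bu; apply: ball_segment => //.
by apply: ballxx; exact: ball_radius_gt0 Bu.
Qed.

Lemma radial_joint_continuous f u (t : R) :
  (forall v, B v -> {for v, continuous f}) -> B u -> 0 <= t <= 1 ->
  {for (u, t), continuous (fun z : 'rV[R]_m * R => f (z.2 *: (z.1 - c) + c))}.
Proof.
move=> cf Bu t01.
apply: (continuous_comp (f := fun z : 'rV[R]_m * R => z.2 *: (z.1 - c) + c)).
  apply: cvgD; last exact: cvg_cst.
  apply: cvgZ; first exact: cvg_snd.
  by apply: cvgB; [exact: cvg_fst|exact: cvg_cst].
by apply: cf => /=; exact: ball_radial.
Qed.

Lemma radial_cont01 f u : (forall v, B v -> {for v, continuous f}) -> B u ->
  cont01 (fun t => f (t *: (u - c) + c)).
Proof.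
move=> cf Bu t t01.
apply: (continuous_comp (f := fun s : R => (u, s))
  (g := fun z : 'rV[R]_m * R => f (z.2 *: (z.1 - c) + c))).
  by apply: pair_continuous_at; [exact: cst_continuous|exact: cvg_id].
exact: radial_joint_continuous.
Qed.

Lemma radial_average_continuous f : (forall v, B v -> {for v, continuous f}) ->
  forall u, B u -> {for u, continuous (radial_average f)}.
Proof.
move=> cf u Bu.
apply: (@int01_continuous _ _ u (fun v t => f (t *: (v - c) + c))).
  by move=> t t01; exact: radial_joint_continuous.
by apply: near_in_open (ball_open c r) Bu _ => v Bv; exact: radial_cont01.
Qed.

Lemma is_derive_radial_average f u b : class_C 1 B f -> B u ->
  is_derive u (delta_mx 0 b) (radial_average f)
    (int01 (fun t => t * pd b f (t *: (u - c) + c))).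
Proof.
move=> fC Bu; set e := delta_mx 0 b.
have cf v (Bv : B v) : {for v, continuous f} := class_C_cont fC Bv.
have cpf v (Bv : B v) : {for v, continuous (pd b f)} := class_C_cont (class_C_pd b fC) Bv.
have cl (s : R) : {for s, continuous (fun s : R => s *: (e : 'rV[R]_m) + u)}.
  apply: cvgD; last exact: cvg_cst.
  by apply: cvgZr_tmp; exact: cvg_id.
have : \forall s \near (0 : R), B (s *: e + u).
  apply: (cl 0 : (fun s => s *: e + u) s @[s --> nbhs 0] --> _).
  by rewrite scale0r add0r; apply: open_nbhs_nbhs; split => //; exact: ball_open.
move=> /nbhs_ballP[d /= d0 dP].
have {}dP (s : R) : `|s| < d -> B (s *: e + u).
  by move=> sd; apply: dP; rewrite -ball_normE /= sub0r normrN.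
apply: is_derive_from_line.
have -> : int01 (fun t => t * pd b f (t *: (u - c) + c)) =
    int01 (fun t => t * pd b f (t *: (0 *: e + u - c) + c)).
  by apply: eq_int01 => t _; rewrite scale0r add0r.
apply: (@int01_derive R (fun s t => f (t *: (s *: e + u - c) + c))
  (fun s t => t * pd b f (t *: (s *: e + u - c) + c)) d d0).
- by move=> s sd; apply: radial_cont01 => //; exact: dP.
- move=> s t sd t01.
  (* Moving [u] by [w *: e] moves the point at time [t] by [w *: (t *: e)], whence the factor [t] in
     the derivative. *)
  have E w : t *: (w *: e + u - c) + c = w *: (t *: e) + (t *: (u - c) + c).
    by rewrite !scalerDr !scalerA (mulrC t w) !addrA.
  have Bst : B (s *: (t *: e) + (t *: (u - c) + c)).
    by rewrite -E; apply: ball_radial => //; exact: dP.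
  have dfb := C1_derivable (v := e) (ball_open c r) fC Bst.
  have [dft dftE] := is_deriveZdir t dfb.
  have := is_derive_line dft.
  rewrite dftE -E; under eq_fun do rewrite -E; exact.
- move=> t t01.
  apply: (@continuousM _ _ (fun z : R * R => z.2)
    (fun z : R * R => pd b f (z.2 *: (z.1 *: e + u - c) + c))).
    exact: cvg_snd.
  apply: (continuous_comp (f := fun z : R * R => (z.1 *: e + u, z.2))
    (g := fun z : 'rV[R]_m * R => pd b f (z.2 *: (z.1 - c) + c))).
    apply: pair_continuous_at; last exact: cvg_snd.
    apply: (continuous_comp (f := fst) (g := fun s : R => s *: (e : 'rV[R]_m) + u)).
      exact: cvg_fst.
    exact: cl.
  apply: (@radial_joint_continuous (pd b f) (0 *: e + u) t) => //.
  by apply: dP; rewrite normr0.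
- apply: cont01M; first exact: cont01_id.
  apply: (@radial_cont01 (pd b f) (0 *: e + u)) => //.
  by apply: dP; rewrite normr0.
Qed.

Lemma radial_average_C1 f : class_C 1 B f -> class_C 1 B (radial_average f).
Proof.
move=> fC; have cf v (Bv : B v) : {for v, continuous f} := class_C_cont fC Bv.
apply: (@class_CS_intro _ _ 0 B _ (ball_open c r)).
- by move=> u a Bu; have [] := is_derive_radial_average a fC Bu.
- exact: radial_average_continuous.
move=> a; split=> // u Bu.
apply: (@continuous_at_near_eq _ _
  (fun u => int01 (fun t => t * pd a f (t *: (u - c) + c)))).
  apply: near_in_open (ball_open c r) Bu _ => v Bv.
  by have [_] := is_derive_radial_average a fC Bv.
have cpf v (Bv : B v) : {for v, continuous (pd a f)} := class_C_cont (class_C_pd a fC) Bv.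
apply: (@int01_continuous _ _ u (fun u t => t * pd a f (t *: (u - c) + c))).
  move=> t t01; apply: (@continuousM _ _ (fun z : 'rV[R]_m * R => z.2)
    (fun z : 'rV[R]_m * R => pd a f (z.2 *: (z.1 - c) + c))).
    exact: cvg_snd.
  exact: (@radial_joint_continuous (pd a f)).
apply: near_in_open (ball_open c r) Bu _ => v Bv.
by apply: cont01M; [exact: cont01_id|exact: (@radial_cont01 (pd a f))].
Qed.

(** The integral of the 1-form [omega] along the segment from [c] to [u]. *)
Definition homotopy_op (omega : 'I_m -> 'rV[R]_m -> R) u : R :=
  \sum_a (u - c) 0 a * radial_average (omega a) u.

Lemma homotopy_op_C1 omega : (forall a, class_C 1 B (omega a)) ->
  class_C 1 B (homotopy_op omega).
Proof.
move=> oC; apply: class_C_sum => [|a _]; first exact: ball_open.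
apply: class_CM; first exact: ball_open.
  apply: (@class_C_ext _ _ _ _ (fun u => u 0 a + - c 0 a)); first exact: ball_open.
    by move=> u _; rewrite !mxE.
  apply: class_CD; [exact: ball_open|exact: class_C_coord|exact: class_C_cst].
exact: radial_average_C1.
Qed.

(* The homotopy formula d h + h d = id in degree one. *)
Lemma pd_homotopy_op omega u b : (forall a, class_C 1 B (omega a)) -> B u ->
  pd b (homotopy_op omega) u = omega b u + \sum_a (u - c) 0 a *
    int01 (fun t => t * (pd b (omega a) (t *: (u - c) + c) -
                         pd a (omega b) (t *: (u - c) + c))).
Proof.
move=> oC Bu.
have co a v (Bv : B v) : {for v, continuous (omega a)} := class_C_cont (oC a) Bv.
have cpo a b' v (Bv : B v) : {for v, continuous (pd b' (omega a))} :=
  class_C_cont (class_C_pd b' (oC a)) Bv.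
pose I a b' := int01 (fun t => t * pd b' (omega a) (t *: (u - c) + c)).
have ci a b' : cont01 (fun t => t * pd b' (omega a) (t *: (u - c) + c)).
  by apply: cont01M; [exact: cont01_id|apply: (@radial_cont01 (pd b' (omega a))) => // v; exact: cpo].
have -> : pd b (homotopy_op omega) u =
    \sum_a ((u - c) 0 a * I a b + radial_average (omega a) u * (a == b)%:R).
  have dh a : is_derive u (delta_mx 0 b)
      (fun v => (v - c) 0 a * radial_average (omega a) v)
      ((u - c) 0 a * I a b + radial_average (omega a) u * (a == b)%:R).
    have d1 : is_derive u (delta_mx 0 b) (fun v : 'rV[R]_m => (v - c) 0 a) (a == b)%:R.
      have -> : (fun v : 'rV[R]_m => (v - c) 0 a) =
          (fun v => v 0 a) - cst (c 0 a) by apply/funext => v; rewrite !mxE.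
      have := is_derive_coord u (delta_mx 0 b) a; rewrite mxE eqxx /= => dc.
      by apply: is_derive_eq; rewrite subr0.
    have d2 := is_derive_radial_average b (oC a) Bu.
    have := is_deriveM d1 d2; rewrite /GRing.scale /=; exact.
  rewrite /homotopy_op.
  have -> : (fun u => \sum_a (u - c) 0 a * radial_average (omega a) u) =
    \sum_a (fun u => (u - c) 0 a * radial_average (omega a) u).
    by apply/funext => v; rewrite fct_sumE.
  rewrite derive_sum; last by move=> a; have [] := dh a.
  by apply: eq_bigr => a _; have [_] := dh a.
have S2 : \sum_a radial_average (omega a) u * (a == b)%:R = radial_average (omega b) u.
  rewrite (bigD1 b) //= eqxx mulr1 big1 ?addr0 // => a /negbTE ->.
  by rewrite mulr0.
rewrite big_split /= S2 addrC.
(* Integrate over [0, 1] the derivative of [s * omega b (s *: (u - c) + c)], whose boundary values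
   are 0 and [omega b u]. *)
have -> : omega b u = radial_average (omega b) u + \sum_a (u - c) 0 a * I b a.
  have dF (t : R) : 0 <= t <= 1 ->
      is_derive t 1 (fun s => s * omega b (s *: (u - c) + c))
        (omega b (t *: (u - c) + c) +
         \sum_a (u - c) 0 a * (t * pd a (omega b) (t *: (u - c) + c))).
    move=> t01; have Bt := ball_radial Bu t01.
    have dl := is_derive_line (C1_derivable (v := u - c) (ball_open c r) (oC b) Bt).
    apply: (is_derive_eq (is_deriveM (is_derive_id t (1 : R)) dl)).
    transitivity (t * (\sum_a (u - c) 0 a * pd a (omega b) (t *: (u - c) + c)) +
      omega b (t *: (u - c) + c) * 1).
      by rewrite (C1_derive _ (ball_open c r) (oC b) Bt).
    rewrite mulr1 addrC mulr_sumr; congr (_ + _).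
    by apply: eq_bigr => a _; rewrite mulrCA.
  have cF : cont01 (fun t => omega b (t *: (u - c) + c) +
         \sum_a (u - c) 0 a * (t * pd a (omega b) (t *: (u - c) + c))).
    apply: cont01D; first by apply: (@radial_cont01 (omega b)) => // v; exact: co.
    by apply: cont01_sum => a; apply: cont01M => //; exact: cont01_cst.
  have := int01_FTC cF dF; rewrite mul1r mul0r subr0 scale1r subrK => <-.
  rewrite int01D; last 2 first.
  - by apply: (@radial_cont01 (omega b)) => // v; exact: co.
  - by apply: cont01_sum => a; apply: cont01M => //; exact: cont01_cst.
  congr (_ + _); rewrite int01_sum; last first.
    by move=> a; apply: cont01M => //; exact: cont01_cst.
  by apply: eq_bigr => a _; rewrite int01Z.
rewrite -addrA -big_split /=; congr (_ + _); apply: eq_bigr => a _.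
rewrite -mulrDr; congr (_ * _).
have -> : int01 (fun t => t * (pd b (omega a) (t *: (u - c) + c) -
    pd a (omega b) (t *: (u - c) + c))) = I a b - I b a.
  by rewrite -int01B //; apply: eq_int01 => t _; rewrite mulrBr.
by rewrite addrC subrK.
Qed.

End RadialAverage.

Section SmoothFunctions.
Variables (R : realType) (m : nat).
Implicit Types (D : set 'rV[R]_m) (f g : 'rV[R]_m -> R).

Local Notation pd a f := ('D_(delta_mx 0 a) f).

Lemma class_CS_of_pd k D f (omega : 'I_m -> 'rV[R]_m -> R) : open D ->
  class_C 1 D f -> (forall a u, D u -> pd a f u = omega a u) ->
  (forall a, class_C k D (omega a)) -> class_C k.+1 D f.
Proof.
move=> oD fC fo oC; apply: (@class_CS_intro _ _ k D _ oD).
- by move=> u a Du; exact: class_C_derivable fC Du.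
- by move=> u Du; exact: class_C_cont fC Du.
by move=> a; apply: class_C_ext oD _ (oC a) => u Du; rewrite fo.
Qed.

Lemma poincare (c : 'rV[R]_m) (r : R) (omega : 'I_m -> 'rV[R]_m -> R) :
  (forall a, smooth (ball c r) (omega a)) ->
  (forall u a b, ball c r u -> pd a (omega b) u = pd b (omega a) u) ->
  exists2 f, smooth (ball c r) f &
    forall u a, ball c r u -> pd a f u = omega a u.
Proof.
move=> oS closed; have oC a := oS a 1.
have dh u a : ball c r u -> pd a (homotopy_op c omega) u = omega a u.
  move=> Bu; rewrite (pd_homotopy_op a oC Bu) big1 ?addr0 // => b _.
  rewrite (@eq_int01 _ _ (fun=> 0)) ?int01_cst ?mulr0 // => t t01.
  by rewrite closed ?subrr ?mulr0 //; exact: ball_radial.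
(* Differentiation under the integral gave class C^1 only; higher classes follow because the partial
   derivatives are the smooth [omega a]. *)
exists (homotopy_op c omega) => // k; apply: class_CS.
apply: (class_CS_of_pd (ball_open c r) (homotopy_op_C1 oC)) => [a u Bu|a].
  exact: dh.
exact: oS.
Qed.

End SmoothFunctions.

(** * Sequences with geometrically decaying increments *)

Section GeometricConvergence.
Variable R : realType.

(** It discards the error of the finite stages once an estimate holds at every stage of the Picard
    iteration. *)
Lemma le_geometric (x y A : R) : (forall k : nat, x <= A / 2 ^+ k + y) -> x <= y.
Proof.
move=> H; apply/ler_addgt0Pr => e e0.
have cvg0 : A / 2 ^+ k @[k --> \oo] --> 0.
  have : A * 2^-1 ^+ k @[k --> \oo] --> A * 0.
    apply: cvgM; first exact: cvg_cst.
    by apply: cvg_expr; rewrite ger0_norm ?invr_ge0 // invf_lt1 // ltr1n.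
  by rewrite mulr0; under eq_cvg do rewrite exprVn.
have /cvgrPdist_lt /(_ _ e0) [k _ /(_ k (leqnn k))] := cvg0.
rewrite /= sub0r normrN => /ltr_normlW/ltW le_e.
by rewrite (le_trans (H k)) // addrC lerD2l.
Qed.

(** The intervals of radius [2 * D / 2 ^+ k] about [x k] are nested, since the radius drops by
    [D / 2 ^+ k] at each step; the supremum of their left ends lies in all of them. *)
Lemma geometric_limit (x : nat -> R) (D : R) :
  (forall k, `|x k.+1 - x k| <= D / 2 ^+ k) ->
  exists l, forall k, `|x k - l| <= 2 * D / 2 ^+ k.
Proof.
move=> xD; pose a k := x k - 2 * D / 2 ^+ k; pose b k := x k + 2 * D / 2 ^+ k.
have E k : 2 * D / 2 ^+ k = D / 2 ^+ k + 2 * D / 2 ^+ k.+1.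
  by rewrite exprS; field; rewrite expf_neq0 ?pnatr_eq0.
have ab k : a k <= b k.
  have := le_trans (normr_ge0 _) (xD k); rewrite /a /b => h.
  by rewrite -mulrA; lra.
have aS k : a k <= a k.+1.
  rewrite /a (E k); have := xD k; rewrite ler_norml => /andP[h _].
  by move: h; move: (D / _) (2 * D / _) => p q; lra.
have bS k : b k.+1 <= b k.
  rewrite /b (E k); have := xD k; rewrite ler_norml => /andP[_ h].
  by move: h; move: (D / _) (2 * D / _) => p q; lra.
have amono k j : a k <= a (k + j)%N.
  by elim: j => [|j IH]; rewrite ?addn0 // addnS (le_trans IH).
have bmono k j : b (k + j)%N <= b k.
  by elim: j => [|j IH]; rewrite ?addn0 // addnS (le_trans (bS _)).
have aleb k j : a k <= b j.
  by rewrite (le_trans (amono k j)) // (le_trans (ab _)) // addnC.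
exists (sup (range a)) => k.
have ubk : ubound (range a) (b k) by move=> _ [j _ <-].
have h1 : a k <= sup (range a).
  apply: ub_le_sup; last by exists k.
  by exists (b k).
have h2 : sup (range a) <= b k.
  by apply: ge_sup => //; exists (a 0%N); exists 0%N.
by rewrite ler_norml; move: h1 h2; rewrite /a /b; move: (2 * D / _) => p *; lra.
Qed.

End GeometricConvergence.

(** * Linear total differential systems *)

Lemma sum_norm_le (R : realType) n (F : 'I_n -> R) (A : R) :
  (forall i, `|F i| <= A) -> `|\sum_i F i| <= n%:R * A.
Proof.
move=> FA; apply: le_trans (ler_norm_sum _ _ _) _.
apply: le_trans (ler_sum _ (fun i _ => FA i)) _.
by rewrite sumr_const card_ord mulr_natl.
Qed.

Section LinearTotalDifferentialSystem.
Variables (R : realType) (m N : nat) (c : 'rV[R]_m) (r : R).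
Variable G : 'I_m -> 'rV[R]_m -> 'M[R]_N.

Local Notation pd a f := ('D_(delta_mx 0 a) f).
Local Notation B := (ball c r).

Implicit Types (u v : 'rV[R]_m).

Hypothesis r_gt0 : 0 < r.
Hypothesis G_smooth : forall a d l, smooth B (fun u => G a u d l).
Hypothesis G_flat : forall u (a b : 'I_m) (e l : 'I_N), B u ->
  pd a (fun v => G b v e l) u - pd b (fun v => G a v e l) u +
  \sum_d (G a u e d * G b u d l - G b u e d * G a u d l) = 0.

Variable C : R.
Hypothesis C_ge0 : 0 <= C.
Hypothesis G_le : forall u a d l, B u -> `|G a u d l| <= C.
Hypothesis r_small : 8 * (m%:R * r * (N%:R * C)) <= 1.

Variable t0 : 'I_N -> R.

Definition rhs (th : 'I_N -> 'rV[R]_m -> R) l (a : 'I_m) u : R :=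
  \sum_d th d u * G a u d l.

Fixpoint picard (k : nat) : 'I_N -> 'rV[R]_m -> R :=
  if k is k'.+1 then fun l u => t0 l + homotopy_op c (rhs (picard k') l) u
  else fun l _ => t0 l.

Let oB : open B. Proof. exact: ball_open. Qed.

Lemma ball_coord_le u (a : 'I_m) : B u -> `|(u - c) 0 a| <= r.
Proof.
rewrite -ball_normE /= distrC => Bu.
by apply: le_trans (ltW Bu); exact: row_coord_le.
Qed.

Lemma rhs_le th l a u (X : R) : B u -> (forall d, `|th d u| <= X) ->
  `|rhs th l a u| <= N%:R * C * X.
Proof.
move=> Bu thX; rewrite -mulrA; apply: sum_norm_le => d.
by rewrite normrM mulrC ler_pM // G_le.
Qed.

Lemma rhs_C1 th l a : (forall d, class_C 1 B (th d)) -> class_C 1 B (rhs th l a).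
Proof.
by move=> thC; apply: class_C_sum => // d _; apply: class_CM => //; exact: G_smooth.
Qed.

Lemma picard_C1 k l : class_C 1 B (picard k l).
Proof.
elim: k l => [|k IH] l; first exact: class_C_cst.
apply: (class_CD oB (class_C_cst _ _ (t0 l))).
by apply: homotopy_op_C1 => a; exact: rhs_C1.
Qed.

Lemma picard_center k l : picard k l c = t0 l.
Proof.
case: k => [|k] //=; rewrite /homotopy_op big1 ?addr0 // => a _.
by rewrite subrr mxE mul0r.
Qed.

(** One pass through the right-hand side and the homotopy operator gains a factor 8. Halving the
    increments would need less; halving the defects uses all of it. *)
Lemma mul_le_small (w : R) : 0 <= w -> m%:R * (r * (N%:R * C * w)) <= w / 8.
Proof.
move=> w0.
have -> : m%:R * (r * (N%:R * C * w)) = (8 * (m%:R * r * (N%:R * C))) * w / 8 by field.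
by rewrite ler_pM2r ?invr_gt0 // ler_piMl.
Qed.

Lemma homotopy_op_le omega u (K : R) : (forall a, class_C 1 B (omega a)) ->
  B u -> (forall a v, B v -> `|omega a v| <= K) ->
  `|homotopy_op c omega u| <= m%:R * (r * K).
Proof.
move=> oC Bu oK; apply: sum_norm_le => a; rewrite normrM ler_pM ?ball_coord_le //.
apply: int01_norm_le => [|t t01].
  by apply: (radial_cont01 _ Bu) => v Bv; exact: class_C_cont (oC a) Bv.
by apply: oK; exact: ball_radial.
Qed.

Lemma homotopy_opB (om1 om2 : 'I_m -> 'rV[R]_m -> R) u :
  (forall a, class_C 1 B (om1 a)) -> (forall a, class_C 1 B (om2 a)) -> B u ->
  homotopy_op c om1 u - homotopy_op c om2 u =
  homotopy_op c (fun a v => om1 a v - om2 a v) u.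
Proof.
move=> C1 C2 Bu; rewrite -sumrB; apply: eq_bigr => a _.
rewrite -mulrBr /radial_average int01B //.
  by apply: (radial_cont01 _ Bu) => v Bv; exact: class_C_cont (C1 a) Bv.
by apply: (radial_cont01 _ Bu) => v Bv; exact: class_C_cont (C2 a) Bv.
Qed.

Definition size0 : R := \sum_l `|t0 l|.

Lemma size0_ge0 : 0 <= size0. Proof. by apply: sumr_ge0. Qed.

Lemma t0_le l : `|t0 l| <= size0.
Proof. by rewrite /size0 (bigD1 l) //= lerDl sumr_ge0. Qed.

Lemma pow2_ge0 (k : nat) (x : R) : 0 <= x -> 0 <= x / 2 ^+ k.
Proof. by move=> x0; rewrite divr_ge0 // exprn_ge0. Qed.

Lemma half_pow2 (k : nat) (x : R) : x / 2 ^+ k.+1 = x / 2 ^+ k / 2.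
Proof. by rewrite exprSr; field; rewrite expf_neq0 ?pnatr_eq0. Qed.

Lemma picard_step k l u : B u ->
  `|picard k.+1 l u - picard k l u| <= size0 / 2 ^+ k.
Proof.
have s0 := size0_ge0.
elim: k l u => [|k IH] l u Bu.
  rewrite /= addrAC subrr add0r expr0 divr1.
  apply: le_trans (homotopy_op_le _ Bu _) _.
  - by move=> a; apply: rhs_C1 => d; exact: class_C_cst.
  - by move=> a v Bv; apply: (rhs_le _ _ Bv) => d; exact: t0_le.
  by apply: le_trans (mul_le_small s0) _; rewrite ler_piMr // invf_le1 // ler1n.
have p0 : 0 <= size0 / 2 ^+ k by exact: pow2_ge0.
have -> : picard k.+2 l u - picard k.+1 l u =
    homotopy_op c (rhs (picard k.+1) l) u - homotopy_op c (rhs (picard k) l) u.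
  by rewrite /= opprD addrACA subrr add0r.
rewrite homotopy_opB //; last 2 first.
- by move=> a; apply: rhs_C1 => d; exact: picard_C1.
- by move=> a; apply: rhs_C1 => d; exact: picard_C1.
apply: (le_trans (homotopy_op_le (K := N%:R * C * (size0 / 2 ^+ k)) _ Bu _)).
- by move=> a; apply: class_CD => //; [|apply: class_CN => //];
    apply: rhs_C1 => d; exact: picard_C1.
- move=> a v Bv; rewrite -sumrB.
  under eq_bigr do rewrite -mulrBl.
  apply: (@rhs_le (fun d v => picard k.+1 d v - picard k d v) l a v _ Bv) => d.
  exact: IH.
apply: (le_trans (mul_le_small p0)); rewrite half_pow2.
by move: p0; move: (size0 / _) => p p0; lra.
Qed.

(** The decay of this error is what controls the derivatives of the iterates, about which their
    uniform convergence says nothing. *)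
Definition defect k l (a : 'I_m) u : R := pd a (picard k l) u - rhs (picard k) l a u.

Lemma pd_rhs k l (a b : 'I_m) u : B u -> pd b (rhs (picard k) l a) u =
  \sum_d (picard k d u * pd b (fun v => G a v d l) u
          + G a u d l * pd b (picard k d) u).
Proof.
move=> Bu; rewrite /rhs.
have -> : (fun u => \sum_d picard k d u * G a u d l) =
  \sum_d (fun u => picard k d u * G a u d l).
  by apply/funext => v; rewrite fct_sumE.
have dp d : derivable (picard k d) u (delta_mx 0 b).
  exact: class_C_derivable (picard_C1 k d) Bu.
have dG d : derivable (fun v => G a v d l) u (delta_mx 0 b).
  exact: class_C_derivable (G_smooth a d l 1) Bu.
rewrite derive_sum; last by move=> d; exact: (derivableM (dp d) (dG d)).
by apply: eq_bigr => d _; exact: (deriveM (dp d) (dG d)).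
Qed.

(* The flatness of G turns the exterior derivative of the right-hand side into
   an expression in the defect alone. *)
Lemma rhs_exterior k l (a b : 'I_m) u : B u ->
  pd b (rhs (picard k) l a) u - pd a (rhs (picard k) l b) u =
  \sum_d (defect k d b u * G a u d l - defect k d a u * G b u d l).
Proof.
move=> Bu; have E1 := pd_rhs k l a b Bu; have E2 := pd_rhs k l b a Bu.
rewrite E1 E2 -sumrB.
have -> : \sum_d (defect k d b u * G a u d l - defect k d a u * G b u d l) =
    \sum_d (G a u d l * pd b (picard k d) u - G b u d l * pd a (picard k d) u)
    - \sum_d \sum_e picard k e u * (G b u e d * G a u d l - G a u e d * G b u d l).
  rewrite -sumrB; apply: eq_bigr => d _; rewrite /defect /rhs !mulrBl !mulr_suml.
  under [in RHS]eq_bigr do rewrite mulrBr !mulrA.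
  by rewrite sumrB; ring.
rewrite exchange_big /= -sumrB; apply: eq_bigr => d _.
rewrite -mulr_sumr.
have := G_flat b a d l Bu => /eqP; rewrite addrC addr_eq0 => /eqP ->.
ring.
Qed.

(** By the homotopy formula, the derivative of stage [k.+1] is the right-hand side at stage [k] plus
    the radial integral of its exterior derivative. *)
Lemma defect_step k l (b : 'I_m) u : B u -> defect k.+1 l b u =
  \sum_d (picard k d u - picard k.+1 d u) * G b u d l +
  \sum_a (u - c) 0 a * int01 (fun t => t *
    (pd b (rhs (picard k) l a) (t *: (u - c) + c) -
     pd a (rhs (picard k) l b) (t *: (u - c) + c))).
Proof.
move=> Bu; rewrite /defect.
have rC a : class_C 1 B (rhs (picard k) l a).
  by apply: rhs_C1 => d; exact: picard_C1.
have -> : pd b (picard k.+1 l) u = pd b (homotopy_op c (rhs (picard k) l)) u.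
  have hC := homotopy_op_C1 rC.
  have := deriveD (derivable_cst (t0 l) u (delta_mx 0 b)) (class_C_derivable (a := b) hC Bu).
  by rewrite derive_cst add0r.
rewrite (pd_homotopy_op _ rC Bu) addrAC; congr (_ + _).
by rewrite /rhs -sumrB; apply: eq_bigr => d _; rewrite mulrBl.
Qed.

(** The constant 4 closes the recursion of [defect_step]. If [K] is the bound at stage [k], the
    increment term is at most [K / 4]; the exterior derivative has two products of a defect with a
    coefficient and contributes at most [2 * K / 8]. Together they give [K / 2]. *)
Lemma defect_le k l b u : B u ->
  `|defect k l b u| <= 4 * (N%:R * C * size0) / 2 ^+ k.
Proof.
have s0 := size0_ge0.
have K0 : 0 <= N%:R * C * size0 by rewrite !mulr_ge0.
elim: k l b u => [|k IH] l b u Bu.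
  rewrite /defect /= derive_cst sub0r normrN expr0 divr1.
  apply: le_trans (rhs_le _ _ Bu (fun d => t0_le d)) _.
  by rewrite ler_peMl // ler1n.
rewrite defect_step //; apply: le_trans (ler_normD _ _) _.
have h1 : `|\sum_d (picard k d u - picard k.+1 d u) * G b u d l| <=
    N%:R * C * size0 / 2 ^+ k.
  rewrite -[leRHS]mulrA.
  apply: (@rhs_le (fun d v => picard k d v - picard k.+1 d v)) => // d.
  by rewrite distrC; exact: picard_step.
pose K := 4 * (N%:R * C * size0) / 2 ^+ k.
have K0' : 0 <= K by rewrite pow2_ge0 // mulr_ge0.
have h2 : `|\sum_a (u - c) 0 a * int01 (fun t => t *
    (pd b (rhs (picard k) l a) (t *: (u - c) + c) -
     pd a (rhs (picard k) l b) (t *: (u - c) + c)))| <= m%:R * (r * (N%:R * C * (2 * K))).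
  apply: sum_norm_le => a; rewrite normrM ler_pM ?ball_coord_le //.
  have rC a' : class_C 1 B (rhs (picard k) l a').
    by apply: rhs_C1 => d; exact: picard_C1.
  apply: int01_norm_le => [|t t01].
    apply: cont01M; first exact: cont01_id.
    apply: (radial_cont01 (f := fun v => pd b (rhs (picard k) l a) v -
      pd a (rhs (picard k) l b) v) _ Bu) => v Bv.
    by apply: continuousB; apply: class_C_cont Bv; apply: class_C_pd; exact: rC.
  have Bt := ball_radial Bu t01.
  rewrite rhs_exterior // normrM.
  apply: (@le_trans _ _ (1 * (N%:R * (C * (2 * K))))); last by rewrite mul1r !mulrA.
  apply: ler_pM => //; first by rewrite ger0_norm; case/andP: t01.
  apply: sum_norm_le => d; apply: le_trans (ler_normB _ _) _.
  have -> : C * (2 * K) = K * C + K * C by ring.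
  by rewrite !normrM lerD // ler_pM // ?IH ?G_le.
have := le_trans h2 (mul_le_small (mulr_ge0 (ler0n R 2) K0')).
move: h1 => /lerD /[apply] /le_trans; apply.
rewrite half_pow2 -/K.
have -> : N%:R * C * size0 / 2 ^+ k = K / 4 by rewrite /K; field; rewrite expf_neq0 ?pnatr_eq0.
lra.
Qed.

(** The limit is specified by its rate of convergence, so that later estimates are explicit. Outside
    the ball nothing is claimed about the chosen value. *)
Definition picard_limit l u : R :=
  get (fun x => forall k, `|picard k l u - x| <= 2 * size0 / 2 ^+ k).

Lemma picard_limitP k l u : B u ->
  `|picard k l u - picard_limit l u| <= 2 * size0 / 2 ^+ k.
Proof.
move=> Bu; have [x Px] := geometric_limit (fun k => picard_step k l Bu).
have Q : exists x, forall k, `|picard k l u - x| <= 2 * size0 / 2 ^+ k by exists x.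
exact: (getPex Q).
Qed.

Lemma picard_limit_center l : picard_limit l c = t0 l.
Proof.
have Bc : B c by exact: ballxx.
apply/eqP; rewrite -subr_eq0 -normr_le0; apply: (le_geometric (A := 2 * size0)) => k.
by rewrite addr0 -(picard_center k l) distrC; exact: picard_limitP.
Qed.

Lemma picard_limit_continuous l u : B u -> {for u, continuous (picard_limit l)}.
Proof.
move=> Bu; apply/(@cvgrPdist_le _ _ _ (nbhs u)) => e e0.
have [k hk] : exists k : nat, 4 * size0 / 2 ^+ k <= e / 2.
  apply: contrapT => /forallNP H.
  have : e / 2 <= 0.
    apply: (le_geometric (A := 4 * size0)) => k; rewrite addr0 ltW // ltNge.
    by apply/negP; exact: H.
  by rewrite leNgt divr_gt0.
have e20 : 0 < e / 2 by rewrite divr_gt0.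
have /cvgrPdist_le /(_ _ e20) near_pic := class_C_cont (picard_C1 k l) Bu.
have nB : \forall v \near u, B v by exact: near_in_open oB Bu _.
near=> v.
have Bv : B v by near: v; exact: nB.
have h : `|picard k l u - picard k l v| <= e / 2 by near: v; exact: near_pic.
have h1 := picard_limitP k l Bu; have h2 := picard_limitP k l Bv.
move: h h1 h2 hk.
have -> : 4 * size0 / 2 ^+ k = 2 * size0 / 2 ^+ k + 2 * size0 / 2 ^+ k.
  by rewrite -mulrDl -mulrDl -natrD.
move: (2 * size0 / _) => q; rewrite !ler_norml => /andP[? ?] /andP[? ?] /andP[? ?] ?.
by apply/andP; split; lra.
Unshelve. all: by end_near.
Qed.

(** The mean value theorem is applied at a finite stage, where derivative and right-hand side differ
    by the defect. As [k] grows, only the oscillation of [rhs picard_limit] near [u] remains, and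
    that is small by continuity. *)
Lemma is_derive_picard_limit l (b : 'I_m) u : B u ->
  is_derive u (delta_mx 0 b) (picard_limit l) (rhs picard_limit l b u).
Proof.
move=> Bu; set e := delta_mx 0 b; set g := rhs picard_limit l b.
have cg : {for u, continuous g}.
  suff : class_C 0 B g by move=> gC; exact: class_C_cont gC Bu.
  apply: class_C_sum => // d _; apply: class_CM => //; last exact: G_smooth.
  by split=> // v; exact: picard_limit_continuous.
apply: is_derive_of_bound => d d0.
have /cvgrPdist_le /(_ _ d0) := cg.
have nB : \forall v \near u, B v by exact: near_in_open oB Bu _.
move=> /(filterI nB) /nbhs_ballP[d' /= d'0 dP].
apply/nbhs_ballP; exists d' => //= s; rewrite -ball_normE /= sub0r normrN => sd.
have Bs (w : R) : 0 <= w <= 1 -> B (w *: (s *: e) + u) /\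
    `|g u - g (w *: (s *: e) + u)| <= d.
  move=> /andP[w0 w1]; apply: dP.
  rewrite -ball_normE /= opprD addrC subrK normrN; apply: le_lt_trans sd.
  apply: row_norm_le => // j; rewrite !mxE eqxx /=.
  have [_|_] := eqVneq j b; last by rewrite !mulr0 normr0.
  by rewrite mulr1 normrM ger0_norm // ler_piMl.
have Bse : B (s *: e + u).
  by have [] := Bs 1; rewrite ?ler01 ?lexx // scale1r.
have {}step k : `|picard k l (s *: e + u) - picard k l u - s * g u| <=
    `|s| * (4 * (N%:R * C * size0) / 2 ^+ k + N%:R * C * (2 * size0 / 2 ^+ k) + d).
  have dir (w : R) : 0 <= w <= 1 -> derivable (picard k l) (w *: (s *: e) + u) e.
    by move=> /Bs[Bw _]; exact: class_C_derivable (picard_C1 k l) Bw.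
  have [|w w01 ->] := @MVT_dir _ _ (picard k l) u (s *: e).
    by move=> w /dir dw; have [] := is_deriveZdir s dw.
  have [_ ->] := is_deriveZdir s (dir w w01).
  rewrite -mulrBr normrM ler_wpM2l //.
  have [Bw gw] := Bs w w01.
  set w' := w *: (s *: e) + u in Bw gw *.
  have -> : 'D_e (picard k l) w' - g u = defect k l b w' +
      \sum_d (picard k d w' - picard_limit d w') * G b w' d l + (g w' - g u).
    rewrite /defect /g /rhs; under [X in _ + X + _]eq_bigr do rewrite mulrBl.
    by rewrite sumrB; ring.
  rewrite (le_trans (ler_normD _ _)) // lerD //; last by rewrite distrC.
  rewrite (le_trans (ler_normD _ _)) // lerD //; first exact: defect_le.
  apply: (@rhs_le (fun d v => picard k d v - picard_limit d v) l b w' _ Bw) => j.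
  exact: picard_limitP.
apply: (le_geometric (A := 4 * size0 +
  `|s| * (4 * (N%:R * C * size0) + N%:R * C * (2 * size0)))) => k.
have h1 := picard_limitP k l Bu; have h2 := picard_limitP k l Bse; have h3 := step k.
have -> : (4 * size0 + `|s| * (4 * (N%:R * C * size0) +
    N%:R * C * (2 * size0))) / 2 ^+ k + d * `|s|
  = 2 * size0 / 2 ^+ k + 2 * size0 / 2 ^+ k +
    `|s| * (4 * (N%:R * C * size0) / 2 ^+ k + N%:R * C * (2 * size0 / 2 ^+ k) + d).
  by field; rewrite expf_neq0 ?pnatr_eq0.
move: h1 h2 h3; move: (2 * size0 / _) (`|s| * _) (s * g u) => q q' q''.
rewrite !ler_norml => /andP[? ?] /andP[? ?] /andP[? ?].
by apply/andP; split; lra.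
Qed.

(** The system expresses the partial derivatives through the functions themselves, so each class C^k
    yields the next. *)
Lemma picard_limit_smooth l : smooth B (picard_limit l).
Proof.
move=> k; elim: k l => [|k IH] l.
  by split=> // u; exact: picard_limit_continuous.
apply: (@class_CS_intro _ _ k B _ oB).
- by move=> u a Bu; have [] := is_derive_picard_limit l a Bu.
- by move=> u; exact: picard_limit_continuous.
move=> a; apply: (@class_C_ext _ _ _ _ (rhs picard_limit l a)) => //.
  by move=> u Bu; have [_] := is_derive_picard_limit l a Bu.
apply: class_C_sum => // d _; apply: class_CM => //; exact: G_smooth.
Qed.

End LinearTotalDifferentialSystem.

Section Frobenius.
Variables (R : realType) (m N : nat) (D : set 'rV[R]_m) (c : 'rV[R]_m).
Variable G : 'I_m -> 'rV[R]_m -> 'M[R]_N.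

Local Notation pd a f := ('D_(delta_mx 0 a) f).

Lemma locally_bounded (I : finType) (f : I -> 'rV[R]_m -> R) :
  open D -> D c -> (forall i, {for c, continuous (f i)}) ->
  exists r C, [/\ 0 < r, 0 <= C, ball c r `<=` D &
    forall i u, ball c r u -> `|f i u| <= C].
Proof.
move=> oD Dc cf.
have : \forall u \near c, forall i, `|f i c - f i u| <= 1.
  apply: (@filter_forall _ _ (fun i u => `|f i c - f i u| <= 1) (nbhs c)) => i.
  by have /cvgrPdist_le /(_ _ ltr01) := cf i.
move=> /(filterI (open_nbhs_nbhs (conj oD Dc))) /nbhs_ballP[r /= r0 rP].
exists r, (1 + \sum_i `|f i c|); split=> //.
- by rewrite addr_ge0 // sumr_ge0.
- by move=> u /rP[].
move=> i u /rP[_ /(_ i)]; rewrite distrC => h.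
rewrite -[f i u](subrK (f i c)) (le_trans (ler_normD _ _)) // lerD //.
by rewrite (bigD1 i) //= lerDl sumr_ge0.
Qed.

Lemma frobenius : open D -> D c ->
  (forall a d l, smooth D (fun u => G a u d l)) ->
  (forall u (a b : 'I_m) (e l : 'I_N), D u ->
    pd a (fun v => G b v e l) u - pd b (fun v => G a v e l) u +
    \sum_d (G a u e d * G b u d l - G b u e d * G a u d l) = 0) ->
  exists r, [/\ 0 < r, ball c r `<=` D &
    forall t0 : 'I_N -> R, exists th : 'I_N -> 'rV[R]_m -> R,
      [/\ forall l, smooth (ball c r) (th l), forall l, th l c = t0 l &
        forall u (a : 'I_m) l, ball c r u ->
          pd a (th l) u = \sum_d th d u * G a u d l]].
Proof.
move=> oD Dc GS Gflat.
have Gcont (i : 'I_m * 'I_N * 'I_N) : {for c, continuous (fun u => G i.1.1 u i.1.2 i.2)}.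
  by case: i => [[a d] l]; exact: class_C_cont (GS a d l 0) Dc.
have [r [C [r0 C0 rD GC]]] := locally_bounded oD Dc Gcont.
(* A radius of at most [q^-1] satisfies the smallness hypothesis of the Picard iteration; the
   summand 1 keeps [q] positive when the product vanishes. The radius does not involve [t0]. *)
pose q := 8 * (m%:R * (N%:R * C)) + 1.
have q0 : 0 < q by rewrite ltr_pwDr // !mulr_ge0.
pose r' := Num.min r q^-1.
have r'0 : 0 < r' by rewrite lt_min r0 invr_gt0.
have r'r : ball c r' `<=` ball c r by apply: le_ball; rewrite ge_min lexx.
have r'D : ball c r' `<=` D by apply: subset_trans rD.
have small : 8 * (m%:R * r' * (N%:R * C)) <= 1.
  have -> : 8 * (m%:R * r' * (N%:R * C)) = 8 * (m%:R * (N%:R * C)) * r' by ring.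
  apply: (@le_trans _ _ (q * q^-1)); last by rewrite divff // gt_eqF.
  apply: ler_pM; [by rewrite !mulr_ge0|exact: ltW|by rewrite /q lerDl|].
  by rewrite ge_min lexx orbT.
have GS' a d l : smooth (ball c r') (fun u => G a u d l).
  by move=> k; exact: class_C_sub r'D (GS a d l k).
have GC' u a d l : ball c r' u -> `|G a u d l| <= C.
  by move=> /r'r Bu; exact: (GC (a, d, l)).
have Gf' u (a b : 'I_m) (e l : 'I_N) Bu := Gflat u a b e l (r'D u Bu).
exists r'; split=> // t0; exists (picard_limit c G t0); split.
- by move=> l; apply: picard_limit_smooth GC' small _ _.
- by move=> l; apply: picard_limit_center GC' small _ _.
- move=> u a l Bu.
  by have [] := is_derive_picard_limit GS' Gf' C0 GC' small t0 l a Bu.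
Qed.

End Frobenius.

(** * Maps close to the identity *)

Section InverseFunction.
Variables (R : realType) (m : nat).
Implicit Types (D W : set 'rV[R]_m) (u v y : 'rV[R]_m) (F : 'rV[R]_m -> 'rV[R]_m).

Local Notation pd a f := ('D_(delta_mx 0 a) f).

Definition partials F u : 'M[R]_m := \matrix_(k, a) pd a (fun v => F v 0 k) u.

(** The mean value theorem is applied to each coordinate of [F]; the [m] entries in a row of the
    Jacobian minus the identity, each bounded by 1/(2(m+1)), have total size at most 1/2. *)
Lemma near_identity F u0 r : (forall k, class_C 1 (ball u0 r) (fun v => F v 0 k)) ->
  (forall u k a, ball u0 r u ->
    `|partials F u k a - (k == a)%:R| <= (2 * m.+1%:R)^-1) ->
  forall u v, ball u0 r u -> ball u0 r v ->
    `|F v - F u - (v - u)| <= `|v - u| / 2.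
Proof.
move=> FC FJ u v Bu Bv; apply: row_norm_le => [|k]; first by rewrite divr_ge0.
have seg (s : R) : 0 <= s <= 1 -> ball u0 r (s *: (v - u) + u) by exact: ball_segment.
have [s /seg Bs E] := C1_MVT (ball_open u0 r) (FC k) seg.
rewrite !mxE E; set w := s *: (v - u) + u in Bs *.
have -> : \sum_a (v - u) 0 a * pd a (fun v => F v 0 k) w - (v 0 k - u 0 k) =
    \sum_a (v - u) 0 a * (partials F w k a - (k == a)%:R).
  under [RHS]eq_bigr => a _ do rewrite mulrBr [partials F w k a]mxE.
  rewrite sumrB; congr (_ - _); rewrite (bigD1 k) //= eqxx mulr1 big1 ?addr0 ?mxE //.
  by move=> a; rewrite eq_sym => /negbTE ->; rewrite mulr0.
apply: (@le_trans _ _ (m%:R * (`|v - u| * (2 * m.+1%:R)^-1))).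
  by apply: sum_norm_le => a; rewrite normrM ler_pM ?row_coord_le ?FJ.
rewrite mulrCA ler_wpM2l // invfM mulrCA ler_piMr ?invr_ge0 //.
by rewrite ler_pdivrMr ?ltr0Sn // mul1r ler_nat.
Qed.

Lemma closed_ball_row_compact u1 (s : R) : 0 < s -> compact (closed_ball u1 s).
Proof.
move=> s0; apply: bounded_closed_compact; last exact: closed_ball_closed.
exists (`|u1| + s); split; first exact: num_real.
move=> M /ltW sM u; rewrite closed_ballE // => us; apply: le_trans sM.
rewrite -[u](subrK u1) addrC (le_trans (ler_normD _ _)) // lerD2l.
by rewrite distrC.
Qed.

(* The image point closest to y has y itself as its value: the Newton step from
   any other candidate would come closer. *)
Lemma near_identity_onto F u1 s y :
  0 < s -> (forall u, closed_ball u1 s u -> {for u, continuous F}) ->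
  (forall u v, closed_ball u1 s u -> closed_ball u1 s v ->
    `|F v - F u - (v - u)| <= `|v - u| / 2) ->
  `|F u1 - y| < s / 8 -> exists2 u, closed_ball u1 s u & F u = y.
Proof.
move=> s0 cF nearF yF.
have K1 : closed_ball u1 s u1 by exact: closed_ballxx.
have KE u : closed_ball u1 s u <-> `|u1 - u| <= s by rewrite closed_ballE.
have cK := closed_ball_row_compact (u1 := u1) s0.
have [|||u] := @EVT_min_rV R m (fun u => `|F u - y|) (closed_ball u1 s).
- by exists u1.
- exact: cK.
- apply: continuous_in_subspaceT => u; rewrite inE => Ku.
  apply: (continuous_comp (f := fun u => F u - y) (g := Num.norm)).
    by apply: continuousB; [exact: cF|exact: cst_continuous].
  exact: norm_continuous.
rewrite inE => Ku umin; exists u => //.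
pose d := y - F u.
have dE : `|d| = `|F u - y| by rewrite distrC.
have d8 : `|d| < s / 8.
  by rewrite dE; apply: le_lt_trans yF; apply: umin; rewrite inE.
(* The minimizer lies within [s / 2] of the centre and the Newton step [d] is shorter than [s / 8],
   so [u + d] is still a candidate in the closed ball. *)
have uu1 : `|u - u1| <= s / 2.
  have := nearF _ _ K1 Ku; have h1 : `|F u - F u1| <= s / 4.
    have hy : `|y - F u1| < s / 8 by rewrite distrC.
    rewrite -(subrKA y) (le_trans (ler_normD _ _)) // -dE.
    by move: d8 hy; lra.
  have h2 : `|u - u1| <= `|F u - F u1| + `|F u - F u1 - (u - u1)|.
    rewrite -[X in `|X| <= _](subKr (F u - F u1)) (le_trans (ler_normB _ _)) //.
  by move: h1 h2; lra.
have Kud : closed_ball u1 s (u + d).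
  apply/KE; rewrite opprD addrA (le_trans (ler_normB _ _)) // distrC.
  by move: uu1 d8; lra.
have ud : u + d - u = d by rewrite addrAC subrr add0r.
have := nearF _ _ Ku Kud; rewrite ud => h.
have := umin (u + d); rewrite inE => /(_ Kud); rewrite -dE => hmin.
have Ed : y = F u + d by rewrite /d addrC subrK.
have h3 : `|F (u + d) - y| <= `|d| / 2 by rewrite Ed opprD addrA.
have : `|d| <= 0 by lra.
by rewrite normr_le0 subr_eq0 => /eqP.
Qed.

End InverseFunction.

(** * The inverse function theorem *)

Section LocalInverse.
Variables (R : realType) (m : nat).
Implicit Types (D W : set 'rV[R]_m) (u v y : 'rV[R]_m) (F : 'rV[R]_m -> 'rV[R]_m).

Local Notation pd a f := ('D_(delta_mx 0 a) f).

Lemma mulmx_norm_le v (Q : 'M[R]_m) : `|v *m Q| <= (\sum_k \sum_j `|Q j k|) * `|v|.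
Proof.
apply: row_norm_le => [|k].
  by rewrite mulr_ge0 // sumr_ge0 // => k _; rewrite sumr_ge0.
rewrite mxE (le_trans (ler_norm_sum _ _ _)) //.
rewrite (@le_trans _ _ (\sum_j `|Q j k| * `|v|)) //.
  by apply: ler_sum => j _; rewrite normrM mulrC ler_wpM2l ?row_coord_le.
rewrite -mulr_suml ler_wpM2r // [leRHS](bigD1 k) //= lerDl sumr_ge0 // => j _.
by rewrite sumr_ge0.
Qed.

Lemma class_C_mulmx k D F (Q : 'M[R]_m) : open D ->
  (forall j, class_C k D (fun u => F u 0 j)) ->
  forall j, class_C k D (fun u => (F u *m Q) 0 j).
Proof.
move=> oD FC j; apply: (@class_C_ext _ _ _ _ (fun u => \sum_i F u 0 i * Q i j)) => //.
  by move=> u _; rewrite mxE.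
apply: class_C_sum => // i _; apply: class_CM => //; exact: class_C_cst.
Qed.

Lemma partials_mulmx D F (P : 'M[R]_m) u : open D -> D u ->
  (forall k, class_C 1 D (fun v => F v 0 k)) ->
  partials (fun v => F v *m P^T) u = P *m partials F u.
Proof.
move=> oD Du FC; apply/matrixP => k a; rewrite !mxE.
have dF i : derivable (fun v => F v 0 i) u (delta_mx 0 a).
  exact: class_C_derivable (FC i) Du.
have -> : (fun v => (F v *m P^T) 0 k) = \sum_i (P k i \*: (fun v => F v 0 i)).
  apply/funext => v; rewrite mxE fct_sumE; apply: eq_bigr => i _.
  by rewrite mxE mulrC.
rewrite derive_sum; last by move=> i; exact: derivableZ.
by apply: eq_bigr => i _; rewrite deriveZ // mxE.
Qed.

Theorem local_inverse F D u0 : open D -> D u0 ->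
  (forall k, smooth D (fun u => F u 0 k)) -> partials F u0 \in unitmx ->
  exists W Fi, [/\ open W, W u0, W `<=` D, open (F @` W) &
    (forall u, W u -> Fi (F u) = u) /\
    forall b, smooth (F @` W) (fun y => Fi y 0 b)].
Proof.
move=> oD Du0 FS uA; set P := invmx (partials F u0).
have FC1 k : class_C 1 D (fun v => F v 0 k) := FS k 1.
(* This normalizes the Jacobian at [u0] to the identity; points are row vectors, whence the
   transpose. *)
pose G u := F u *m P^T.
have GC1 k : class_C 1 D (fun v => G v 0 k) by exact: class_C_mulmx.
have JC k a : class_C 0 D (fun u => partials F u k a).
  apply: class_C_ext oD _ (class_C_pd a (FC1 k)) => u _; by rewrite mxE.
have JGC k a : class_C 0 D (fun u => partials G u k a).
  apply: class_C_ext oD _ (class_C_pd a (GC1 k)) => u _; by rewrite mxE.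
have JG0 : partials G u0 = 1%:M.
  by rewrite (partials_mulmx P oD Du0 FC1) mulVmx.
pose eps : R := (2 * m.+1%:R)^-1.
have eps0 : 0 < eps by rewrite invr_gt0 mulr_gt0.
have near1 : \forall u \near u0, forall ka : 'I_m * 'I_m,
    `|partials G u ka.1 ka.2 - (ka.1 == ka.2)%:R| <= eps.
  apply: (@filter_forall _ _ (fun (ka : 'I_m * 'I_m) u =>
    `|partials G u ka.1 ka.2 - (ka.1 == ka.2)%:R| <= eps) (nbhs u0)) => -[k a] /=.
  have /cvgrPdist_le /(_ _ eps0) := class_C_cont (JGC k a) Du0.
  by rewrite JG0 mxE; apply: filterS => u; rewrite distrC.
have near2 : \forall u \near u0, \det (partials F u) != 0.
  have dC := class_C_cont (class_C_det oD JC) Du0.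
  have d0 : 0 < `|\det (partials F u0)|.
    by rewrite normr_gt0 -unitfE -unitmxE.
  have /cvgrPdist_lt /(_ _ d0) := dC.
  by apply: filterS => u; apply: contraTneq => ->; rewrite subr0 ltxx.
have nD : \forall u \near u0, D u by exact: near_in_open oD Du0 _.
have /nbhs_ballP[r /= r0 rP] : \forall u \near u0, D u /\
    (forall ka : 'I_m * 'I_m, `|partials G u ka.1 ka.2 - (ka.1 == ka.2)%:R| <= eps) /\
    \det (partials F u) != 0.
  by apply: filterI nD _; exact: filterI.
have rD : ball u0 r `<=` D by move=> u /rP[].
have nearG := @near_identity _ _ G u0 r
  (fun k => class_C_sub rD (GC1 k)) (fun u k a Bu => (rP u Bu).2.1 (k, a)).
set W := ball u0 r in rP rD nearG.
(* [G] shrinks distances by at most a factor 2: hence [F] is injective on [W] and its inverse is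
   Lipschitz. *)
have Gexp u v : W u -> W v -> `|v - u| <= 2 * `|G v - G u|.
  move=> Wu Wv; have h := nearG u v Wu Wv.
  have := ler_normB (G v - G u) (G v - G u - (v - u)).
  by rewrite subKr; move: h; lra.
have Gcont u : W u -> {for u, continuous G}.
  move=> Wu; apply: row_continuous => b; exact: class_C_cont (GC1 b) (rD _ Wu).
have GE y u : y *m P^T = G u -> y = F u.
  have uP : P^T \in unitmx by rewrite unitmx_tr unitmx_inv.
  by move=> /(congr1 (fun z => z *m invmx P^T)); rewrite !mulmxK.
have oGW : open (G @` W).
  rewrite openE => _ [u1 Wu1 <-].
  pose s := (r - `|u0 - u1|) / 2.
  have s0 : 0 < s.
    by rewrite divr_gt0 // subr_gt0; move: Wu1; rewrite /W -ball_normE.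
  have sW : closed_ball u1 s `<=` W.
    move=> u; rewrite closed_ballE // /closed_ball_ /= /W -ball_normE /= => us.
    rewrite -(subrKA u1) (le_lt_trans (ler_normD _ _)) //.
    by move: us s0; rewrite /s; lra.
  have s80 : 0 < s / 8 by rewrite divr_gt0.
  apply/nbhs_ballP; exists (s / 8) => //= y; rewrite -ball_normE /= => yG.
  have [u Ku <-] := near_identity_onto s0 (fun u Ku => Gcont u (sW u Ku))
    (fun u v Ku Kv => nearG u v (sW u Ku) (sW v Kv)) yG.
  by exists u => //; exact: sW.
have FWE : F @` W = (fun y => y *m P^T) @^-1` (G @` W).
  apply/seteqP; split=> [_ [u Wu <-]|y [u Wu /esym/GE ->]]; by exists u.
have oFW : open (F @` W).
  rewrite FWE; apply: open_comp => // y _; apply: row_continuous => b.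
  apply: (@class_C_cont _ _ 0 setT) => //.
  by apply: class_C_mulmx => [|j]; [exact: openT|exact: class_C_coord].
pose Fi y := get (fun u => W u /\ F u = y).
have FiP y : (F @` W) y -> W (Fi y) /\ F (Fi y) = y.
  move=> [u Wu Fu]; have ex : exists u, W u /\ F u = y by exists u.
  exact: (getPex ex).
have FiK u : W u -> Fi (F u) = u.
  move=> Wu; have [W' E] := FiP _ (imageP F Wu).
  have := Gexp u _ Wu W'; rewrite /G E subrr normr0 mulr0 normr_le0 subr_eq0.
  by move=> /eqP.
pose L := 2 * \sum_k \sum_j `|P^T j k|.
have L0 : 0 <= L.
  by rewrite mulr_ge0 // sumr_ge0 // => k _; rewrite sumr_ge0.
have FiL y z : (F @` W) y -> (F @` W) z -> `|Fi z - Fi y| <= L * `|z - y|.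
  move=> /FiP[Wy Fy] /FiP[Wz Fz]; apply: le_trans (Gexp _ _ Wy Wz) _.
  rewrite /G Fy Fz -mulmxBl /L -mulrA ler_wpM2l //; exact: mulmx_norm_le.
have near_image y : (F @` W) y -> \forall z \near y, (F @` W) z.
  by move=> FWy; exact: near_in_open oFW FWy _.
have FiC y b : (F @` W) y -> {for y, continuous (fun y => Fi y 0 b)}.
  move=> FWy; apply: coord_continuous_at; apply/(@cvgrPdist_le _ _ _ (nbhs y)) => e e0.
  have L1 : 0 < L + 1 by rewrite ltr_pwDr.
  near=> z; rewrite distrC.
  have FWz : (F @` W) z by near: z; exact: near_image.
  apply: (le_trans (FiL y z FWy FWz)).
  have zy : `|y - z| <= e / (L + 1).
    by near: z; apply: cvgr_dist_le; rewrite ?divr_gt0.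
  rewrite distrC (@le_trans _ _ ((L + 1) * (e / (L + 1)))) //.
    by rewrite ler_pM // lerDl.
  by rewrite mulrC divfK // gt_eqF.
have unitJ u : W u -> partials F u \in unitmx.
  by move=> /rP[_ [_ d0]]; rewrite unitmxE unitfE.
have dFi y (a b : 'I_m) : (F @` W) y -> is_derive y (delta_mx 0 a) (fun y => Fi y 0 b)
    (invmx (partials F (Fi y)) b a).
  move=> FWy; apply: is_derive_of_bound => d d0.
  have [Wu Fu] := FiP y FWy; set u := Fi y in Wu Fu *.
  set Q := invmx (partials F u).
  pose S := \sum_k `|Q b k|.
  have S0 : 0 <= S by rewrite sumr_ge0.
  (* The remainder of the expansion of [F] passes through the row of [Q], of size [S], and through
     the Lipschitz constant [L] of the inverse; this choice leaves at most [d]. *)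
  pose d' := d / (S * L + 1).
  have SL1 : 0 < S * L + 1 by rewrite ltr_pwDr // mulr_ge0.
  have d'0 : 0 < d' by rewrite divr_gt0.
  have exps : \forall h \near (0 : 'rV[R]_m), forall k,
      `|F (h + u) 0 k - F u 0 k - \sum_c h 0 c * pd c (fun v => F v 0 k) u| <= d' * `|h|.
    apply: (@filter_forall _ _ (fun k h => `|F (h + u) 0 k - F u 0 k
      - \sum_c h 0 c * pd c (fun v => F v 0 k) u| <= d' * `|h|) (nbhs (0 : 'rV[R]_m))).
    by move=> k; exact: C1_expansion oD (FC1 k) (rD _ Wu) d' d'0.
  move: exps => /nbhs_ballP[t /= t0 tP].
  have FWs : \forall s \near (0 : R), (F @` W) (s *: delta_mx 0 a + y).
    have cl : s *: (delta_mx 0 a : 'rV[R]_m) + y @[s --> (0 : R)] -->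
        (0 : R) *: (delta_mx 0 a : 'rV[R]_m) + y.
      apply: cvgD; last exact: cvg_cst.
      by apply: cvgZr_tmp; exact: cvg_id.
    apply: cl.
    by rewrite scale0r add0r; exact: near_image.
  have L1 : 0 < L + 1 by rewrite ltr_pwDr.
  have near_small : \forall s \near (0 : R), `|s| < t / (L + 1).
    apply/nbhs_ballP; exists (t / (L + 1)); first by rewrite /= divr_gt0.
    by move=> s; rewrite -ball_normE /= sub0r normrN.
  near=> s.
  have FWv : (F @` W) (s *: delta_mx 0 a + y) by near: s; exact: FWs.
  have [Ws Fs] := FiP _ FWv; set v := Fi (s *: delta_mx 0 a + y) in Ws Fs *.
  have vu : `|v - u| <= L * `|s|.
    apply: le_trans (FiL _ _ FWy FWv) _; rewrite addrK ler_wpM2l //.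
    apply: row_norm_le => // j; rewrite !mxE eqxx /=.
    by case: eqP => _; rewrite ?mulr1 // mulr0 normr0.
  have small : `|v - u| < t.
    apply: le_lt_trans vu _; rewrite (@le_lt_trans _ _ ((L + 1) * `|s|)) //.
      by rewrite ler_wpM2r // lerDl.
    by rewrite -ltr_pdivlMl // mulrC; near: s; exact: near_small.
  have {}tP k : `|F v 0 k - F u 0 k
      - \sum_c (v - u) 0 c * pd c (fun v => F v 0 k) u| <= d' * `|v - u|.
    have := tP (v - u); rewrite -ball_normE /= sub0r normrN => /(_ small k).
    by rewrite subrK.
  (* Here [F v - F u] is [s] times the [a]-th basis vector, and [Q] inverts the Jacobian at [u];
     applying [Q] to the first-order expansion of [F] leaves minus [Q] times the remainder. *)
  have -> : v 0 b - u 0 b - s * Q b a = \sum_k - Q b k * (F v 0 k - F u 0 k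
      - \sum_c (v - u) 0 c * pd c (fun v => F v 0 k) u).
    under eq_bigr => k _ do rewrite mulNr mulrBr opprB.
    rewrite sumrB; congr (_ - _).
      have := congr1 (fun M : 'cV[R]_m => M b 0) (mulKmx (unitJ u Wu) (v - u)^T).
      rewrite !mxE => <-; apply: eq_bigr => k _; rewrite !mxE; congr (_ * _).
      by apply: eq_bigr => c _; rewrite !mxE mulrC.
    rewrite Fs Fu (bigD1 a) //= big1 ?addr0.
      by rewrite !mxE !eqxx /= mulr1 addrK mulrC.
    by move=> k ka; rewrite !mxE eqxx (negbTE ka) /= mulr0 add0r subrr mulr0.
  rewrite (le_trans (ler_norm_sum _ _ _)) //.
  rewrite (@le_trans _ _ (\sum_k `|Q b k| * (d' * (L * `|s|)))) //.
    apply: ler_sum => k _; rewrite normrM normrN ler_wpM2l //.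
    by apply: le_trans (tP k) _; rewrite ler_wpM2l // ltW.
  rewrite -mulr_suml -/S.
  have -> : S * (d' * (L * `|s|)) = (S * L) * d' * `|s| by ring.
  rewrite ler_wpM2r // (@le_trans _ _ ((S * L + 1) * d')) //.
    by rewrite ler_wpM2r ?lerDl // ltW.
  by rewrite /d' mulrC divfK // gt_eqF.
exists W, Fi; split=> //; [exact: ball_open|exact: ballxx|split=> // b k].
elim: k b => [|k IH] b.
  by split=> // y; exact: FiC.
apply: (@class_CS_intro _ _ k _ _ oFW).
- by move=> y a FWy; have [] := dFi y a b FWy.
- by move=> y; exact: FiC.
(* The partial derivatives of the inverse are entries of the inverse Jacobian of [F] composed with
   [Fi], so class C^k of [Fi] gives class C^k of its partial derivatives. *)
move=> a; apply: (@class_C_ext _ _ _ _ (fun y => invmx (partials F (Fi y)) b a)) => //.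
  by move=> y FWy; have [_] := dFi y a b FWy.
apply: class_C_invmx => // [y /FiP[Wy _]|k' c]; first exact: unitJ.
apply: (@class_C_ext _ _ _ _ (fun y => pd c (fun v => F v 0 k') (Fi y))) => //.
  by move=> y _; rewrite mxE.
apply: (class_C_comp oFW oD _ IH (class_C_pd c (FS k' k.+1))) => y /FiP[Wy _].
exact: rD.
Unshelve. all: by end_near.
Qed.

End LocalInverse.

(** * Charts *)

Section ChartCalculus.
Variables (R : realType) (m : nat) (M : smooth_manifold R m).
Local Notation chart := (chart R m M).
Implicit Types (c e : chart) (U V : set M) (f g : M -> R) (p q : M).

Definition chart_image c U : set 'rV[R]_m := coord c @` (dom c `&` U).

Lemma dom_open c : atlas c -> open (dom c).
Proof. by move=> /atlas_chart[]. Qed.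

Lemma coordK c p : atlas c -> dom c p -> coordV c (coord c p) = p.
Proof. by move=> /atlas_chart[_ _ cK _ _]; exact: cK. Qed.

Lemma coord_continuous_dom c p : atlas c -> dom c p -> {for p, continuous (coord c)}.
Proof. by move=> /atlas_chart[_ _ _ cc _]; exact: cc. Qed.

Lemma chart_imageP c U u : atlas c -> chart_image c U u ->
  [/\ dom c (coordV c u), U (coordV c u) & coord c (coordV c u) = u].
Proof. by move=> ac [p [cp Up] <-]; rewrite coordK. Qed.

Lemma chart_image_coord c U p : dom c p -> U p -> chart_image c U (coord c p).
Proof. by move=> cp Up; exists p. Qed.

Lemma chart_imageS c U V : U `<=` V -> chart_image c U `<=` chart_image c V.
Proof. by move=> UV u [p [cp Up] <-]; exists p => //; split=> //; exact: UV. Qed.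

Lemma coordV_continuous c U u : atlas c -> chart_image c U u ->
  {for u, continuous (coordV c)}.
Proof.
move=> /atlas_chart[_ _ _ _ cc] [p [cp _] <-]; apply: cc; by exists p.
Qed.

Lemma chart_image_open c U : atlas c -> open U -> open (chart_image c U).
Proof.
move=> ac oU; have [_ oi _ _ _] := atlas_chart ac.
rewrite openE => u Iu; have [cu Uu uE] := chart_imageP ac Iu.
have : \forall v \near u, (coord c @` dom c) v /\ U (coordV c v).
  apply: filterI; first by apply: open_nbhs_nbhs; split=> //; rewrite -uE; exists (coordV c u).
  by apply: (coordV_continuous ac Iu); exact: open_nbhs_nbhs.
apply: filterS => v [[q cq <-]]; rewrite coordK // => Uq; by exists q.
Qed.

Lemma smooth_in_ext c U f g : atlas c -> open U ->
  (forall p, dom c p -> U p -> f p = g p) -> smooth_in c U f -> smooth_in c U g.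
Proof.
move=> ac oU fg fS k; apply: class_C_ext (chart_image_open ac oU) _ (fS k) => u.
by move=> /(chart_imageP ac)[cu Uu _]; exact: fg.
Qed.

Lemma smooth_in_sub c U V f : U `<=` V -> smooth_in c V f -> smooth_in c U f.
Proof. by move=> UV fS k; apply: class_C_sub (fS k); exact: chart_imageS. Qed.

Lemma smooth_in_cst c U (x : R) : smooth_in c U (fun=> x).
Proof. by move=> k; exact: class_C_cst. Qed.

Lemma smooth_inD c U f g : atlas c -> open U ->
  smooth_in c U f -> smooth_in c U g -> smooth_in c U (fun p => f p + g p).
Proof.
by move=> ac oU fS gS k; exact: class_CD (chart_image_open ac oU) (fS k) (gS k).
Qed.

Lemma smooth_inN c U f : atlas c -> open U ->
  smooth_in c U f -> smooth_in c U (fun p => - f p).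
Proof. by move=> ac oU fS k; exact: class_CN (chart_image_open ac oU) (fS k). Qed.

Lemma smooth_inM c U f g : atlas c -> open U ->
  smooth_in c U f -> smooth_in c U g -> smooth_in c U (fun p => f p * g p).
Proof.
by move=> ac oU fS gS k; exact: class_CM (chart_image_open ac oU) (fS k) (gS k).
Qed.

Lemma smooth_in_sum c U (I : Type) (r : seq I) (F : I -> M -> R) :
  atlas c -> open U -> (forall i, smooth_in c U (F i)) ->
  smooth_in c U (fun p => \sum_(i <- r) F i p).
Proof.
move=> ac oU FS k; apply: class_C_sum; first exact: chart_image_open.
by move=> i _; exact: FS.
Qed.

Lemma smooth_in_coord c U k : atlas c -> open U ->
  smooth_in c U (fun p => coord c p 0 k).
Proof.
move=> ac oU j.
apply: class_C_ext (chart_image_open ac oU) _ (class_C_coord j _ k) => u.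
by move=> /(chart_imageP ac)[_ _ /= ->].
Qed.

Lemma smooth_in_pderiv c U a f : atlas c -> open U ->
  smooth_in c U f -> smooth_in c U (pderiv c a f).
Proof.
move=> ac oU fS k.
apply: class_C_ext (chart_image_open ac oU) _ (class_C_pd a (fS k.+1)) => u.
by move=> /(chart_imageP ac)[_ _ /= uE]; rewrite /pderiv uE.
Qed.

Lemma smooth_in_derivable c U a f p : smooth_in c U f -> dom c p -> U p ->
  derivable (f \o coordV c) (coord c p) (delta_mx 0 a).
Proof.
by move=> fS cp Up; exact: class_C_derivable (fS 1) (chart_image_coord cp Up).
Qed.

Lemma smooth_in_continuous c U f p : atlas c -> open U -> smooth_in c U f ->
  dom c p -> U p -> {for p, continuous f}.
Proof.
move=> ac oU fS cp Up.
apply: (@continuous_at_near_eq _ _ (f \o coordV c \o coord c)).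
  apply: (@near_in_open _ (dom c `&` U)) => [||q [cq _]].
  - by apply: openI => //; exact: dom_open.
  - by [].
  - by rewrite /= coordK.
apply: continuous_comp; first exact: coord_continuous_dom.
exact: class_C_cont (fS 0) (chart_image_coord cp Up).
Qed.

Lemma eq_pderiv c U a f g p : atlas c -> open U -> dom c p -> U p ->
  (forall q, dom c q -> U q -> f q = g q) -> pderiv c a f p = pderiv c a g p.
Proof.
move=> ac oU cp Up fg; apply: near_eq_derive.
apply: (@near_in_open _ (chart_image c U)); first exact: chart_image_open.
  exact: chart_image_coord.
by move=> u /(chart_imageP ac)[cu Uu _]; exact: fg.
Qed.

Lemma pderiv_cst c a (x : R) p : pderiv c a (fun=> x) p = 0.
Proof. exact: derive_cst. Qed.

Section Rules.
Variables (c : chart) (U : set M) (p : M) (a : 'I_m).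
Hypotheses (ac : atlas c) (oU : open U) (cp : dom c p) (Up : U p).

Lemma pderivD f g : smooth_in c U f -> smooth_in c U g ->
  pderiv c a (fun q => f q + g q) p = pderiv c a f p + pderiv c a g p.
Proof.
by move=> fS gS; exact: deriveD (smooth_in_derivable (a := a) fS cp Up)
  (smooth_in_derivable (a := a) gS cp Up).
Qed.

Lemma pderivN f : smooth_in c U f -> pderiv c a (fun q => - f q) p = - pderiv c a f p.
Proof. by move=> fS; exact: deriveN (smooth_in_derivable (a := a) fS cp Up). Qed.

Lemma pderivB f g : smooth_in c U f -> smooth_in c U g ->
  pderiv c a (fun q => f q - g q) p = pderiv c a f p - pderiv c a g p.
Proof.
by move=> fS gS; exact: deriveB (smooth_in_derivable (a := a) fS cp Up)
  (smooth_in_derivable (a := a) gS cp Up).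
Qed.

Lemma pderivM f g : smooth_in c U f -> smooth_in c U g ->
  pderiv c a (fun q => f q * g q) p = f p * pderiv c a g p + g p * pderiv c a f p.
Proof.
move=> fS gS; have := deriveM (smooth_in_derivable (a := a) fS cp Up)
  (smooth_in_derivable (a := a) gS cp Up).
by rewrite /= (coordK ac cp).
Qed.

Lemma pderivZ (x : R) f : smooth_in c U f ->
  pderiv c a (fun q => x * f q) p = x * pderiv c a f p.
Proof. by move=> fS; exact: (@deriveZ _ _ _ _ x _ _ (smooth_in_derivable (a := a) fS cp Up)). Qed.

Lemma pderiv_sum n (F : 'I_n -> M -> R) : (forall i, smooth_in c U (F i)) ->
  pderiv c a (fun q => \sum_i F i q) p = \sum_i pderiv c a (F i) p.
Proof.
move=> FS; rewrite /pderiv.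
have -> : (fun q => \sum_i F i q) \o coordV c = \sum_i (F i \o coordV c).
  by apply/funext => u; rewrite /= fct_sumE.
by apply: derive_sum => i; exact: smooth_in_derivable (FS i) cp Up.
Qed.

End Rules.

Lemma pderiv_coord c a k p : atlas c -> dom c p ->
  pderiv c a (fun q => coord c q 0 k) p = (a == k)%:R.
Proof.
move=> ac cp.
have [_ E] := is_derive_coord (coord c p) (delta_mx 0 a) k.
rewrite mxE eqxx /= eq_sym in E; rewrite -E; apply: near_eq_derive.
apply: (@near_in_open _ (chart_image c setT)).
- by apply: chart_image_open => //; exact: openT.
- exact: chart_image_coord.
by move=> u /(chart_imageP ac)[_ _ /= ->].
Qed.

Lemma transition_smooth c c' k : atlas c -> atlas c' ->
  smooth_in c (dom c') (fun p => coord c' p 0 k).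
Proof. by move=> ac ac'; have [+ _] := atlas_compatible ac ac'; exact. Qed.

Lemma smooth_in_change c c' U f : atlas c -> atlas c' -> open U ->
  U `<=` dom c -> smooth_in c U f -> smooth_in c' U f.
Proof.
move=> ac ac' oU Uc fS k.
have oI := chart_image_open ac oU; have oI' := chart_image_open ac' oU.
apply: (@class_C_ext _ _ _ _ (fun u => (f \o coordV c) (coord c (coordV c' u)))) => //.
  by move=> u /(chart_imageP ac')[_ /Uc cu _] /=; rewrite coordK.
apply: (@class_C_comp _ _ _ _ (chart_image c' U) (chart_image c U)
  (fun u => coord c (coordV c' u))) => //.
- move=> u /(chart_imageP ac')[_ Uu _]; apply: chart_image_coord => //; exact: Uc.
- move=> b; apply: class_C_sub (transition_smooth b ac' ac k).
  exact: chart_imageS.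
Qed.

Lemma smooth_in_on c U f : atlas c -> open U -> U `<=` dom c ->
  smooth_in c U f -> smooth_on U f.
Proof. by move=> ac oU Uc fS c' ac'; exact: smooth_in_change fS. Qed.

Lemma pderiv_change c c' U a f p : atlas c -> atlas c' -> open U ->
  dom c p -> dom c' p -> U p -> smooth_in c' U f ->
  pderiv c a f p = \sum_k pderiv c' k f p * jacobian c c' p k a.
Proof.
move=> ac ac' oU cp c'p Up fS.
pose V := U `&` (dom c `&` dom c').
have oV : open V by apply: openI => //; apply: openI; exact: dom_open.
have Vp : V p by [].
pose T u := coord c' (coordV c u).
have I : chart_image c V (coord c p) by exact: chart_image_coord.
have TC k : class_C 1 (chart_image c V) (fun u => T u 0 k).
  apply: class_C_sub (transition_smooth k ac ac' 1).
  by apply: chart_imageS => q [_ []].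
have TI : chart_image c' U (T (coord c p)).
  by rewrite /T coordK //; exact: chart_image_coord.
have [_ E] := @is_derive_comp_C1 _ _ _ _ _ T (f \o coordV c') (coord c p) (delta_mx 0 a)
  (chart_image_open ac oV) (chart_image_open ac' oU) TC (fS 1) I TI.
transitivity ('D_(delta_mx 0 a) (fun w => (f \o coordV c') (T w)) (coord c p)).
  apply: near_eq_derive.
  apply: (@near_in_open _ (chart_image c V)) => //; first exact: chart_image_open.
  by move=> u /(chart_imageP ac)[_ [_ [_ c'u]] _] /=; rewrite /T coordK.
rewrite E; apply: eq_bigr => k _; rewrite mulrC mxE; congr (_ * _).
by rewrite /pderiv /T coordK.
Qed.

Lemma differential_change c c' U f p : atlas c -> atlas c' -> open U ->
  dom c p -> dom c' p -> U p -> smooth_in c' U f ->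
  differential c f p = differential c' f p *m jacobian c c' p.
Proof.
move=> ac ac' oU cp c'p Up fS; apply/rowP => a; rewrite !mxE.
rewrite (pderiv_change a ac ac' oU cp c'p Up fS).
by apply: eq_bigr => k _; rewrite [in RHS]mxE.
Qed.

Lemma jacobian_inverse c c' p : atlas c -> atlas c' -> dom c p -> dom c' p ->
  jacobian c' c p *m jacobian c c' p = 1%:M.
Proof.
move=> ac ac' cp c'p; apply/matrixP => k a; rewrite [LHS]mxE mxE eq_sym.
rewrite -(pderiv_coord a k ac cp).
rewrite (pderiv_change a ac ac' (dom_open ac) cp c'p cp (transition_smooth k ac' ac)).
by apply: eq_bigr => l _; rewrite [jacobian c' c p k l]mxE.
Qed.

Lemma jacobian_unit c c' p : atlas c -> atlas c' -> dom c p -> dom c' p ->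
  jacobian c c' p \in unitmx.
Proof.
move=> ac ac' cp c'p; have := jacobian_inverse ac ac' cp c'p.
by move=> /mulmx1_unit[].
Qed.

End ChartCalculus.

Section ChartConstructions.
Variables (R : realType) (m : nat) (M : smooth_manifold R m).
Local Notation chart := (chart R m M).
Implicit Types (c e : chart) (U V : set M) (f g : M -> R) (p q : M).

Definition restrict_chart c U : chart := Chart (dom c `&` U) (coord c) (coordV c).

Lemma restrict_chart_atlas c U : atlas c -> open U -> atlas (restrict_chart c U).
Proof.
move=> ac oU; apply: atlas_maximal => [|c' ac'].
  split=> /=.
  - by apply: openI => //; exact: dom_open.
  - exact: chart_image_open.
  - by move=> p [cp _]; exact: coordK.
  - by move=> p [cp _]; exact: coord_continuous_dom.
  - by move=> u; exact: coordV_continuous.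
split=> k j.
  apply: class_C_sub (transition_smooth k ac ac' j).
  by move=> _ [q [[cq _] c'q] <-]; exists q.
apply: class_C_sub (transition_smooth k ac' ac j).
by apply: chart_imageS => q [].
Qed.

Definition chart_ball c p (r : R) : set M :=
  dom c `&` coord c @^-1` ball (coord c p) r.

Lemma chart_ball_open c p r : atlas c -> open (chart_ball c p r).
Proof.
move=> ac; rewrite openE => q [cq Bq].
have nB : \forall q' \near q, ball (coord c p) r (coord c q').
  apply: (coord_continuous_dom ac cq).
  by apply: open_nbhs_nbhs; split => //; exact: ball_open.
have nc : \forall q' \near q, dom c q' by exact: near_in_open (dom_open ac) cq _.
exact: filterI nc nB.
Qed.

Lemma chart_ball_center c p r : dom c p -> 0 < r -> chart_ball c p r p.
Proof. by move=> cp r0; split=> //; exact: ballxx. Qed.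

Lemma chart_ball_sub c p U r : atlas c -> ball (coord c p) r `<=` chart_image c U ->
  chart_ball c p r `<=` U.
Proof.
move=> ac BU q [cq /BU /(chart_imageP ac)[_ + _]].
by rewrite coordK.
Qed.

Lemma chart_ball_image c p U r : atlas c -> ball (coord c p) r `<=` chart_image c U ->
  chart_image c (chart_ball c p r) = ball (coord c p) r.
Proof.
move=> ac BU; apply/seteqP; split=> [u [q [_ [_ Bq]] <-]//|u Bu].
have [cu Uu uE] := chart_imageP ac (BU u Bu).
by exists (coordV c u) => //; split=> //; split=> //=; rewrite uE.
Qed.

Lemma ex_chart_ball c p U : atlas c -> dom c p -> open U -> U p ->
  exists2 r, 0 < r & ball (coord c p) r `<=` chart_image c U.
Proof.
move=> ac cp oU Up.
have /nbhs_ballP[r r0 rU] : nbhs (coord c p) (chart_image c U).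
  apply: open_nbhs_nbhs; split; first exact: chart_image_open.
  exact: chart_image_coord.
by exists r.
Qed.

Lemma chart_constant c p U r f q : atlas c ->
  ball (coord c p) r `<=` chart_image c U -> dom c p -> smooth_in c U f ->
  (forall q a, chart_ball c p r q -> pderiv c a f q = 0) ->
  chart_ball c p r q -> f q = f p.
Proof.
move=> ac BU cp fS f0 [cq Bq].
have fC : class_C 1 (ball (coord c p) r) (f \o coordV c).
  exact: class_C_sub BU (fS 1).
have := ball_pd_eq0 fC _ Bq; rewrite /= !coordK //; apply.
move=> u a Bu; have [cu _ uE] := chart_imageP ac (BU u Bu).
by have := f0 (coordV c u) a; rewrite /pderiv /chart_ball /= uE; exact.
Qed.

Lemma chart_pullback c p U r (f : 'rV[R]_m -> R) : atlas c ->
  ball (coord c p) r `<=` chart_image c U -> smooth (ball (coord c p) r) f ->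
  smooth_in c (chart_ball c p r) (f \o coord c) /\
  forall q a, chart_ball c p r q ->
    pderiv c a (f \o coord c) q = 'D_(delta_mx 0 a) f (coord c q).
Proof.
move=> ac BU fS; have IE := chart_ball_image ac BU.
have fV u : ball (coord c p) r u -> f u = (f \o coord c \o coordV c) u.
  by move=> /BU /(chart_imageP ac)[_ _ uE] /=; rewrite uE.
split=> [k|q a [cq Bq]].
  rewrite -/(chart_image _ _) IE; apply: class_C_ext (ball_open _ _) _ (fS k).
  exact: fV.
apply/esym/near_eq_derive.
by apply: near_in_open (ball_open _ _) Bq _ => u Bu; exact: fV.
Qed.

Lemma chart_poincare c p U r (omega : 'I_m -> M -> R) : atlas c ->
  ball (coord c p) r `<=` chart_image c U ->
  (forall a, smooth_in c U (omega a)) ->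
  (forall q a b, U q -> dom c q -> pderiv c a (omega b) q = pderiv c b (omega a) q) ->
  exists2 f, smooth_in c (chart_ball c p r) f &
    forall q a, chart_ball c p r q -> pderiv c a f q = omega a q.
Proof.
move=> ac BU oS closed.
have [a k|u a b Bu|f fS fE] := @poincare _ _ (coord c p) r (fun a => omega a \o coordV c).
- exact: class_C_sub BU (oS a k).
- have [cu Uu uE] := chart_imageP ac (BU u Bu).
  by have := closed _ a b Uu cu; rewrite /pderiv uE.
have [S E] := chart_pullback ac BU fS.
exists (f \o coord c) => // q a Bq; have [cq Bq'] := Bq.
by rewrite E // fE //= coordK.
Qed.

(** The inverse function theorem in the coordinates of [c] makes [F] a chart near [p]. Maximality of
    the atlas then only asks for compatibility with every chart, which comes from smoothness of [F]
    and of its local inverse [Fi]. *)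
Lemma chart_of_functions c p U (F : M -> 'rV[R]_m) : atlas c -> open U ->
  dom c p -> U p -> (forall k, smooth_in c U (fun q => F q 0 k)) ->
  \matrix_(k, a) pderiv c a (fun q => F q 0 k) p \in unitmx ->
  exists e, [/\ atlas e, dom e p, dom e `<=` dom c `&` U & coord e = F].
Proof.
move=> ac oU cp Up FS uF.
have [||||W [Fi [oW Wp WD oFW [FiK FiS]]]] := @local_inverse _ _ (F \o coordV c)
  (chart_image c U) (coord c p).
- exact: chart_image_open.
- exact: chart_image_coord.
- exact: FS.
- exact: uF.
pose V := [set q | [/\ dom c q, U q & W (coord c q)]].
have oV : open V.
  rewrite openE => q [cq Uq Wq].
  have h1 : \forall q' \near q, dom c q' by exact: near_in_open (dom_open ac) cq _.
  have h2 : \forall q' \near q, U q' by exact: near_in_open oU Uq _.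
  have h3 : \forall q' \near q, W (coord c q').
    by apply: (coord_continuous_dom ac cq); exact: open_nbhs_nbhs.
  by near=> q'; split; near: q'.
have WV u : W u -> V (coordV c u) /\ coord c (coordV c u) = u.
  by move=> Wu; have [cu Uu uE] := chart_imageP ac (WD u Wu); rewrite /V /= uE.
have imE : F @` V = (F \o coordV c) @` W.
  apply/seteqP; split=> [_ [q [cq Uq Wq] <-]|_ [u Wu <-]].
    by exists (coord c q) => //=; rewrite coordK.
  by have [Vu _] := WV u Wu; exists (coordV c u).
have FiF q : V q -> Fi (F q) = coord c q.
  by move=> [cq Uq Wq]; have := FiK _ Wq; rewrite /= coordK.
have FiKV q : V q -> coordV c (Fi (F q)) = q.
  by move=> Vq; rewrite FiF // coordK //; case: Vq.
have FVU : V `<=` U by move=> q [].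
have FVc : V `<=` dom c by move=> q [].
pose e : chart := Chart V F (coordV c \o Fi).
have oimE (U' : set M) : open U' -> open (F @` (V `&` U')).
  move=> oU'; have oWU := chart_image_open ac oU'.
  have -> : F @` (V `&` U') = F @` V `&` Fi @^-1` (chart_image c U').
    apply/seteqP; split=> [_ [q [Vq U'q] <-]|y [[q Vq <-]]].
      split; first by exists q.
      by rewrite /= FiF //; apply: chart_image_coord => //; exact: FVc.
    move=> /(chart_imageP ac)[_]; rewrite FiKV // => U'q _.
    by exists q.
  rewrite openE => y [FVy Fiy]; apply: filterI.
    by apply: open_nbhs_nbhs; split=> //; rewrite imE.
  have Fic : {for y, continuous Fi}.
    apply: row_continuous => b; apply: (class_C_cont (FiS b 0)).
    by rewrite -imE.
  by apply: Fic; apply: open_nbhs_nbhs.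
have Fic y : (F @` V) y -> {for y, continuous Fi}.
  by rewrite imE => FVy; apply: row_continuous => b; exact: class_C_cont (FiS b 0) FVy.
exists e; split; [|by split|by move=> q []|by []].
apply: atlas_maximal => [|c' ac'].
  split=> /=.
  - exact: oV.
  - by rewrite imE.
  - exact: FiKV.
  - move=> q Vq; apply: row_continuous => b.
    exact: (smooth_in_continuous ac oU (FS b) (FVc q Vq) (FVU q Vq)).
  - move=> y [q Vq <-]; apply: (continuous_comp (f := Fi) (g := coordV c)).
      by apply: Fic; exists q.
    have [cq Uq Wq] := Vq; rewrite FiF //.
    by apply: (@coordV_continuous _ _ _ c U) => //; exact: chart_image_coord.
split=> k.
  move=> j; rewrite /smooth_in /=.
  apply: (@class_C_comp _ _ _ j (F @` (V `&` dom c')) (chart_image c (dom c')) Fi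
    (fun u => coord c' (coordV c u) 0 k)).
  - by apply: oimE; exact: dom_open.
  - by apply: chart_image_open => //; exact: dom_open.
  - move=> _ [q [Vq c'q] <-]; have [cq Uq Wq] := Vq.
    by rewrite FiF //; exact: chart_image_coord.
  - move=> b; apply: class_C_sub (FiS b j); rewrite -imE.
    by move=> _ [q [Vq _] <-]; exists q.
  - exact: transition_smooth.
have FSV : smooth_in c V (fun q => F q 0 k) by exact: smooth_in_sub (FS k).
exact: (smooth_in_on ac oV FVc FSV).
Unshelve. all: end_near.
Qed.

End ChartConstructions.

(** * Hermitian linear algebra at a point *)

Section AdaptedBasis.
Variables (R : realType) (n : nat) (g J : 'M[R]_(n + n)).
Hypotheses (g_sym : g^T = g) (g_unit : g \in unitmx).
Hypotheses (J2 : J *m J = - 1%:M) (gJ : J^T *m g *m J = g).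

Local Notation N := (n + n)%N.

Lemma kahler_form_antisym : (g *m J)^T = - (g *m J).
Proof.
rewrite trmx_mul g_sym -[in RHS]gJ -mulmxA J2 mulmxN mulmx1 opprK.
by [].
Qed.

Lemma antisym_isotropic (v : 'rV[R]_N) : v *m (g *m J) *m v^T = 0.
Proof.
set a := v *m (g *m J) *m v^T.
have aT : a^T = - a.
  by rewrite /a trmx_mul trmxK [(v *m _)^T]trmx_mul kahler_form_antisym mulNmx mulmxN mulmxA.
apply/matrixP => i j; rewrite !ord1 mxE.
have := congr1 (fun A : 'M[R]_1 => A 0 0) aT; rewrite !mxE => E.
by move: E; move: (a 0 0) => x; lra.
Qed.

Lemma form_tr p q (A : 'M[R]_(p, N)) (B : 'M[R]_(q, N)) :
  (A *m g *m B^T)^T = B *m g *m A^T.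
Proof. by rewrite !trmx_mul trmxK g_sym mulmxA. Qed.

(** Invertibility of the Gram matrix also makes the rows of [E] independent. For [k = n] their span
    is a Lagrangian subspace; for smaller [k] it is merely isotropic for Phi. *)
Definition lagrangian k (E : 'M[R]_(k, N)) :=
  E *m (g *m J) *m E^T = 0 /\ E *m g *m E^T \in unitmx.

(** The Gram matrix of [E] and [J E] together is block diagonal with two copies of [H], so g is
    nondegenerate on their span and on its orthogonal complement [W]. As 2k < 2n, [W] is nonzero and
    contains a vector that is not null. *)
Lemma lagrangian_step k (E : 'M[R]_(k, N)) : (k < n)%N -> lagrangian E ->
  exists E' : 'M[R]_(1 + k, N), lagrangian E'.
Proof.
move=> kn [E0 Eu]; pose H := E *m g *m E^T; pose K := col_mx E (E *m J^T).
pose W := kermx (g *m K^T).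
have EJJ : E *m J^T *m g *m (E *m J^T)^T = H.
  by rewrite trmx_mul trmxK /H -[in RHS]gJ !mulmxA.
have EEJ : E *m g *m (E *m J^T)^T = 0.
  by rewrite trmx_mul trmxK; rewrite !mulmxA in E0 *.
have EJE : E *m J^T *m g *m E^T = 0 by rewrite -form_tr EEJ trmx0.
have KK : K *m (g *m K^T) \in unitmx.
  rewrite mulmxA /K mul_col_mx tr_col_mx mul_col_row EEJ EJE EJJ.
  by rewrite unitmxE det_ublock unitrM -!unitmxE Eu.
have W0 : W != 0.
  rewrite -mxrank_eq0 mxrank_ker -lt0n subn_gt0.
  apply: leq_ltn_trans (rank_leq_col _) _.
  by rewrite -addSn; apply: leq_add => //; exact: ltnW.
(* If all vectors of [W] were null, polarization would make [W] orthogonal to itself; being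
   orthogonal to [K] as well, it would lie in the radical of g. *)
have [v vW vv] : exists2 v : 'rV[R]_N, (v <= W)%MS & v *m g *m v^T != 0.
  apply: contrapT => noV.
  have iso (v : 'rV[R]_N) : (v <= W)%MS -> v *m g *m v^T = 0.
    by move=> vW; apply: contrapT => /eqP vv; apply: noV; exists v.
  have iso2 (v w : 'rV[R]_N) : (v <= W)%MS -> (w <= W)%MS -> v *m g *m w^T = 0.
    move=> vW wW; have := iso _ (addmx_sub vW wW).
    rewrite linearD /= mulmxDl mulmxDl !mulmxDr !iso // addr0 add0r => E1.
    have E2 : w *m g *m v^T = v *m g *m w^T.
      rewrite -form_tr.
      by apply/matrixP => i j; rewrite !ord1 mxE.
    apply/matrixP => i j; have := congr1 (fun A : 'M[R]_1 => A i j) E1.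
    rewrite E2 !mxE; move: (\sum_k _) => x; lra.
  have WW : W *m g *m W^T = 0.
    apply/matrixP => i j; rewrite [RHS]mxE.
    have := iso2 (row i W) (row j W) (row_sub i W) (row_sub j W).
    move=> /(congr1 (fun A : 'M[R]_1 => A 0 0)); rewrite [RHS]mxE => <-.
    by rewrite -row_mul [LHS]mxE [RHS]mxE; apply: eq_bigr => l _; rewrite !mxE.
  have WK : W *m g *m K^T = 0 by rewrite -mulmxA mulmx_ker.
  (* [A *m K], acting on rows from the right, is the g-orthogonal projection onto the span of
     [K]. *)
  pose A := g *m K^T *m invmx (K *m (g *m K^T)).
  have /submxP[Y YE] : (1%:M - A *m K <= W)%MS.
    apply/sub_kermxP; rewrite mulmxBl mul1mx -[A *m K *m _]mulmxA mulmxKV //.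
    by rewrite subrr.
  have Wg : W *m g = 0.
    rewrite -[LHS]mulmx1 -[1%:M]trmx1 -[1%:M](subrK (A *m K)) YE linearD /=.
    rewrite [(Y *m W)^T]trmx_mul [(A *m K)^T]trmx_mul mulmxDr.
    by rewrite (mulmxA _ W^T) (mulmxA _ K^T) WW WK !mul0mx addr0.
  by move/eqP: W0; apply; rewrite -[W](mulmxK g_unit) Wg mul0mx.
pose E' : 'M[R]_(1 + k, N) := col_mx v E.
exists E'.
have vK : v *m (g *m K^T) = 0 by apply/sub_kermxP.
rewrite mulmxA /K tr_col_mx mul_mx_row in vK.
have [vE vJ] : v *m g *m E^T = 0 /\ v *m g *m (E *m J^T)^T = 0.
  by apply: eq_row_mx; rewrite vK row_mx0.
have Ev : E *m g *m v^T = 0.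
  by rewrite -form_tr vE trmx0.
have vJE : v *m (g *m J) *m E^T = 0.
  by rewrite trmx_mul trmxK !mulmxA in vJ *.
have vEJ : E *m (g *m J) *m v^T = 0.
  rewrite -[LHS]trmxK [(_ *m v^T)^T]trmx_mul trmxK [(E *m _)^T]trmx_mul.
  by rewrite kahler_form_antisym mulNmx mulmxN mulmxA vJE oppr0 trmx0.
split.
  by rewrite /E' mul_col_mx tr_col_mx mul_col_row antisym_isotropic E0 vJE vEJ block_mx0.
rewrite /E' mul_col_mx tr_col_mx mul_col_row vE Ev unitmxE det_ublock unitrM.
rewrite -!unitmxE Eu andbT unitmxE det_mx11 unitfE.
by apply: contraNneq vv => vv0; apply/eqP/matrixP => i j; rewrite !ord1 vv0 mxE.
Qed.

Lemma ex_lagrangian k : (k <= n)%N -> exists E : 'M[R]_(k, N), lagrangian E.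
Proof.
elim: k => [|k IH] kn.
  by exists 0; split; rewrite ?mul0mx // unitmxE det_mx00 unitr1.
by have [E /(lagrangian_step kn)] := IH (ltnW kn).
Qed.

(** The matrix of the sum of the dx^j /\ dy_j; the entries 1/2 come from the normalization of the
    wedge product. *)
Definition darboux_mx : 'M[R]_N :=
  block_mx 0 (2^-1)%:M (- (2^-1)%:M) 0.

(** The rows of [E] serve as the vectors d/dx^j, and [J E], corrected by the inverse Gram matrix, as
    the d/dy_j. Since [J] exchanges the two halves of this frame, the x-components of the vectors
    J(d/dy_k) form an invertible block, which is the independence of dx^j and dx^j o J. *)
Lemma ex_adapted_coframe : exists P : 'M[R]_N,
  [/\ P \in unitmx, P^T *m darboux_mx *m P = g *m J &
      exists J' : 'M[R]_N, P *m J = J' *m P /\ ursubmx J' \in unitmx].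
Proof.
have [E [E0 Hu]] := ex_lagrangian (leqnn n).
(* The factors [invmx H] and -1/2 are forced by the requirement that Phi pair [E] with [F] to one
   half of the identity. *)
pose H := E *m g *m E^T; pose F := - 2^-1 *: (invmx H *m E *m J^T).
have HT : H^T = H by rewrite /H form_tr.
have Hi : (invmx H)^T = invmx H by rewrite trmx_inv HT.
pose Q := col_mx E F.
have FT : F^T = - 2^-1 *: (J *m E^T *m invmx H).
  by rewrite linearZ /= !trmx_mul trmxK Hi mulmxA.
have EF : E *m (g *m J) *m F^T = (2^-1)%:M.
  rewrite FT -scalemxAr; have -> : E *m (g *m J) *m (J *m E^T *m invmx H) =
      E *m g *m (J *m J) *m E^T *m invmx H by rewrite !mulmxA.
  by rewrite J2 mulmxN mulmx1 !mulNmx mulmxV // scalerN scaleNr opprK scalemx1.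
have FE : F *m (g *m J) *m E^T = - (2^-1)%:M.
  rewrite -[LHS]trmxK [(_ *m E^T)^T]trmx_mul trmxK [(F *m _)^T]trmx_mul.
  by rewrite kahler_form_antisym mulNmx mulmxN mulmxA EF linearN /= tr_scalar_mx.
have FF : F *m (g *m J) *m F^T = 0.
  rewrite FT /F -scalemxAr -!scalemxAl.
  have -> : invmx H *m E *m J^T *m (g *m J) *m (J *m E^T *m invmx H) =
      invmx H *m (E *m (J^T *m g *m J *m J) *m E^T) *m invmx H by rewrite !mulmxA.
  by rewrite gJ E0 mulmx0 mul0mx !scaler0.
have QQ : Q *m (g *m J) *m Q^T = darboux_mx.
  by rewrite /Q mul_col_mx tr_col_mx mul_col_row E0 EF FE FF.
have gJu : g *m J \in unitmx.
  have : J *m (- J) = 1%:M by rewrite mulmxN J2 opprK.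
  by move=> /mulmx1_unit[Ju _]; rewrite unitmx_mul g_unit.
have Du : darboux_mx \in unitmx.
  have : darboux_mx *m (block_mx 0 (- 2%:M) (2%:M) 0) = 1%:M.
    rewrite mulmx_block !mul0mx !mulmx0 !addr0 !add0r.
    by rewrite mulNmx mulmxN opprK -scalar_mxM mulVf ?pnatr_eq0 // -scalar_mx_block.
  by move=> /mulmx1_unit[].
have Qu : Q \in unitmx.
  by move: Du; rewrite -QQ !unitmx_mul => /andP[/andP[]].
have QTu : Q^T \in unitmx by rewrite unitmx_tr.
(* The coframe dual to the frame formed by the rows of [Q]. *)
exists (invmx Q^T); split; first by rewrite unitmx_inv.
  by rewrite trmx_inv trmxK -QQ !mulmxA mulVmx // mul1mx -!mulmxA mulmxV // mulmx1.
(* The matrix of [J] in the frame [Q], as computed below in [EJ] and [FJ]. *)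
pose J' : 'M[R]_N := block_mx 0 (2^-1 *: invmx H) (- 2 *: H) 0.
exists J'; split; last first.
  by rewrite block_mxKur unitmxZ ?unitmx_inv // unitfE invr_eq0 pnatr_eq0.
have EJ : E *m J^T = - 2 *: (H *m F).
  rewrite /F -scalemxAr scalerA mulrNN mulfV ?pnatr_eq0 // scale1r.
  by rewrite !mulmxA mulmxV // mul1mx.
have FJ : F *m J^T = 2^-1 *: (invmx H *m E).
  rewrite /F -scalemxAl -!mulmxA -trmx_mul J2 linearN /= trmx1 !mulmxN mulmx1.
  by rewrite scalerN scaleNr opprK.
have J'T : J'^T = block_mx 0 (- 2 *: H) (2^-1 *: invmx H) 0.
  by rewrite tr_block_mx !trmx0 !linearZ /= HT Hi.
have QJ : J *m Q^T = Q^T *m J'.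
  rewrite -[LHS]trmxK trmx_mul trmxK mul_col_mx EJ FJ.
  rewrite -[RHS]trmxK [in RHS]trmx_mul trmxK J'T mul_block_col.
  by rewrite !mul0mx add0r addr0 -!scalemxAl.
rewrite -[LHS]mulmx1 -(mulmxV QTu) -[LHS]mulmxA (mulmxA J) QJ.
by rewrite !mulmxA mulVmx // mul1mx.
Qed.

End AdaptedBasis.

(** * Locally finite covers *)

Section LocallyFiniteCover.
Variable T : topologicalType.

Lemma lindelof (p0 : T) (V : T -> set T) : @second_countable T ->
  (forall p, open_nbhs p (V p)) -> exists pts : nat -> T,
    forall q, exists k, V (pts k) q.
Proof.
move=> [B /countable_injP[phi phi_inj] [Bo Bnbhs]] Vo.
pose b k := get (fun U => B U /\ phi U = k).
(* For the basic open set of number [k], pick a point whose [V] contains it; [p0] stands in when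
   there is none. *)
exists (fun k => xget p0 [set p | b k `<=` V p]) => q.
have [U [BU Uq] UV] := Bnbhs q (V q) (open_nbhs_nbhs (Vo q)).
have bU : b (phi U) = U.
  have [Bb phib] : B (b (phi U)) /\ phi (b (phi U)) = phi U.
    have ex : exists U', B U' /\ phi U' = phi U by exists U.
    exact: (getPex ex).
  by apply: phi_inj; rewrite ?inE.
exists (phi U); rewrite bU.
have : [set p | U `<=` V p] (xget p0 [set p | U `<=` V p]) by apply: xgetPex; exists q.
by move=> /(_ _ Uq).
Qed.

(* With V p in C p in U p and C p closed, U_k minus the union of the earlier C_j is
   a locally finite refinement: V_k misses all its members of index above k. *)
Lemma locally_finite_refinement (p0 : T) (U V C : T -> set T) :
  @second_countable T -> (forall p, open (U p)) -> (forall p, open_nbhs p (V p)) ->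
  (forall p, closed (C p)) -> (forall p, V p `<=` C p) -> (forall p, C p `<=` U p) ->
  exists (pts : nat -> T) (W : nat -> set T),
    (forall k, W k `<=` U (pts k)) /\ locally_finite_cover W.
Proof.
move=> sc oU Vo cC VC CU; have [pts Hpts] := lindelof p0 sc Vo.
pose W k := U (pts k) `&` \bigcap_(j in `I_k) ~` C (pts j).
have WE k q : W k q <-> U (pts k) q /\ forall j, (j < k)%N -> ~ C (pts j) q.
  by split=> -[Uq Cq]; split.
exists pts, W; split=> [k q /WE[]//|].
split.
- move=> k; apply: openI => //; rewrite bigcap_mkord; apply: big_ind.
  + exact: openT.
  + by move=> A A' oA oA'; exact: openI.
  + by move=> j _; exact: closed_openC.
- apply/seteqP; split=> // q _.
  have [k0 /VC/CU Uq] := Hpts q.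
  have ex : exists k, `[< U (pts k) q >] by exists k0; apply/asboolP.
  exists (ex_minn ex) => //; apply/WE; case: ex_minnP => k /asboolP Uk kmin.
  split=> // j jk /CU Uj; have := kmin j; rewrite leqNgt jk.
  by move=> H; have := H (asboolT Uj).
- move=> q; have [k Vq] := Hpts q.
  exists (V (pts k)); first by split=> //; have [] := Vo (pts k).
  apply: (@sub_finite_set _ _ `I_k.+1); last exact: finite_II.
  move=> j [q' [/WE[_ Cj] Vq']] /=; rewrite ltnNge; apply/negP => kj.
  exact: (Cj k kj (VC _ _ Vq')).
Qed.

End LocallyFiniteCover.

Section ManifoldRegular.
Variables (R : realType) (m : nat) (M : smooth_manifold R m).

(** The preimage of a closed coordinate ball is compact, hence closed because the manifold is
    Hausdorff. *)
Lemma manifold_regular (p : M) (U : set M) : open U -> U p ->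
  exists V C, [/\ open_nbhs p V, closed C, V `<=` C & C `<=` U].
Proof.
move=> oU Up; have [c ac cp] := atlas_cover p.
have [r r0 rU] := ex_chart_ball ac cp oU Up.
have r20 : 0 < r / 2 by rewrite divr_gt0.
have Kr : closed_ball (coord c p) (r / 2) `<=` ball (coord c p) r.
  move=> u; rewrite closed_ballE // /closed_ball_ /= -ball_normE /=.
  by move: r0; lra.
exists (chart_ball c p (r / 2)), (coordV c @` closed_ball (coord c p) (r / 2)); split.
- by split; [exact: chart_ball_open|exact: chart_ball_center].
- apply: compact_closed; first exact: manifold_hausdorff.
  apply: continuous_compact; last exact: closed_ball_row_compact.
  apply: continuous_in_subspaceT => u; rewrite inE => /Kr/rU.
  exact: coordV_continuous.
- move=> q [cq Bq]; exists (coord c q); last exact: coordK.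
  exact: subset_closed_ball.
by move=> _ [u /Kr/rU/(chart_imageP ac)[_ + _] <-].
Qed.

End ManifoldRegular.

(** * Flat, Darboux and special coordinates *)

Section FlatCoordinates.
Variables (R : realType) (m : nat) (M : smooth_manifold R m).
Local Notation chart := (chart R m M).
Variable nabla : connection M.
Implicit Types (c e : chart) (p q : M).

Lemma parallel_covectors c p : flat nabla -> atlas c -> dom c p ->
  exists r, [/\ 0 < r, ball (coord c p) r `<=` chart_image c (dom c) &
    forall t0 : 'I_m -> R, exists th : 'I_m -> M -> R,
      [/\ forall l, smooth_in c (chart_ball c p r) (th l),
          forall l, th l p = t0 l &
          forall q a l, chart_ball c p r q ->
            pderiv c a (th l) q = \sum_d th d q * nabla c q d a l]].
Proof.
move=> nflat ac cp.
pose G a u := \matrix_(d, l) nabla c (coordV c u) d a l.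
have GE a d l : (fun u => G a u d l) = (fun q => nabla c q d a l) \o coordV c.
  by apply/funext => u; rewrite mxE.
have [||a d l k|u a b e l Du|r [r0 BD ex]] := @frobenius R m m
  (chart_image c (dom c)) (coord c p) G.
- exact: chart_image_open ac (dom_open ac).
- exact: chart_image_coord.
- by rewrite GE; exact: (christoffel_smooth nabla ac d a l k).
- have [cu _ uE] := chart_imageP ac Du.
  have := nflat c ac _ cu e l a b; rewrite /curvature /pderiv uE -!GE => E; rewrite -[RHS]E.
  by congr (_ + _); apply: eq_bigr => d _; rewrite !mxE.
exists r; split=> // t0; have [th [thS thp thE]] := ex t0.
exists (fun l => th l \o coord c); split=> [l|l|q a l Bq].
- by have [] := chart_pullback ac BD (thS l).
- exact: thp.
have [_ ->] // := chart_pullback ac BD (thS l).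
have [cq Bq'] := Bq; rewrite thE //; apply: eq_bigr => d _.
by rewrite mxE coordK.
Qed.

(** The freedom in [P] allows the coordinate coframe at [p] to be prescribed, so that it can later
    be chosen symplectic and adapted to [J]. *)
Lemma flat_chart c p (U : set M) (P : 'M[R]_m) : flat nabla -> torsion_free nabla ->
  atlas c -> dom c p -> open U -> U p -> P \in unitmx ->
  exists e, [/\ atlas e, dom e p, dom e `<=` dom c `&` U, jacobian c e p = P &
    forall q, dom e q -> forall k a b, nabla e q k a b = 0].
Proof.
move=> nflat ntf ac cp oU Up uP.
have [r [r0 BD ex]] := parallel_covectors nflat ac cp.
pose V := chart_ball c p r.
have oV : open V by exact: chart_ball_open.
have Vp : V p by exact: chart_ball_center.
have Vc : V `<=` dom c by move=> q [].
have [th thP] := choice (fun k => ex (P k)).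
have thS k l : smooth_in c V (th k l) by have [] := thP k.
have th_p k l : th k l p = P k l by have [] := thP k.
have thE k q a l : V q -> pderiv c a (th k l) q = \sum_d th k d q * nabla c q d a l.
  by have [_ _ +] := thP k; exact.
have [s s0 BV] := ex_chart_ball ac cp oV Vp.
have exx k : exists f, smooth_in c (chart_ball c p s) f /\
    forall q a, chart_ball c p s q -> pderiv c a f q = th k a q.
  have [//|q a b Vq cq|f fS fE] := @chart_poincare _ _ _ c p V s (th k) ac BV.
    rewrite !thE //; apply: eq_bigr => d _.
    by rewrite (ntf c ac q cq).
  by exists f.
have [x xP] := choice exx.
pose F q := \row_k x k q.
pose V' := chart_ball c p s `&` U.
have oV' : open V' by apply: openI => //; exact: chart_ball_open.
have V'p : V' p by split=> //; exact: chart_ball_center.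
have sV : chart_ball c p s `<=` V by exact: chart_ball_sub.
have FE k : (fun q => F q 0 k) = x k by apply/funext => q; rewrite mxE.
have xS k : smooth_in c V' (x k).
  by apply: smooth_in_sub (xP k).1 => q [].
have [k||e [ae ep eU eF]] := @chart_of_functions _ _ _ c p V' F ac oV' cp V'p.
- by rewrite FE.
- suff -> : \matrix_(k, a) pderiv c a (fun q => F q 0 k) p = P by [].
  apply/matrixP => k a; rewrite mxE FE (xP k).2 ?th_p //.
  exact: chart_ball_center.
have eV q : dom e q -> V' q /\ dom c q by move=> /eU[].
have jE q k a : dom e q -> jacobian c e q k a = th k a q.
  move=> eq; have [[Bq _] cq] := eV q eq.
  by rewrite mxE eF FE (xP k).2.
exists e; split=> //.
- by move=> q /eV[[_ Uq] cq].
- by apply/matrixP => k a; rewrite jE.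
move=> q eq k a b; have [[Bq _] cq] := eV q eq.
pose A := \matrix_(d, d') nabla e q k d d'.
(* The rows of the Jacobian are the parallel covectors [th], so in the transformation law the
   derivative of the Jacobian already accounts for the symbols of [c]. The term with the symbols of
   [e] must vanish. *)
have A0 : (jacobian c e q)^T *m A *m jacobian c e q = 0.
  apply/matrixP => a' b'; have := christoffel_change nabla ac ae cq eq k a' b'.
  have -> : pderiv c a' (fun q' => jacobian c e q' k b') q = pderiv c a' (th k b') q.
    apply: (eq_pderiv a' ac (dom_open ae) cq eq) => q' _ eq'; exact: jE.
  rewrite thE; last exact: sV.
  under eq_bigr do rewrite jE //.
  rewrite -[LHS]add0r => /addIr E; rewrite [RHS]mxE [RHS]E !mxE exchange_big /=.
  apply: eq_bigr => d' _; rewrite !mxE mulr_suml; apply: eq_bigr => d _.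
  by rewrite !mxE; ring.
have uj := jacobian_unit ac ae cq eq.
have : A = 0.
  have := congr1 (fun B => invmx (jacobian c e q)^T *m B *m invmx (jacobian c e q)) A0.
  rewrite mulmx0 mul0mx -!mulmxA mulmxV // mulmx1 mulKmx //.
  by rewrite unitmx_tr.
by move=> /matrixP /(_ a b); rewrite !mxE.
Qed.

End FlatCoordinates.

Section RestrictedCharts.
Variables (R : realType) (m : nat) (M : smooth_manifold R m).
Local Notation chart := (chart R m M).
Implicit Types (c e : chart) (U : set M) (p q : M).

Lemma jacobian_restrict c U p : atlas c -> dom c p ->
  jacobian c (restrict_chart c U) p = 1%:M.
Proof.
by move=> ac cp; apply/matrixP => k a; rewrite !mxE pderiv_coord // eq_sym.
Qed.

(** A tensor assigns components to each chart separately, so even shrinking the domain requires the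
    transformation law, here with identity Jacobian. *)
Lemma tensor02_restrict (t : tensor02 M) c U p : atlas c -> open U -> dom c p ->
  U p -> t (restrict_chart c U) p = t c p.
Proof.
move=> ac oU cp Up.
have := comp02_change t ac (restrict_chart_atlas ac oU) cp (conj cp Up).
by rewrite jacobian_restrict // trmx1 mul1mx mulmx1.
Qed.

Lemma tensor11_restrict (t : tensor11 M) c U p : atlas c -> open U -> dom c p ->
  U p -> t (restrict_chart c U) p = t c p.
Proof.
move=> ac oU cp Up.
have := comp11_change t ac (restrict_chart_atlas ac oU) cp (conj cp Up).
by rewrite jacobian_restrict // mul1mx mulmx1.
Qed.

Lemma christoffel_restrict (nabla : connection M) c U p : atlas c -> open U ->
  dom c p -> U p -> forall k a b, nabla (restrict_chart c U) p k a b = nabla c p k a b.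
Proof.
move=> ac oU cp Up k a b.
have := christoffel_change nabla ac (restrict_chart_atlas ac oU) cp (conj cp Up) k a b.
have -> : pderiv c a (fun q => jacobian c (restrict_chart c U) q k b) p = 0.
  rewrite -(pderiv_cst c a ((k == b)%:R) p).
  apply: (eq_pderiv a ac (dom_open ac) cp cp) => q cq _.
  by rewrite jacobian_restrict // mxE.
rewrite jacobian_restrict // addr0.
have -> : \sum_l (1%:M : 'M[R]_m) k l * nabla c p l a b = nabla c p k a b.
  rewrite (bigD1 k) //= mxE eqxx mul1r big1 ?addr0 // => l lk.
  by rewrite mxE eq_sym (negbTE lk) mul0r.
move=> ->; rewrite (bigD1 a) //= [X in _ + X]big1 ?addr0; last first.
  move=> d da; apply: big1 => l _.
  by rewrite [1%:M d a]mxE (negbTE da) mulr0 mul0r.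
rewrite (bigD1 b) //= !mxE !eqxx !mulr1 big1 ?addr0 // => l lb.
by rewrite [1%:M l b]mxE (negbTE lb) mulr0.
Qed.

End RestrictedCharts.

(** * Cauchy-Riemann equations and holomorphic functions *)

Section Holomorphic.
Variables (R : realType) (m : nat) (M : smooth_manifold R m) (J : tensor11 M).
Local Notation chart := (chart R m M).
Implicit Types (c e : chart) (U V : set M) (f : M -> R[i]) (p q : M).

(** The real and imaginary parts of [df o J = i df]. *)
Definition cauchy_riemann c f p :=
  differential c (fun q => complex.Re (f q)) p *m J c p =
    - differential c (fun q => complex.Im (f q)) p /\
  differential c (fun q => complex.Im (f q)) p *m J c p =
    differential c (fun q => complex.Re (f q)) p.

Lemma cauchy_riemannP c f p : cauchy_riemann c f p <->
  differentialC c f p *m map_mx (real_complex R) (J c p) =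
    'i%C *: differentialC c f p.
Proof.
have E a : (differentialC c f p *m map_mx (real_complex R) (J c p)) 0 a =
    (differential c (fun q => complex.Re (f q)) p *m J c p) 0 a +i*
    (differential c (fun q => complex.Im (f q)) p *m J c p) 0 a.
  rewrite !mxE; apply/eqP; rewrite eq_complex /= !raddf_sum /=; apply/andP; split.
    by apply/eqP/eq_bigr => b _; rewrite !mxE /=; ring.
  by apply/eqP/eq_bigr => b _; rewrite !mxE /=; ring.
have E' a : ('i%C *: differentialC c f p) 0 a =
    (- differential c (fun q => complex.Im (f q)) p 0 a) +i*
    differential c (fun q => complex.Re (f q)) p 0 a.
  rewrite !mxE; apply/eqP; rewrite eq_complex /=; apply/andP; split; apply/eqP; ring.
split=> [[H1 H2]|H].
  by apply/rowP => a; rewrite E E' H1 H2 mxE.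
split; apply/rowP => a; have := congr1 (fun A : 'rV_m => A 0 a) H; rewrite E E'.
  by move=> [-> _]; rewrite [RHS]mxE.
by move=> [_ ->].
Qed.

(** Composing the first equation with [J] gives the second, since the square of [J] is -1. *)
Lemma cauchy_riemann_intro c f p : J c p *m J c p = - 1%:M ->
  differential c (fun q => complex.Re (f q)) p *m J c p =
    - differential c (fun q => complex.Im (f q)) p -> cauchy_riemann c f p.
Proof.
move=> J2 H; split=> //; apply: oppr_inj.
by rewrite -mulNmx -H -mulmxA J2 mulmxN mulmx1.
Qed.

Lemma cauchy_riemann_change c c' U f p : atlas c -> atlas c' -> open U ->
  dom c p -> dom c' p -> U p ->
  smooth_in c' U (fun q => complex.Re (f q)) ->
  smooth_in c' U (fun q => complex.Im (f q)) ->
  cauchy_riemann c' f p -> cauchy_riemann c f p.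
Proof.
move=> ac ac' oU cp c'p Up rS iS [H1 H2].
have JE := comp11_change J ac ac' cp c'p.
split; rewrite !(differential_change ac ac' oU cp c'p Up) // -mulmxA JE mulmxA.
  by rewrite H1 mulNmx.
by rewrite H2.
Qed.

Lemma holomorphic_intro c U f : atlas c -> open U -> U `<=` dom c ->
  smooth_in c U (fun q => complex.Re (f q)) ->
  smooth_in c U (fun q => complex.Im (f q)) ->
  (forall p, U p -> cauchy_riemann c f p) -> holomorphic J U f.
Proof.
move=> ac oU Uc rS iS CR; split.
- exact: smooth_in_on ac oU Uc rS.
- exact: smooth_in_on ac oU Uc iS.
move=> c' ac' p Up c'p; apply/cauchy_riemannP.
exact: (cauchy_riemann_change ac' ac oU c'p (Uc p Up) Up rS iS (CR p Up)).
Qed.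

Lemma holomorphic_sub U V f : U `<=` V -> holomorphic J V f -> holomorphic J U f.
Proof.
move=> UV [rS iS CR]; split=> [c ac|c ac|c ac p Up].
- exact: smooth_in_sub UV (rS c ac).
- exact: smooth_in_sub UV (iS c ac).
exact: CR (UV p Up).
Qed.

Lemma holomorphic_cauchy_riemann U f c p : holomorphic J U f -> atlas c ->
  U p -> dom c p -> cauchy_riemann c f p.
Proof. by move=> [_ _ CR] ac Up cp; apply/cauchy_riemannP; exact: CR. Qed.

End Holomorphic.

(** * Existence of special coordinates and of the cover *)

Section SpecialCoordinates.
Variables (R : realType) (n : nat) (M : smooth_manifold R (n + n)).
Local Notation chart := (chart R (n + n) M).
Variables (g : tensor02 M) (J : tensor11 M) (nabla : connection M).
Implicit Types (c e : chart) (U V : set M) (p q : M).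

Lemma kahler_form_smooth c a b : atlas c ->
  smooth_in c (dom c) (fun q => kahler_form g J c q a b).
Proof.
move=> ac; apply: (@smooth_in_ext _ _ _ _ _ (fun q => \sum_k g c q a k * J c q k b)) => //.
- exact: dom_open.
- by move=> q _ _; rewrite /kahler_form mxE.
apply: smooth_in_sum => // [|k]; first exact: dom_open.
apply: smooth_inM => //; [exact: dom_open|exact: comp02_smooth|exact: comp11_smooth].
Qed.

Lemma kahler_form_change c c' p : atlas c -> atlas c' -> dom c p -> dom c' p ->
  kahler_form g J c p = (jacobian c c' p)^T *m kahler_form g J c' p *m jacobian c c' p.
Proof.
move=> ac ac' cp c'p; rewrite /kahler_form (comp02_change g ac ac' cp c'p).
by rewrite -mulmxA (comp11_change J ac ac' cp c'p) !mulmxA.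
Qed.

Lemma differential_coord c k p : atlas c -> dom c p ->
  differential c (fun q => coord c q 0 k) p = delta_mx 0 k.
Proof.
by move=> ac cp; apply/rowP => a; rewrite !mxE pderiv_coord // eqxx.
Qed.

Lemma sum_wedge_coord c p : atlas c -> dom c p ->
  \sum_j wedge (differential c (xcoord c j) p) (differential c (ycoord c j) p) =
  darboux_mx R n.
Proof.
move=> ac cp; under eq_bigr do rewrite !differential_coord // /wedge.
apply/matrixP => a b; rewrite summxE /darboux_mx.
have E (j : 'I_n) : (2^-1 *: ((delta_mx 0 (lshift n j) : 'rV[R]_(n + n))^T *m delta_mx 0 (rshift n j) -
    (delta_mx 0 (rshift n j))^T *m delta_mx 0 (lshift n j))) a b =
    2^-1 * (((a == lshift n j) && (b == rshift n j))%:R -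
            ((a == rshift n j) && (b == lshift n j))%:R).
  by rewrite !trmx_delta !mul_delta_mx !mxE.
under eq_bigr do rewrite E.
have D (i j : 'I_n) : \sum_k (((i == k) && (j == k))%:R : R) = (i == j)%:R.
  rewrite (bigD1 i) //= eqxx /= big1 ?addr0 1?eq_sym // => k ki.
  by rewrite eq_sym (negbTE ki).
rewrite -mulr_sumr sumrB.
case: (split_ordP a) => a' ->; case: (split_ordP b) => b' ->;
  rewrite ?block_mxEul ?block_mxEur ?block_mxEdl ?block_mxEdr ?mxE;
  under eq_bigr do rewrite !eq_shift /= ?andbF;
  under [X in _ - X]eq_bigr do rewrite !eq_shift /= ?andbF.
- by rewrite subrr mulr0.
- by rewrite D big1 // subr0 mulr_natr.
- by rewrite D big1 // sub0r mulrN mulr_natr.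
- by rewrite subrr mulr0.
Qed.

Lemma flat_darboux_restrict c U : flat_darboux g J nabla c -> open U ->
  flat_darboux g J nabla (restrict_chart c U).
Proof.
move=> [ac kf n0] oU; split; first exact: restrict_chart_atlas.
  move=> p [cp Up].
  have -> : kahler_form g J (restrict_chart c U) p = kahler_form g J c p.
    by rewrite /kahler_form tensor02_restrict // tensor11_restrict.
  by rewrite kf.
by move=> p [cp Up] k a b; rewrite christoffel_restrict // n0.
Qed.

Hypothesis special : rigid_special_kahler g J nabla.

Let pk := special_pseudo_kahler special.

Lemma flat_darboux_at p U : open U -> U p ->
  exists e, [/\ flat_darboux g J nabla e, dom e p, dom e `<=` U &
    ursubmx (J e p) \in unitmx].
Proof.
move=> oU Up; have [c ac cp] := atlas_cover p.
have [P [uP PE [J' [PJ J'u]]]] := ex_adapted_coframe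
  (metric_symmetric pk ac cp) (metric_nondegenerate pk ac cp)
  (complex_structure pk ac cp) (metric_hermitian pk ac cp).
have [e [ae ep eU jE n0]] := flat_chart (special_flat special)
  (special_torsion_free special) ac cp oU Up uP.
(* The domain of [e] need not be connected; on a coordinate ball vanishing partial derivatives do
   make Phi constant. *)
have [r r0 BD] := ex_chart_ball ae ep (dom_open ae) ep.
pose V := chart_ball e p r; have oV : open V by exact: chart_ball_open.
have Vp : V p by exact: chart_ball_center.
exists (restrict_chart e V); split.
- split; first exact: restrict_chart_atlas.
    move=> q [eq Vq].
    have -> : kahler_form g J (restrict_chart e V) q = kahler_form g J e q.
      by rewrite /kahler_form tensor02_restrict // tensor11_restrict.
    rewrite [RHS](sum_wedge_coord ae eq).
    have -> : darboux_mx R n = kahler_form g J e p.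
      have := kahler_form_change ac ae cp ep.
      rewrite jE /kahler_form -PE => E.
      have uPT : P^T \in unitmx by rewrite unitmx_tr.
      apply: (can_inj (mulmxK uP)); apply: (can_inj (mulKmx uPT)).
      by rewrite !mulmxA in E *.
    apply/matrixP => a b.
    apply: (chart_constant (f := fun q => kahler_form g J e q a b) ae BD ep
      (kahler_form_smooth a b ae)) => // q' d [eq' _].
    have := special_symplectic special ae eq' d a b.
    by rewrite !big1 ?subr0 // => l _; rewrite n0 // mul0r.
  by move=> q [eq Vq] k a b; rewrite christoffel_restrict // n0.
- by [].
- by move=> q [/eU[]].
rewrite tensor11_restrict //.
have := comp11_change J ac ae cp ep; rewrite jE PJ => E.
by rewrite -(can_inj (mulmxK uP) E).
Qed.

Lemma special_coords_at p U : open U -> U p ->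
  exists c e eta lambda, special_coords g J nabla c e eta lambda /\
    dom c p /\ dom c `<=` U.
Proof.
move=> oU Up; have [c [fc cp cU Ju]] := flat_darboux_at oU Up.
have [ac _ n0] := fc; have oc := dom_open ac.
have [r r0 BD] := ex_chart_ball ac cp oc cp.
pose V := chart_ball c p r; have oV : open V by exact: chart_ball_open.
have Vp : V p by exact: chart_ball_center.
have Vc : V `<=` dom c by move=> q [].
have ex k : exists f, smooth_in c V f /\
    forall q a, V q -> pderiv c a f q = J c q k a.
  have [a|q a b _ cq|f fS fE] := @chart_poincare _ _ _ c p (dom c) r
    (fun a q => J c q k a) ac BD.
  - exact: comp11_smooth.
  - have := special_dnabla special ac cq k a b; rewrite /nabla_J.
    rewrite !big1 => [|l _|l _]; rewrite ?n0 ?mul0r //.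
    by rewrite !addr0 => /eqP; rewrite subr_eq0 => /eqP.
  by exists f.
have [f fP] := choice ex.
have fS k : smooth_in c V (f k) by have [] := fP k.
have fE k q a : V q -> pderiv c a (f k) q = J c q k a by have [_ +] := fP k; exact.
have dfE k q : V q -> differential c (f k) q = row k (J c q).
  by move=> Vq; apply/rowP => a; rewrite !mxE fE.
pose eta (j : 'I_n) q : R[i] := xcoord c j q +i* (- f (lshift n j) q).
pose lambda (j : 'I_n) q : R[i] := (- ycoord c j q) +i* f (rshift n j) q.
have J2 q : V q -> J c q *m J c q = - 1%:M.
  by move=> [cq _]; exact: (complex_structure pk ac cq).
have xS j : smooth_in c V (xcoord c j) by exact: smooth_in_coord.
have yS j : smooth_in c V (ycoord c j) by exact: smooth_in_coord.
have dN h q : smooth_in c V h -> V q ->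
    differential c (fun q => - h q) q = - differential c h q.
  move=> hS Vq; apply/rowP => a; rewrite !mxE.
  exact: (pderivN a (Vc q Vq) Vq hS).
have holo_eta j : holomorphic J V (eta j).
  apply: (@holomorphic_intro _ _ _ J c V (eta j) ac oV Vc (xS j)
    (smooth_inN ac oV (fS _))) => q Vq.
  apply: cauchy_riemann_intro; first exact: J2.
  rewrite /= dN // dfE // opprK differential_coord //; last exact: Vc.
  by rewrite -rowE.
have holo_lambda j : holomorphic J V (lambda j).
  apply: (@holomorphic_intro _ _ _ J c V (lambda j) ac oV Vc
    (smooth_inN ac oV (yS j)) (fS _)) => q Vq.
  apply: cauchy_riemann_intro; first exact: J2.
  rewrite /= dN // dfE // differential_coord //; last exact: Vc.
  by rewrite mulNmx -rowE.
pose F q := real_coords (fun j => eta j q).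
have Fl j : (fun q => F q 0 (lshift n j)) = xcoord c j.
  by apply/funext => q; rewrite /F /real_coords row_mxEl mxE.
have Fr j : (fun q => F q 0 (rshift n j)) = fun q => - f (lshift n j) q.
  by apply/funext => q; rewrite /F /real_coords row_mxEr mxE.
have [k||e [ae ep eV eF]] := @chart_of_functions _ _ _ c p V F ac oV cp Vp.
- case: (split_ordP k) => j ->; first by rewrite Fl; exact: xS.
  by rewrite Fr; exact: smooth_inN.
(* Relative to (x, y), the Jacobian of (Re eta, Im eta) is block triangular, and its nontrivial
   diagonal block is minus the upper right block of [J], invertible by the choice of the Darboux
   chart. *)
- have -> : \matrix_(k, a) pderiv c a (fun q => F q 0 k) p =
      block_mx 1%:M 0 (- ulsubmx (J c p)) (- ursubmx (J c p)).
    apply/matrixP => k a; rewrite mxE.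
    case: (split_ordP k) => j ->.
      rewrite Fl pderiv_coord //; case: (split_ordP a) => b ->.
        by rewrite block_mxEul mxE eq_shift eq_sym.
      by rewrite block_mxEur mxE eq_shift.
    rewrite Fr (pderivN a cp Vp) // fE //; case: (split_ordP a) => b ->.
      by rewrite block_mxEdl !mxE.
    by rewrite block_mxEdr !mxE.
  by rewrite unitmxE det_lblock unitrM det1 unitr1 -unitmxE /= -scaleN1r unitmxZ ?unitrN1.
have eV' q : dom e q -> V q /\ dom c q by move=> /eV[].
have oe := dom_open ae.
exists (restrict_chart c (dom e)), e, eta, lambda; split; last first.
  by split=> // q [_ /eV' [_ /cU]].
have domE : dom e = dom (restrict_chart c (dom e)).
  by apply/seteqP; split=> [q eq|q [] //]; split=> //; have [_] := eV' q eq.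
split.
- exact: flat_darboux_restrict.
- exact: domE.
- split=> [//|j|q eq]; last by rewrite eF.
  by apply: holomorphic_sub (holo_eta j) => q /eV'[].
- by move=> j; apply: holomorphic_sub (holo_lambda j) => q [_ /eV'[]].
- by move=> j q [cq eq]; apply/rowP => a; rewrite !mxE.
move=> j q [cq /eV'[Vq _]]; apply/rowP => a; rewrite !mxE /=.
exact: (pderivN a cq Vq (yS j)).
Qed.

Lemma special_coords_restrict c e eta lambda U :
  special_coords g J nabla c e eta lambda -> open U ->
  special_coords g J nabla (restrict_chart c U) (restrict_chart e U) eta lambda.
Proof.
move=> [fc domE [ae heta eE] hlambda dx dy] oU; split.
- exact: flat_darboux_restrict.
- by rewrite /= domE.
- split; first exact: restrict_chart_atlas.
    by move=> j; apply: holomorphic_sub (heta j) => q [].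
  by move=> q [eq _]; exact: eE.
- by move=> j; apply: holomorphic_sub (hlambda j) => q [].
- by move=> j q [cq _]; exact: dx.
- by move=> j q [cq _]; exact: dy.
Qed.

Lemma special_cover : exists (I : Type) (c e : I -> chart)
    (eta lambda : I -> 'I_n -> M -> R[i]),
  locally_finite_cover (fun i => dom (c i)) /\
  forall i, special_coords g J nabla (c i) (e i) (eta i) (lambda i).
Proof.
(* An empty manifold is covered by the empty family; otherwise [p0] is the default point that the
   refinement argument needs. *)
have [[p0 _]|noM] := pselect (exists p : M, True); last first.
  have no p : False by apply: noM; exists p.
  exists void, (of_void _), (of_void _), (of_void _), (of_void _).
  split=> [|[]]; split=> [[]||p]; last by case: (no p).
  by apply/seteqP; split=> [//|p]; case: (no p).
have ex p : exists x : chart * chart * ('I_n -> M -> R[i]) * ('I_n -> M -> R[i]),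
    special_coords g J nabla x.1.1.1 x.1.1.2 x.1.2 x.2 /\ dom x.1.1.1 p.
  have [c [e [eta [lambda [sc [cp _]]]]]] := special_coords_at openT (I : setT p).
  by exists (c, e, eta, lambda).
have [x xP] := choice ex.
have oU p : open (dom (x p).1.1.1).
  by have [[[ac _ _] _ _ _ _ _] _] := xP p; exact: dom_open.
have exVC p : exists VC : set M * set M, [/\ open_nbhs p VC.1, closed VC.2,
    VC.1 `<=` VC.2 & VC.2 `<=` dom (x p).1.1.1].
  have [V [C VC]] := manifold_regular (oU p) (xP p).2.
  by exists (V, C).
have [VC VCP] := choice exVC.
have [||||||pts [W [WU lfW]]] := @locally_finite_refinement M p0
  (fun p => dom (x p).1.1.1) (fun p => (VC p).1) (fun p => (VC p).2).
- exact: manifold_second_countable.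
- exact: oU.
- by move=> p; have [] := VCP p.
- by move=> p; have [] := VCP p.
- by move=> p; have [] := VCP p.
- by move=> p; have [] := VCP p.
have [oW _ _] := lfW.
exists nat, (fun i => restrict_chart (x (pts i)).1.1.1 (W i)),
  (fun i => restrict_chart (x (pts i)).1.1.2 (W i)),
  (fun i => (x (pts i)).1.2), (fun i => (x (pts i)).2); split.
  suff -> : (fun i => dom (restrict_chart (x (pts i)).1.1.1 (W i))) = W by [].
  by apply/funext => i; apply/setIidr; exact: WU.
by move=> i; apply: special_coords_restrict (oW i); have [] := xP (pts i).
Qed.

End SpecialCoordinates.

(** * The prepotential *)

Section MixedPartials.
Variables (R : realType) (m : nat).
Implicit Types (D : set 'rV[R]_m) (f : 'rV[R]_m -> R) (u v : 'rV[R]_m).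

Local Notation pd a f := ('D_(delta_mx 0 a) f).

(** The mean value theorem is used twice: along [b] for the increment [phi] of [f] in direction [a],
    then along [a] for [pd b f]. *)
Lemma second_difference D f u (a b : 'I_m) (s : R) : open D -> class_C 2 D f ->
  (forall t t' : R, 0 <= t <= 1 -> 0 <= t' <= 1 ->
    D (t *: (s *: delta_mx 0 a) + (t' *: (s *: delta_mx 0 b) + u))) ->
  exists t t' : R, [/\ 0 <= t <= 1, 0 <= t' <= 1 &
    f (s *: delta_mx 0 a + (s *: delta_mx 0 b + u)) - f (s *: delta_mx 0 b + u)
    - (f (s *: delta_mx 0 a + u) - f u) =
    s * (s * pd a (pd b f)
      (t *: (s *: delta_mx 0 a) + (t' *: (s *: delta_mx 0 b) + u)))].
Proof.
move=> oD fC HD; pose phi v := f (s *: delta_mx 0 a + v) - f v.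
have fC1 := class_CS fC; have pC := class_C_pd b fC.
have dphi (t' : R) : 0 <= t' <= 1 ->
    is_derive (t' *: (s *: delta_mx 0 b) + u) (delta_mx 0 b) phi
      (pd b f (s *: delta_mx 0 a + (t' *: (s *: delta_mx 0 b) + u))
       - pd b f (t' *: (s *: delta_mx 0 b) + u)).
  move=> t'01; set v := t' *: _ + u.
  have D0 : D v by have := HD 0 t'; rewrite scale0r add0r; apply; rewrite ?lexx ?ler01.
  have D1 : D (s *: delta_mx 0 a + v).
    by have := HD 1 t'; rewrite scale1r; apply; rewrite ?lexx ?ler01.
  have d0 := derivableP (class_C_derivable (a := b) fC1 D0).
  have d1 : is_derive v (delta_mx 0 b) (fun v => f (s *: delta_mx 0 a + v))
      (pd b f (s *: delta_mx 0 a + v)).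
    have [df dE] := derivableP (class_C_derivable (a := b) fC1 D1).
    have E : (fun h : R => h^-1 *: ((f \o shift (s *: delta_mx 0 a + v)) (h *: delta_mx 0 b)
        - f (s *: delta_mx 0 a + v))) =
      (fun h : R => h^-1 *: (((fun v => f (s *: delta_mx 0 a + v)) \o shift v)
        (h *: delta_mx 0 b) - f (s *: delta_mx 0 a + v))).
      by apply/funext => h /=; rewrite addrCA.
    by apply: DeriveDef; [rewrite /derivable -E|rewrite /derive -E].
  exact: is_deriveB d1 d0.
have [t' t'01|t' t'01 E] := @MVT_dir _ _ phi u (s *: delta_mx 0 b).
  by have [dp _] := dphi t' t'01; have [] := is_deriveZdir s dp.
have [dp dpE] := dphi t' t'01; have [_ E2] := is_deriveZdir s dp.
rewrite E2 dpE in E.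
have Dt (t : R) : 0 <= t <= 1 ->
    derivable (pd b f) (t *: (s *: delta_mx 0 a) + (t' *: (s *: delta_mx 0 b) + u))
      (delta_mx 0 a).
  by move=> t01; exact: class_C_derivable pC (HD t t' t01 t'01).
have [t t01|t t01 E3] := @MVT_dir _ _ (pd b f) (t' *: (s *: delta_mx 0 b) + u)
  (s *: delta_mx 0 a).
  by have [] := is_deriveZdir s (Dt t t01).
have [_ E4] := is_deriveZdir s (Dt t t01).
by exists t, t'; split=> //; rewrite -E4 -E3 -E.
Qed.

(** The second difference over a small square is symmetric in the two directions, and divided by the
    area of the square it is a value of either mixed derivative at a nearby point. *)
Lemma pd_comm D f u (a b : 'I_m) : open D -> class_C 2 D f -> D u ->
  pd a (pd b f) u = pd b (pd a f) u.
Proof.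
move=> oD fC Du.
apply/eqP; rewrite -subr_eq0 -normr_le0; apply/ler_addgt0Pr => e e0.
rewrite add0r; have e20 : 0 < e / 2 by rewrite divr_gt0.
have near_pd (a' b' : 'I_m) : \forall v \near u,
    `|pd a' (pd b' f) u - pd a' (pd b' f) v| <= e / 2.
  by have /cvgrPdist_le /(_ _ e20) := class_C_cont (class_C_pd a' (class_C_pd b' fC)) Du.
have nD : \forall v \near u, D v by exact: near_in_open oD Du _.
have /nbhs_ballP[d /= d0 dP] : \forall v \near u, D v /\
    (`|pd a (pd b f) u - pd a (pd b f) v| <= e / 2 /\
     `|pd b (pd a f) u - pd b (pd a f) v| <= e / 2).
  by apply: filterI nD _; apply: filterI; exact: near_pd.
(* With [s + s < d], the square of side [s] at [u] stays in the ball of radius [d]. *)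
have [s [s0 sd]] : exists s, 0 < s /\ s + s < d by exists (d / 3); split; lra.
have Bs (a' b' : 'I_m) (t t' : R) : 0 <= t <= 1 -> 0 <= t' <= 1 ->
    ball u d (t *: (s *: delta_mx 0 a') + (t' *: (s *: delta_mx 0 b') + u)).
  have le_s (w : R) (k : 'I_m) : 0 <= w <= 1 ->
      `|w *: (s *: delta_mx 0 k) : 'rV[R]_m| <= s.
    move=> /andP[w0 w1]; apply: row_norm_le => [|j]; first exact: ltW.
    rewrite !mxE eqxx /= !normrM (ger0_norm w0) (gtr0_norm s0).
    case: eqP => _; rewrite ?normr1 ?normr0 ?mulr0 ?mulr1; last exact: ltW.
    by rewrite ler_piMl // ltW.
  move=> t01 t'01; rewrite -ball_normE /= distrC addrA addrK.
  rewrite (le_lt_trans (ler_normD _ _)) //.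
  by apply: le_lt_trans sd; rewrite lerD // le_s.
have [t1 [t1' [t101 t1'01 E1]]] := second_difference oD fC
  (fun t t' t01 t'01 => (dP _ (Bs a b t t' t01 t'01)).1).
have [t2 [t2' [t201 t2'01 E2]]] := second_difference oD fC
  (fun t t' t01 t'01 => (dP _ (Bs b a t t' t01 t'01)).1).
have [_ [h1 _]] := dP _ (Bs a b t1 t1' t101 t1'01).
have [_ [_ h2]] := dP _ (Bs b a t2 t2' t201 t2'01).
rewrite (addrCA (s *: delta_mx 0 b) (s *: delta_mx 0 a) u) in E2.
move: E1 h1.
move: (pd a (pd b f) (t1 *: (s *: delta_mx 0 a) + (t1' *: (s *: delta_mx 0 b) + u))).
move: E2 h2.
move: (pd b (pd a f) (t2 *: (s *: delta_mx 0 b) + (t2' *: (s *: delta_mx 0 a) + u))).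
move: (f (s *: delta_mx 0 a + (s *: delta_mx 0 b + u)))
  (f (s *: delta_mx 0 b + u)) (f (s *: delta_mx 0 a + u)) (f u).
move: (pd a (pd b f) u) (pd b (pd a f) u) => L L' f2 fb fa f0 X2 E2 h2 X1 E1 h1.
have EX : X1 = X2.
  have sn0 : s != 0 by rewrite gt_eqF.
  by apply: (mulfI sn0); apply: (mulfI sn0); rewrite -E1 -E2; ring.
rewrite EX in h1; rewrite -(subrKA X2) (le_trans (ler_normD _ _)) // (splitr e).
by rewrite lerD // distrC.
Qed.

End MixedPartials.

Lemma pderiv_comm (R : realType) (m : nat) (M : smooth_manifold R m)
    (c : chart R m M) (U : set M) (s t : 'I_m) (f : M -> R) (q : M) :
  atlas c -> open U -> smooth_in c U f -> dom c q -> U q ->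
  pderiv c s (pderiv c t f) q = pderiv c t (pderiv c s f) q.
Proof.
move=> ac oU fS cq Uq; have oI := chart_image_open ac oU.
have Iq : chart_image c U (coord c q) by exact: chart_image_coord.
have E s' t' : pderiv c s' (pderiv c t' f) q =
    'D_(delta_mx 0 s') ('D_(delta_mx 0 t') (f \o coordV c)) (coord c q).
  apply: near_eq_derive; apply: near_in_open oI Iq _ => u.
  by move=> /(chart_imageP ac)[_ _ uE]; rewrite /= /pderiv uE.
by rewrite !E; exact: pd_comm oI (fS 2) Iq.
Qed.

Section Prepotential.
Variables (R : realType) (n : nat) (M : smooth_manifold R (n + n)).
Local Notation chart := (chart R (n + n) M).
Variables (g : tensor02 M) (J : tensor11 M) (nabla : connection M).
Hypothesis special : rigid_special_kahler g J nabla.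
Variables (c e : chart) (eta lambda : 'I_n -> M -> R[i]).
Hypothesis sc : special_coords g J nabla c e eta lambda.
Implicit Types (p q : M) (i j k : 'I_n) (s t : 'I_(n + n)).

Local Notation l := (lshift n).
Local Notation r := (rshift n).
Let pk := special_pseudo_kahler special.

(** Below, eta_j = [x] + i [y] and lambda_j = [a] + i [b]. This [y] is not the Darboux coordinate,
    whose differential is that of [- a]. *)
Definition re_eta j q := complex.Re (eta j q).
Definition im_eta j q := complex.Im (eta j q).
Definition re_lambda j q := complex.Re (lambda j q).
Definition im_lambda j q := complex.Im (lambda j q).

Local Notation x := re_eta.
Local Notation y := im_eta.
Local Notation a := re_lambda.
Local Notation b := im_lambda.

Let ae : atlas e. Proof. by case: sc => _ _ []. Qed.
Let ac : atlas c. Proof. by case: sc => -[]. Qed.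
Let oe : open (dom e). Proof. exact: dom_open. Qed.
Let domE : dom e = dom c. Proof. by case: sc. Qed.

Lemma coord_re_eta j q : dom e q -> coord e q 0 (l j) = x j q.
Proof. by move=> eq; have [_ _ [_ _ ->] // _ _ _] := sc; rewrite row_mxEl mxE. Qed.

Lemma coord_im_eta j q : dom e q -> coord e q 0 (r j) = y j q.
Proof. by move=> eq; have [_ _ [_ _ ->] // _ _ _] := sc; rewrite row_mxEr mxE. Qed.

Lemma re_eta_smooth j : smooth_in e (dom e) (x j).
Proof. by have [_ _ [_ /(_ j)[H _ _] _] _ _ _] := sc; exact: H. Qed.

Lemma im_eta_smooth j : smooth_in e (dom e) (y j).
Proof. by have [_ _ [_ /(_ j)[_ H _] _] _ _ _] := sc; exact: H. Qed.

Lemma re_lambda_smooth j : smooth_in e (dom e) (a j).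
Proof. by rewrite domE; have [_ _ _ /(_ j)[H _ _] _ _] := sc; exact: H. Qed.

Lemma im_lambda_smooth j : smooth_in e (dom e) (b j).
Proof. by rewrite domE; have [_ _ _ /(_ j)[_ H _] _ _] := sc; exact: H. Qed.

Lemma pderiv_re_eta s j q : dom e q -> pderiv e s (x j) q = (s == l j)%:R.
Proof.
move=> eq; rewrite -(pderiv_coord s (l j) ae eq).
by apply: (eq_pderiv s ae oe eq eq) => q' eq' _; rewrite coord_re_eta.
Qed.

Lemma pderiv_im_eta s j q : dom e q -> pderiv e s (y j) q = (s == r j)%:R.
Proof.
move=> eq; rewrite -(pderiv_coord s (r j) ae eq).
by apply: (eq_pderiv s ae oe eq eq) => q' eq' _; rewrite coord_im_eta.
Qed.

Lemma differential_re_eta j q : dom e q -> differential e (x j) q = delta_mx 0 (l j).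
Proof. by move=> eq; apply/rowP => s; rewrite !mxE pderiv_re_eta // eqxx. Qed.

Lemma differential_im_eta j q : dom e q -> differential e (y j) q = delta_mx 0 (r j).
Proof. by move=> eq; apply/rowP => s; rewrite !mxE pderiv_im_eta // eqxx. Qed.

Lemma J_special q : dom e q -> J e q = block_mx 0 (- 1%:M) 1%:M 0.
Proof.
move=> eq; have CR j : cauchy_riemann J e (eta j) q.
  by have [_ _ [_ /(_ j) he _] _ _ _] := sc; exact: (holomorphic_cauchy_riemann he ae eq eq).
apply/row_matrixP => s; rewrite !rowE; case: (split_ordP s) => j ->.
  have [+ _] := CR j; rewrite (differential_re_eta j eq) (differential_im_eta j eq) => ->.
  rewrite -rowE; apply/rowP => t; rewrite [RHS]mxE.
  case: (split_ordP t) => k ->; rewrite ?block_mxEul ?block_mxEur !mxE eqxx eq_shift /=.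
    by rewrite oppr0.
  by rewrite eq_sym.
have [_ +] := CR j; rewrite (differential_re_eta j eq) (differential_im_eta j eq) => ->.
rewrite -rowE; apply/rowP => t; rewrite [RHS]mxE.
case: (split_ordP t) => k ->; rewrite ?block_mxEdl ?block_mxEdr !mxE eqxx eq_shift //=.
by rewrite eq_sym.
Qed.

Lemma mul_J_l d (A : 'M[R]_(d, n + n)) q (s : 'I_d) k : dom e q ->
  (A *m J e q) s (l k) = A s (r k) /\ (A *m J e q) s (r k) = - A s (l k).
Proof.
move=> eq; rewrite J_special // -{1 3}[A]hsubmxK mul_row_block.
rewrite !mulmx0 mulmx1 mulmxN mulmx1 add0r addr0 row_mxEl row_mxEr !mxE.
by [].
Qed.

Lemma lambda_CR k j q : dom e q ->
  pderiv e (r k) (a j) q = - pderiv e (l k) (b j) q /\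
  pderiv e (r k) (b j) q = pderiv e (l k) (a j) q.
Proof.
move=> eq; have cq : dom c q by rewrite -domE.
have [_ _ _ /(_ j) hl _ _] := sc.
have [H1 H2] := holomorphic_cauchy_riemann hl ae cq eq.
split.
  have := congr1 (fun A : 'rV[R]_(n + n) => A 0 (l k)) H1.
  by rewrite /= (mul_J_l _ _ _ eq).1 !mxE.
have := congr1 (fun A : 'rV[R]_(n + n) => A 0 (l k)) H2.
by rewrite /= (mul_J_l _ _ _ eq).1 !mxE.
Qed.

Lemma wedge_mulmx (u v : 'rV[R]_(n + n)) (A : 'M[R]_(n + n)) :
  A^T *m wedge u v *m A = wedge (u *m A) (v *m A).
Proof.
rewrite /wedge -scalemxAr -scalemxAl mulmxBr mulmxBl !trmx_mul.
by rewrite !mulmxA.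
Qed.

(** The Darboux expression pulled back to the chart of eta; the sign comes from dy_j = - d Re
    lambda_j. *)
Lemma kahler_form_special q : dom e q -> kahler_form g J e q =
  \sum_j wedge (delta_mx 0 (l j)) (- differential e (a j) q).
Proof.
move=> eq; have cq : dom c q by rewrite -domE.
have [[_ kf _] _ _ _ dx dy] := sc.
rewrite (kahler_form_change g J ae ac eq cq) kf // mulmx_sumr mulmx_suml.
have xS j : smooth_in c (dom c) (x j).
  by rewrite -domE; have [_ _ [_ /(_ j)[H _ _] _] _ _ _] := sc; exact: H.
have aS j : smooth_in c (dom c) (a j).
  by have [_ _ _ /(_ j)[H _ _] _ _] := sc; exact: H.
apply: eq_bigr => j _; rewrite wedge_mulmx; congr wedge.
  rewrite -(differential_re_eta j eq).
  rewrite (differential_change ae ac (dom_open ac) eq cq cq (xS j)) -dx //.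
  by congr (_ *m _); apply/rowP => s; rewrite !mxE.
rewrite (differential_change ae ac (dom_open ac) eq cq cq (aS j)) -mulNmx.
congr (_ *m _); rewrite -[LHS]opprK -dy //; congr (- _).
by apply/rowP => s; rewrite !mxE.
Qed.

Lemma kahler_form_entry q s t : dom e q -> kahler_form g J e q s t =
  2^-1 * (\sum_j (t == l j)%:R * pderiv e s (a j) q
        - \sum_j (s == l j)%:R * pderiv e t (a j) q).
Proof.
move=> eq; rewrite kahler_form_special // summxE -sumrB mulr_sumr.
apply: eq_bigr => j _; rewrite /wedge !mxE !big_ord1 !mxE eqxx /=.
ring.
Qed.

Lemma kahler_form_ll q i k : dom e q -> kahler_form g J e q (l i) (l k) =
  2^-1 * (pderiv e (l i) (a k) q - pderiv e (l k) (a i) q).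
Proof.
have sumD (f : 'I_n -> R) k' : \sum_j (l k' == l j)%:R * f j = f k'.
  rewrite (bigD1 k') //= eqxx mul1r big1 ?addr0 // => j jk.
  by rewrite eq_shift eq_sym (negbTE jk) mul0r.
by move=> eq; rewrite kahler_form_entry // !sumD.
Qed.

Lemma kahler_form_lr q i k : dom e q -> kahler_form g J e q (l i) (r k) =
  - 2^-1 * pderiv e (r k) (a i) q.
Proof.
move=> eq; rewrite kahler_form_entry // big1 => [|j _]; last by rewrite eq_shift mul0r.
rewrite (bigD1 i) //= eqxx mul1r big1 ?addr0 => [|j jk].
  by ring.
by rewrite eq_shift eq_sym (negbTE jk) mul0r.
Qed.

Lemma kahler_form_rl q i k : dom e q -> kahler_form g J e q (r i) (l k) =
  2^-1 * pderiv e (r i) (a k) q.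
Proof.
move=> eq; rewrite kahler_form_entry // [X in _ - X]big1 => [|j _]; last by rewrite eq_shift mul0r.
rewrite (bigD1 k) //= eqxx mul1r big1 ?addr0 ?subr0 // => j jk.
by rewrite eq_shift eq_sym (negbTE jk) mul0r.
Qed.

Lemma kahler_form_rr q i k : dom e q -> kahler_form g J e q (r i) (r k) = 0.
Proof.
move=> eq; rewrite kahler_form_entry // !big1 ?subrr ?mulr0 // => j _;
by rewrite eq_shift mul0r.
Qed.

Lemma kahler_form_J_invariant q : dom e q ->
  (J e q)^T *m kahler_form g J e q *m J e q = kahler_form g J e q.
Proof.
by move=> eq; rewrite /kahler_form !mulmxA (metric_hermitian pk ae eq).
Qed.

(* The (2,0)-form sum_j dlambda_j /\ deta^j vanishes, its real part being a
   multiple of Phi - Phi(J., J.). *)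
Lemma lambda_sym i k q : dom e q ->
  pderiv e (l i) (a k) q = pderiv e (l k) (a i) q /\
  pderiv e (r i) (a k) q = pderiv e (r k) (a i) q.
Proof.
move=> eq; have := kahler_form_J_invariant eq.
set Phi := kahler_form g J e q; rewrite J_special // => H.
have E : (block_mx 0 (- 1%:M) 1%:M 0)^T *m Phi *m block_mx 0 (- 1%:M) 1%:M 0 =
  block_mx (drsubmx Phi) (- dlsubmx Phi) (- ursubmx Phi) (ulsubmx Phi) :> 'M[R]_(n + n).
  rewrite -{1}[Phi]submxK tr_block_mx !trmx0 linearN /= !trmx1 !mulmx_block.
  by rewrite !mul0mx !mulmx0 !mulNmx !mulmxN !mul1mx !mulmx1 !add0r !addr0 opprK.
have subE (A : 'M[R]_(n + n)) : drsubmx A i k = A (r i) (r k) /\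
    (- dlsubmx A) i k = - A (r i) (l k) by rewrite !mxE.
have [drE dlE] := subE Phi.
rewrite E in H; split.
  have := congr1 (fun A : 'M[R]_(n + n) => A (l i) (l k)) H.
  rewrite block_mxEul drE /Phi kahler_form_rr // kahler_form_ll //.
  by lra.
have := congr1 (fun A : 'M[R]_(n + n) => A (l i) (r k)) H.
rewrite block_mxEur dlE /Phi kahler_form_rl // kahler_form_lr //.
by lra.
Qed.

Lemma metric_special q s t : dom e q -> g e q s t =
  - (kahler_form g J e q *m J e q) s t.
Proof.
move=> eq; rewrite /kahler_form -mulmxA (complex_structure pk ae eq).
by rewrite mulmxN mulmx1 mxE opprK.
Qed.

Lemma metric_entries q i j : dom e q ->
  [/\ g e q (l i) (l j) = 2^-1 * pderiv e (r i) (a j) q,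
      g e q (l i) (r j) = 0, g e q (r i) (l j) = 0 &
      g e q (r i) (r j) = 2^-1 * pderiv e (r i) (a j) q].
Proof.
move=> eq; have [s1 s2] := lambda_sym i j eq.
have gl s : g e q s (l j) = - kahler_form g J e q s (r j).
  by rewrite metric_special // (mul_J_l _ _ _ eq).1.
have gr s : g e q s (r j) = kahler_form g J e q s (l j).
  by rewrite metric_special // (mul_J_l _ _ _ eq).2 opprK.
rewrite !gl !gr kahler_form_lr // kahler_form_ll // kahler_form_rr // kahler_form_rl //.
by rewrite s1 s2; split; ring.
Qed.

Let aS := re_lambda_smooth.
Let bS := im_lambda_smooth.
Let xS := re_eta_smooth.
Let yS := im_eta_smooth.

Lemma lambda_sym_im i k q : dom e q ->
  pderiv e (l i) (b k) q = pderiv e (l k) (b i) q.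
Proof.
move=> eq; have [_ h] := lambda_sym i k eq.
have [h1 _] := lambda_CR i k eq.
have [h2 _] := lambda_CR k i eq.
by apply: oppr_inj; rewrite -h1 -h2.
Qed.

Lemma lambda_CR2 s k j q : dom e q ->
  pderiv e s (pderiv e (r k) (a j)) q = - pderiv e s (pderiv e (l k) (b j)) q /\
  pderiv e s (pderiv e (r k) (b j)) q = pderiv e s (pderiv e (l k) (a j)) q.
Proof.
move=> eq; split.
  have bS' := smooth_in_pderiv (l k) ae oe (bS j).
  rewrite -(pderivN s eq eq bS').
  apply: (eq_pderiv s ae oe eq eq) => q' eq' _.
  by have [] := lambda_CR k j eq'.
apply: (eq_pderiv s ae oe eq eq) => q' eq' _.
by have [] := lambda_CR k j eq'.
Qed.

Lemma half_complex : (2^-1 : R[i]) = (2^-1)%:C.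
Proof. by rewrite fmorphV rmorph_nat. Qed.

Lemma wirtinger_holo (s t u v : R) :
  2^-1 * ((s +i* t) - 'i%C * (u +i* v)) = (2^-1 * (s + v)) +i* (2^-1 * (t - u)).
Proof.
rewrite half_complex; apply/eqP; rewrite eq_complex /=.
by apply/andP; split; apply/eqP; ring.
Qed.

Lemma wirtinger_antiholo (s t u v : R) :
  2^-1 * ((s +i* t) + 'i%C * (u +i* v)) = (2^-1 * (s - v)) +i* (2^-1 * (t + u)).
Proof.
rewrite half_complex; apply/eqP; rewrite eq_complex /=.
by apply/andP; split; apply/eqP; ring.
Qed.

Lemma ex_prepotential p : dom e p -> exists V F, [/\ open_nbhs p V, V `<=` dom e,
    holomorphic J V F &
    forall j q, V q -> dholo e j F q = (- 8^-1 * a j q) +i* (- 8^-1 * b j q)].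
Proof.
move=> ep; have [d d0 BD] := ex_chart_ball ae ep oe ep.
(* [om1] and [om2] are the real and imaginary parts of the 1-form - (sum_j lambda_j deta^j) / 8.
   They are closed by the symmetry of the derivatives of lambda and the Cauchy-Riemann equations. *)
pose om1 s q := row_mx (\row_j (- 8^-1 * a j q)) (\row_j (8^-1 * b j q)) 0 s.
pose om2 s q := row_mx (\row_j (- 8^-1 * b j q)) (\row_j (- 8^-1 * a j q)) 0 s.
have om1l j : om1 (l j) = fun q => - 8^-1 * a j q.
  by apply/funext => q; rewrite /om1 row_mxEl mxE.
have om1r j : om1 (r j) = fun q => 8^-1 * b j q.
  by apply/funext => q; rewrite /om1 row_mxEr mxE.
have om2l j : om2 (l j) = fun q => - 8^-1 * b j q.
  by apply/funext => q; rewrite /om2 row_mxEl mxE.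
have om2r j : om2 (r j) = fun q => - 8^-1 * a j q.
  by apply/funext => q; rewrite /om2 row_mxEr mxE.
have ZS (z : R) f : smooth_in e (dom e) f -> smooth_in e (dom e) (fun q => z * f q).
  by move=> fS; apply: smooth_inM => //; exact: smooth_in_cst.
have om1S s : smooth_in e (dom e) (om1 s).
  by case: (split_ordP s) => j ->; rewrite ?om1l ?om1r; exact: ZS.
have om2S s : smooth_in e (dom e) (om2 s).
  by case: (split_ordP s) => j ->; rewrite ?om2l ?om2r; exact: ZS.
have pZ (z : R) s f q : smooth_in e (dom e) f -> dom e q ->
    pderiv e s (fun q => z * f q) q = z * pderiv e s f q.
  by move=> fS eq; exact: (pderivZ s eq eq).
have [||u uS uE] := @chart_poincare _ _ _ e p (dom e) d om1 ae BD.
- exact: om1S.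
- move=> q s t eq _; case: (split_ordP s) => i ->; case: (split_ordP t) => k ->;
    rewrite ?om1l ?om1r !pZ //.
  + by have [-> _] := lambda_sym i k eq.
  + have [-> _] := lambda_CR k i eq.
    by rewrite lambda_sym_im // mulNr mulrN opprK.
  + have [-> _] := lambda_CR i k eq.
    by rewrite lambda_sym_im // mulNr mulrN opprK.
  + have [_ ->] := lambda_CR i k eq.
    have [_ ->] := lambda_CR k i eq.
    by have [-> _] := lambda_sym i k eq.
have [||v vS vE] := @chart_poincare _ _ _ e p (dom e) d om2 ae BD.
- exact: om2S.
- move=> q s t eq _; case: (split_ordP s) => i ->; case: (split_ordP t) => k ->;
    rewrite ?om2l ?om2r !pZ //.
  + by rewrite lambda_sym_im.
  + have [_ ->] := lambda_CR k i eq.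
    by have [-> _] := lambda_sym i k eq.
  + have [_ ->] := lambda_CR i k eq.
    by have [-> _] := lambda_sym i k eq.
  + by have [_ ->] := lambda_sym i k eq.
pose V := chart_ball e p d; have oV : open V by exact: chart_ball_open.
have Ve : V `<=` dom e by move=> q [].
pose F q := u q +i* v q.
exists V, F; split=> //.
- by split=> //; exact: chart_ball_center.
- apply: (@holomorphic_intro _ _ _ J e V F ae oV Ve uS vS) => q Vq.
  have eq := Ve q Vq.
  apply: cauchy_riemann_intro; first exact: (complex_structure pk ae eq).
  have duE s : differential e u q 0 s = om1 s q by rewrite mxE uE.
  have dvE s : differential e v q 0 s = om2 s q by rewrite mxE vE.
  apply/rowP => s; rewrite [RHS]mxE /= dvE.
  case: (split_ordP s) => k ->.
    by rewrite (mul_J_l _ _ _ eq).1 duE om1r om2l mulNr opprK.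
  by rewrite (mul_J_l _ _ _ eq).2 duE om1l om2r.
move=> j q Vq; rewrite /dholo /pderivC wirtinger_holo /=.
rewrite !uE // !vE // om1l om1r om2l om2r.
by congr (_ +i* _); field.
Qed.

(** This is - Im (sum_k lambda_k * conj eta^k) / 4, the value of the special potential once
    dF/deta^k = - lambda_k / 8 is inserted. It no longer involves [F], so it can be differentiated
    on all of [dom e]. *)
Definition real_potential q : R := - 4^-1 * \sum_k (b k q * x k q - a k q * y k q).

Lemma special_potentialE (V : set M) (F : M -> R[i]) q : V q ->
  (forall j q, V q -> dholo e j F q = (- 8^-1 * a j q) +i* (- 8^-1 * b j q)) ->
  special_potential e eta F q = real_potential q.
Proof.
move=> Vq FE; rewrite /special_potential /real_potential raddf_sum /= !mulr_sumr.
apply: eq_bigr => k _; rewrite FE // /re_eta /im_eta.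
by case: (eta k q) => u v /=; field.
Qed.

Let term1 k q := b k q * x k q.
Let term2 k q := a k q * y k q.
Let S1 k : smooth_in e (dom e) (term1 k). Proof. exact: smooth_inM. Qed.
Let S2 k : smooth_in e (dom e) (term2 k). Proof. exact: smooth_inM. Qed.

Lemma real_potential_smooth : smooth_in e (dom e) real_potential.
Proof.
apply: smooth_inM => //; first exact: smooth_in_cst.
by apply: smooth_in_sum => // k; exact: (smooth_inD ae oe (S1 k) (smooth_inN ae oe (S2 k))).
Qed.

Lemma pderiv_real_potential s q : dom e q -> pderiv e s real_potential q =
  - 4^-1 * \sum_k ((b k q * (s == l k)%:R + x k q * pderiv e s (b k) q)
                 - (a k q * (s == r k)%:R + y k q * pderiv e s (a k) q)).
Proof.
move=> eq; have BS k : smooth_in e (dom e) (fun q => term1 k q - term2 k q).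
  exact: (smooth_inD ae oe (S1 k) (smooth_inN ae oe (S2 k))).
have SS : smooth_in e (dom e) (fun q => \sum_k (term1 k q - term2 k q)).
  exact: smooth_in_sum.
rewrite (pderivZ s eq eq _ SS) (pderiv_sum s eq eq BS); congr (_ * _).
apply: eq_bigr => k _; rewrite (pderivB s eq eq (S1 k) (S2 k)).
rewrite (pderivM s ae eq eq (bS k) (xS k)).
rewrite (pderivM s ae eq eq (aS k) (yS k)).
by rewrite pderiv_re_eta // pderiv_im_eta.
Qed.

(** The product rule is split into six sums, so that the sums with Kronecker symbols collapse by
    [sum_shift] and the Cauchy-Riemann equations can be inserted in the second-order ones. *)
Definition hessian_potential t s q : R := - 4^-1 *
  (\sum_k x k q * pderiv e t (pderiv e s (b k)) q
   - \sum_k y k q * pderiv e t (pderiv e s (a k)) q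
   + \sum_k pderiv e s (b k) q * (t == l k)%:R
   + \sum_k pderiv e t (b k) q * (s == l k)%:R
   - \sum_k pderiv e s (a k) q * (t == r k)%:R
   - \sum_k pderiv e t (a k) q * (s == r k)%:R).

Lemma pderiv2_real_potential t s q : dom e q ->
  pderiv e t (pderiv e s real_potential) q = hessian_potential t s q.
Proof.
move=> eq.
have cS (z : R) (f : M -> R) : smooth_in e (dom e) f -> smooth_in e (dom e) (fun q => z * f q).
  by move=> fS; apply: smooth_inM => //; exact: smooth_in_cst.
have pS k : smooth_in e (dom e) (pderiv e s (b k)) := smooth_in_pderiv s ae oe (bS k).
have p'S k : smooth_in e (dom e) (pderiv e s (a k)) := smooth_in_pderiv s ae oe (aS k).
pose G1 k q := (s == l k)%:R * b k q; pose G2 k q := x k q * pderiv e s (b k) q.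
pose G3 k q := (s == r k)%:R * a k q; pose G4 k q := y k q * pderiv e s (a k) q.
have G1S k : smooth_in e (dom e) (G1 k) by exact: cS.
have G2S k : smooth_in e (dom e) (G2 k) by exact: smooth_inM.
have G3S k : smooth_in e (dom e) (G3 k) by exact: cS.
have G4S k : smooth_in e (dom e) (G4 k) by exact: smooth_inM.
have G12S k : smooth_in e (dom e) (fun q => G1 k q + G2 k q) by exact: smooth_inD.
have G34S k : smooth_in e (dom e) (fun q => G3 k q + G4 k q) by exact: smooth_inD.
have GS k : smooth_in e (dom e) (fun q => (G1 k q + G2 k q) - (G3 k q + G4 k q)).
  exact: (smooth_inD ae oe (G12S k) (smooth_inN ae oe (G34S k))).
have SS : smooth_in e (dom e) (fun q => \sum_k ((G1 k q + G2 k q) - (G3 k q + G4 k q))).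
  exact: smooth_in_sum.
transitivity (pderiv e t (fun q => - 4^-1 *
    \sum_k ((G1 k q + G2 k q) - (G3 k q + G4 k q))) q).
  apply: (eq_pderiv t ae oe eq eq) => q' eq' _.
  rewrite pderiv_real_potential //; congr (_ * _); apply: eq_bigr => k _.
  by rewrite /G1 /G2 /G3 /G4 (mulrC (b k q')) (mulrC (a k q')).
rewrite (pderivZ t eq eq _ SS) (pderiv_sum t eq eq GS) /hessian_potential; congr (_ * _).
rewrite -!sumrB -!big_split /= -!sumrB; apply: eq_bigr => k _.
rewrite (pderivB t eq eq (G12S k) (G34S k)).
rewrite (pderivD t eq eq (G1S k) (G2S k)) (pderivD t eq eq (G3S k) (G4S k)).
rewrite (pderivZ t eq eq _ (bS k)) (pderivZ t eq eq _ (aS k)).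
rewrite (pderivM t ae eq eq (xS k) (pS k)) (pderivM t ae eq eq (yS k) (p'S k)).
rewrite pderiv_re_eta // pderiv_im_eta //.
move: (pderiv e t (pderiv e s (b k)) q) (pderiv e t (pderiv e s (a k)) q) => b2 a2.
move: (pderiv e s (b k) q) (pderiv e s (a k) q) => db da.
move: (pderiv e t (b k) q) (pderiv e t (a k) q) (x k q) (y k q) => db' da' x1 y1.
move: ((s == l k)%:R) ((s == r k)%:R) ((t == l k)%:R) ((t == r k)%:R) => d1 d2 d3 d4.
ring.
Qed.

Lemma sum_shift (f : 'I_n -> R) i :
  (\sum_k f k * (l i == l k)%:R = f i) * (\sum_k f k * (r i == r k)%:R = f i) *
  (\sum_k f k * (l i == r k)%:R = 0) * (\sum_k f k * (r i == l k)%:R = 0).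
Proof.
have D : \sum_k f k * (i == k)%:R = f i.
  rewrite (bigD1 i) //= eqxx mulr1 big1 ?addr0 // => k ki.
  by rewrite eq_sym (negbTE ki) mulr0.
split; [split; [split|]|].
- by under eq_bigr do rewrite eq_shift.
- by under eq_bigr do rewrite eq_shift.
- by apply: big1 => k _; rewrite eq_shift mulr0.
- by apply: big1 => k _; rewrite eq_shift mulr0.
Qed.

(* In the following proofs [pderiv e] is generalized before rewriting, since
   comparing two of its distinct instances unfolds it down to limits. *)
Lemma hessian_laplacian i j q : dom e q ->
  hessian_potential (l i) (l j) q + hessian_potential (r i) (r j) q =
  pderiv e (r i) (a j) q.
Proof.
move=> eq; rewrite /hessian_potential !sum_shift.
(* For the real and imaginary parts of a holomorphic function, the second derivative along Im eta^i
   and Im eta^j is minus the one along Re eta^i and Re eta^j. The second-order terms therefore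
   cancel in the sum. *)
have Fb k : pderiv e (r i) (pderiv e (r j) (b k)) q =
    - pderiv e (l i) (pderiv e (l j) (b k)) q.
  apply: (etrans (lambda_CR2 (r i) j k eq).2).
  apply: (etrans (pderiv_comm (r i) (l j) ae oe (aS k) eq eq)).
  apply: (etrans (lambda_CR2 (l j) i k eq).1).
  exact: (congr1 (fun z => - z) (pderiv_comm (l j) (l i) ae oe (bS k) eq eq)).
have Fa k : pderiv e (r i) (pderiv e (r j) (a k)) q =
    - pderiv e (l i) (pderiv e (l j) (a k)) q.
  apply: (etrans (lambda_CR2 (r i) j k eq).1); apply: (congr1 (fun z => - z)).
  apply: (etrans (pderiv_comm (r i) (l j) ae oe (bS k) eq eq)).
  exact: (etrans (lambda_CR2 (l j) i k eq).2 (pderiv_comm (l j) (l i) ae oe (aS k) eq eq)).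
move: (lambda_sym_im j i eq) (lambda_CR i j eq).1 (lambda_CR j i eq).1 Fb Fa.
move: (pderiv e) => D sym CRij CRji Fb Fa.
under [X in _ + - 4^-1 * (X - _ + _ + _ - _ - _)]eq_bigr do rewrite Fb mulrN.
under [X in _ + - 4^-1 * (_ - X + _ + _ - _ - _)]eq_bigr do rewrite Fa mulrN.
rewrite !sumrN CRij CRji sym.
move: (\sum_k _) (\sum_k _) (D _ _ _) => A B C.
by field.
Qed.

(** This makes the imaginary part of the mixed Wirtinger derivative vanish, as it must because
    [bilinC_special] shows the metric coefficient to be real. *)
Lemma hessian_mixed i j q : dom e q ->
  hessian_potential (l i) (r j) q = hessian_potential (r i) (l j) q.
Proof.
move=> eq; rewrite /hessian_potential !sum_shift.
have Fb k : pderiv e (l i) (pderiv e (r j) (b k)) q =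
    pderiv e (r i) (pderiv e (l j) (b k)) q.
  apply: (etrans (lambda_CR2 (l i) j k eq).2).
  apply: (etrans (pderiv_comm (l i) (l j) ae oe (aS k) eq eq)).
  exact: (etrans (esym (lambda_CR2 (l j) i k eq).2) (pderiv_comm (l j) (r i) ae oe (bS k) eq eq)).
have Fa k : pderiv e (l i) (pderiv e (r j) (a k)) q =
    pderiv e (r i) (pderiv e (l j) (a k)) q.
  apply: (etrans (lambda_CR2 (l i) j k eq).1).
  apply: (etrans (congr1 (fun z => - z) (pderiv_comm (l i) (l j) ae oe (bS k) eq eq))).
  exact: (etrans (esym (lambda_CR2 (l j) i k eq).1) (pderiv_comm (l j) (r i) ae oe (aS k) eq eq)).
move: (lambda_CR i j eq).2 (lambda_CR j i eq).2 (lambda_sym j i eq).1 Fb Fa.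
move: (pderiv e) => D CRij CRji sym Fb Fa.
under [in LHS]eq_bigr do rewrite Fb.
under [X in - 4^-1 * (_ - X + _ + _ - _ - _) = _]eq_bigr do rewrite Fa.
rewrite CRij CRji sym; congr (_ * _).
move: (\sum_k _) (\sum_k _) (D _ _ _) => A B C.
by ring.
Qed.

Lemma dholo_dantiholo (V : set M) (K : M -> R) i j q : open V -> smooth_in e V K ->
  dom e q -> V q ->
  dholo e i (dantiholo e j (fun q => (K q)%:C)) q =
  (4^-1 * (pderiv e (l i) (pderiv e (l j) K) q + pderiv e (r i) (pderiv e (r j) K) q))
  +i* (4^-1 * (pderiv e (l i) (pderiv e (r j) K) q - pderiv e (r i) (pderiv e (l j) K) q)).
Proof.
move=> oV KS eq Vq.
have -> : dantiholo e j (fun q => (K q)%:C) =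
    fun q => (2^-1 * pderiv e (l j) K q) +i* (2^-1 * pderiv e (r j) K q).
  apply/funext => q'; rewrite /dantiholo /pderivC wirtinger_antiholo /=.
  by rewrite !pderiv_cst subr0 add0r.
rewrite /dholo /pderivC wirtinger_holo /=.
have pKS s : smooth_in e V (pderiv e s K) by exact: smooth_in_pderiv.
have Z t s := pderivZ t eq Vq 2^-1 (pKS s).
move: (Z (l i) (l j)) (Z (r i) (r j)) (Z (l i) (r j)) (Z (r i) (l j)).
move: (pderiv e) => D -> -> -> ->.
move: (D (l i) _ q) (D (r i) _ q) (D (l i) _ q) (D (r i) _ q) => A B C E.
by congr (_ +i* _); field.
Qed.

(** The two Wirtinger vectors give 1/4, and the two equal diagonal entries of g carry the 1/2 of the
    wedge product. The value is - Im (dlambda_j/deta^i) / 4. If dF/deta^k = s * lambda_k, the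
    potential yields 2 * s * Im (dlambda_j/deta^i), so s = -1/8: this is the origin of the factor
    8. *)
Lemma bilinC_special i j q : dom e q ->
  bilinC g e q (vholo R i) (vantiholo R j) = (4^-1 * pderiv e (r i) (a j) q)%:C.
Proof.
move=> eq; have [gll glr grl grr] := metric_entries i j eq.
rewrite /bilinC; set G := map_mx _ (g e q).
have GE s t : (delta_mx s 0 : 'cV_(n + n))^T *m G *m (delta_mx t 0 : 'cV_(n + n)) =
    ((g e q s t)%:C)%:M.
  rewrite trmx_delta -rowE -colE; apply/matrixP => i' j'.
  by rewrite !ord1 !mxE mulr1n.
have uT : (vholo R i)^T = 2^-1 *: ((delta_mx (l i) 0)^T - 'i%C *: (delta_mx (r i) 0)^T).
  by rewrite /vholo linearZ /= linearB /= linearZ.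
rewrite uT /vantiholo -!scalemxAl mulmxBl -scalemxAl -scalemxAr mulmxDr.
rewrite -!scalemxAr !mulmxBl -!scalemxAl !GE.
rewrite gll glr grl grr !mxE mulr1n half_complex; apply/eqP; rewrite eq_complex /=.
by apply/andP; split; apply/eqP; field.
Qed.

Lemma kahler_potential_special (V : set M) (F : M -> R[i]) : open V ->
  V `<=` dom e ->
  (forall j q, V q -> dholo e j F q = (- 8^-1 * a j q) +i* (- 8^-1 * b j q)) ->
  kahler_potential g e V (special_potential e eta F).
Proof.
move=> oV Ve FE q Vq i j; have eq := Ve q Vq.
have KE q' : V q' -> special_potential e eta F q' = real_potential q'.
  by move=> Vq'; exact: special_potentialE FE.
have KS : smooth_in e V (special_potential e eta F).
  apply: (@smooth_in_ext _ _ _ _ _ real_potential) => //.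
    by move=> q' _ /KE ->.
  exact: smooth_in_sub Ve real_potential_smooth.
have KH t s : pderiv e t (pderiv e s (special_potential e eta F)) q =
    hessian_potential t s q.
  rewrite -(pderiv2_real_potential t s eq); apply: (eq_pderiv t ae oV eq Vq) => q' eq' Vq'.
  by apply: (eq_pderiv s ae oV eq' Vq') => q'' _; exact: KE.
rewrite (dholo_dantiholo i j oV KS eq Vq).
apply: (etrans (bilinC_special i j eq)).
apply: (etrans (congr1 (fun z => (4^-1 * z)%:C) (esym (hessian_laplacian i j eq)))).
move: (KH (l i) (l j)) (KH (r i) (r j)) (KH (l i) (r j)) (KH (r i) (l j)).
move: (hessian_mixed i j eq) (pderiv e) => mixed D -> -> -> ->.
by rewrite mixed subrr mulr0.
Qed.

End Prepotential.

Theorem mainTheorem5 (R : realType) (n : nat) (M : smooth_manifold R (n + n))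
    (g : tensor02 M) (J : tensor11 M) (nabla : connection M)
    (special : rigid_special_kahler g J nabla) :
  (exists (I : Type) (c e : I -> chart R (n + n) M)
      (eta lambda : I -> 'I_n -> M -> R[i]),
    locally_finite_cover (fun i => dom (c i)) /\
    forall i, special_coords g J nabla (c i) (e i) (eta i) (lambda i)) /\
  (forall (c e : chart R (n + n) M) (eta lambda : 'I_n -> M -> R[i]),
    special_coords g J nabla c e eta lambda ->
    forall p, dom c p -> exists (V : set M) (F : M -> R[i]),
      [/\ open_nbhs p V, V `<=` dom c, holomorphic J V F,
          (forall j q, V q -> lambda j q = - 8%:R * dholo e j F q) &
          kahler_potential g e V (special_potential e eta F)]).
Proof.
split; first exact: special_cover special.
move=> c e eta lambda sc p cp; have domE := special_same_dom sc.
have ep : dom e p by rewrite domE.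
have [V [F [Vp Ve hF FE]]] := ex_prepotential special sc ep.
have oV : open V by case: Vp.
exists V, F; split=> //; first by rewrite -domE.
  move=> j q Vq; rewrite FE //; apply/eqP; rewrite eq_complex.
  rewrite /re_lambda /im_lambda; case: (lambda j q) => u v /=.
  by apply/andP; split; apply/eqP; field.
exact: (kahler_potential_special special sc oV Ve FE).
Qed.
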